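(* Suppose that an equation $\mathcal L$: $L=0$ (with $L$ a differential function of order $r>1$ in two independent variables $x=(x_1,x_2)$ and one dependent variable $u$) possesses a first co-order singular set $S=\{Q^\zeta\}$ of vector fields in reduced form $Q^\zeta=\xi\partial_1+\partial_2+\zeta\partial_u$, where $\xi=\xi(x,u)$ is fixed and $\zeta$ runs through all smooth functions of $(x,u)$, and that no element of $S$ is ultra-singular for $\mathcal L$. Then, up to the equivalence of solution families, there exists a bijection between one-parametric families of solutions of $\mathcal L$ and its first co-order singular reduction operators belonging to $S$. Namely, each operator of this kind corresponds to the family of solutions which are invariant under it. (Thus the construction of all one-parametric solution families of $\mathcal L$ and the exhaustive description of its first co-order singular reduction operators belonging to $S$ are completely equivalent problems.)
   Context: All considerations are local; functions are smooth. Subscripts $1,2,u$ denote partial derivatives; $\partial_i=\partial/\partial x_i$. $J^r$ is the jet space with coordinates $x$ and $u_\alpha$, $\alpha=(\alpha_1,\alpha_2)$, $|\alpha|\le r$; $D_1,D_2$ are the total derivatives. A differential function of order $r$ is a smooth function on (a subset of) $J^r$ involving derivatives of maximal order $r$; the zero function has order $-1$. For a vector field $Q=\xi^1\partial_1+\xi^2\partial_2+\eta\partial_u$ (coefficients functions of $(x,u)$, $(\xi^1,\xi^2)\ne(0,0)$) put $Q[u]=\eta-\xi^1u_1-\xi^2u_2$ and $\mathcal Q_{(r)}=\{D_1^{a}D_2^{b}Q[u]=0,\ a+b<r\}\subset J^r$. A function $u=f(x)$ is $Q$-invariant if it solves $Q[u]=0$. Singularity co-order of $Q$ for $L$ (order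 $r$): the minimal order $k$ of differential functions $\tilde L$ with $L|_{\mathcal Q_{(r)}}=\tilde L|_{\mathcal Q_{(r)}}$. $Q$ is singular for $L$ if $k<r$, and ultra-singular if $L|_{\mathcal Q_{(r)}}\equiv0$ (co-order $-1$). A set of vector fields is first co-order singular for $L$ if all its elements are singular for $L$ and the maximum of their singularity co-orders is $1$. $Q$ is a reduction operator of $\mathcal L$ if the $r$th prolongation of $Q$ applied to $L$ vanishes on $\{L=0\}\cap\mathcal Q_{(r)}$. A first co-order singular reduction operator in $S$ is a reduction operator $Q^\zeta\in S$ of singularity co-order $1$ for $L$. A one-parametric family of solutions is a family $u=f(x,\varkappa)$ of solutions with $f_\varkappa\neq0$. Two families $u=f(x,\varkappa)$ and $u=\tilde f(x,\tilde\varkappa)$ are equivalent if they differ only by parameterization: $\tilde f(x,\theta(\varkappa))=f(x,\varkappa)$ for some function $\theta$ with $\theta_\varkappa\ne0$. For $S$ as in the claim, eliminating derivatives that involve $x_2$-differentiation on $\mathcal Q^\zeta_{(r)}$ gives a differential function $\tilde L^\zeta$ depending only on $x,u,u_1$ with $L|_{\mathcal Q^\zeta_{(r)}}=\tilde L^\zeta|_{\mathcal Q^\zeta_{(r)}}$. Standing assumption: $\tilde L^\zeta$ is of maximal rank with respect to $u$ (resp. $u_1$) if the singularity co-order of $Q^\zeta$ is $0$ (resp. $1$), i.e. $\tilde L^\zeta_u\neq0$ (resp. $\tilde L^\zeta_{u_1}\ne0$) on $\tilde L^\zeta=0$, so that $\tilde L^\zeta=0$ can be locally solved for that variable (in the local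 setting, one works near points where the system $\{L=0\}\cap\mathcal Q^\zeta_{(r)}$ is nonempty). Without loss of generality (up to point transformations) the paper takes $\xi\in\{0,u\}$.
   Formalization: Added: over the base point, whether L is defined at a point of Q^ζ_(r) depends only on x, u, u_1 (automatic if L is defined on all of J^r); it fails without this, e.g. u_1 = u_22 restricted to u_11 ≠ 0 with Q = ∂_2. The closing interpretive parenthesis is left out. *)

(* Defs.v *)
From HB Require Import structures.
From mathcomp Require Import all_boot all_order all_algebra.
From mathcomp Require Import all_classical all_reals.
From mathcomp Require Import topology normedtype derive.

Set Implicit Arguments.
Unset Strict Implicit.
Unset Printing Implicit Defensive.

Import Order.TTheory GRing.Theory Num.Theory.
Import numFieldNormedType.Exports.

Local Open Scope classical_set_scope.
Local Open Scope ring_scope.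

(* All notions are local: they are attached to a base point
   c0 = (x, u, u_1), and hold after shrinking to the part of the jet space lying
   over some neighbourhood of c0.  The base point records u_1 because the
   equation L = 0 restricted to an invariant manifold is solved for u_1, and
   distinct branches of u_1 give distinct families of solutions. *)

Section Smooth.
Variables (R : realType) (V : normedModType R).

(* Only used for V finite-dimensional and U open, where existence and continuity
   of all iterated directional derivatives is the usual C^n. *)
Fixpoint Cn (n : nat) (U : set V) (f : V -> R) : Prop :=
  (forall x, U x -> {for x, continuous f}) /\
  (if n is m.+1 then
     forall v : V, (forall x, U x -> derivable f x v) /\
                   Cn m U (fun x => 'D_v f x)
   else True).

Definition smooth_on (U : set V) (f : V -> R) : Prop := forall n, Cn n U f.

Definition smooth_near (x : V) (f : V -> R) : Prop :=
  exists U : set V, open_nbhs x U /\ smooth_on U f.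

End Smooth.

Section Jets.
Variable R : realType.

(* Points (x_1, x_2) are in R * R; points (x, u), and also points (x, k) with k
   the parameter of a family, are in R * R * R. *)

Definition multi (r : nat) : finType :=
  {ab : 'I_r.+1 * 'I_r.+1 | (ab.1 + ab.2 <= r)%N}.

Definition jet (r : nat) : normedModType R := (R * R * 'rV[R]_#|multi r|)%type.

(* The multi-index (alpha_1, alpha_2) of the i-th derivative coordinate. *)
Definition mu (r : nat) (i : 'I_#|multi r|) : nat * nat :=
  let ab := val (enum_val i : multi r) in (val ab.1, val ab.2).

(* The sum has exactly one term if a + b <= r; the value is the junk 0 if
   a + b > r. *)
Definition ucoord (r : nat) (j : jet r) (a b : nat) : R :=
  \sum_(i | mu i == (a, b)) j.2 0 i.

Definition xu (r : nat) (j : jet r) : R * R * R := (j.1, ucoord j 0 0).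

Definition xuu1 (r : nat) (j : jet r) : R * R * R * R := (xu j, ucoord j 1 0).

Definition dx1 (r : nat) (F : jet r -> R) (j : jet r) : R :=
  'D_(((1, 0), 0) : jet r) F j.
Definition dx2 (r : nat) (F : jet r -> R) (j : jet r) : R :=
  'D_(((0, 1), 0) : jet r) F j.
Definition du (r : nat) (i : 'I_#|multi r|) (F : jet r -> R) (j : jet r) : R :=
  'D_(((0, 0), delta_mx 0 i) : jet r) F j.

(* Restricted to J^r these are the total derivatives of the differential
   functions of order less than r, the only ones they are used for. *)
Definition D1 (r : nat) (F : jet r -> R) (j : jet r) : R :=
  dx1 F j + \sum_(i | ((mu i).1 + (mu i).2 < r)%N)
              ucoord j (mu i).1.+1 (mu i).2 * du i F j.
Definition D2 (r : nat) (F : jet r -> R) (j : jet r) : R :=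
  dx2 F j + \sum_(i | ((mu i).1 + (mu i).2 < r)%N)
              ucoord j (mu i).1 (mu i).2.+1 * du i F j.

Definition pd1 (g : R * R -> R) (x : R * R) : R := 'D_((1, 0) : R * R) g x.
Definition pd2 (g : R * R -> R) (x : R * R) : R := 'D_((0, 1) : R * R) g x.

Definition jet_of (r : nat) (g : R * R -> R) (x : R * R) : jet r :=
  (x, \row_i iter (mu i).1 pd1 (iter (mu i).2 pd2 g) x).

Record vfield := VField {
  xi1 : R * R * R -> R;
  xi2 : R * R * R -> R;
  eta : R * R * R -> R }.

Definition reduced (xi zeta : R * R * R -> R) : vfield :=
  VField xi (fun=> 1) zeta.

Definition qchar (r : nat) (Q : vfield) (j : jet r) : R :=
  eta Q (xu j) - xi1 Q (xu j) * ucoord j 1 0 - xi2 Q (xu j) * ucoord j 0 1.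

Definition qman (r : nat) (Q : vfield) : set (jet r) :=
  [set j | forall a b : nat, (a + b < r)%N ->
             iter a (@D1 r) (iter b (@D2 r) (qchar Q)) j = 0].

(* Coefficients of the prolongation, by the usual recursion
   eta^(alpha + delta_i) = D_i eta^alpha - sum_k (D_i xi^k) u_(alpha + delta_k),
   which, unlike the closed formula, involves no derivative of order r + 1. *)
Fixpoint pcoef2 (r : nat) (Q : vfield) (b : nat) : jet r -> R :=
  if b is b'.+1 then fun j =>
    D2 (pcoef2 Q b') j
    - D2 (fun j' : jet r => xi1 Q (xu j')) j * ucoord j 1 b'
    - D2 (fun j' : jet r => xi2 Q (xu j')) j * ucoord j 0 b'.+1
  else fun j => eta Q (xu j).

Fixpoint pcoef (r : nat) (Q : vfield) (a b : nat) : jet r -> R :=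
  if a is a'.+1 then fun j =>
    D1 (pcoef Q a' b) j
    - D1 (fun j' : jet r => xi1 Q (xu j')) j * ucoord j a'.+1 b
    - D1 (fun j' : jet r => xi2 Q (xu j')) j * ucoord j a' b.+1
  else pcoef2 Q b.

Definition prolong (r : nat) (Q : vfield) (F : jet r -> R) (j : jet r) : R :=
  xi1 Q (xu j) * dx1 F j + xi2 Q (xu j) * dx2 F j
  + \sum_i pcoef Q (mu i).1 (mu i).2 j * du i F j.

(* The order is an integer, the zero function having order -1 and a nonzero
   function of x alone order 0. *)
Definition order_le (r : nat) (W : set (jet r)) (F : jet r -> R) (k : int) :
  Prop :=
  match k with
  | Posz n => forall j j', W j -> W j' -> j.1 = j'.1 ->
      (forall a b, (a + b <= n)%N -> ucoord j a b = ucoord j' a b) ->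
      F j = F j'
  | Negz 0 => forall j, W j -> F j = 0
  | Negz _ => False
  end.

Definition diff_order (r : nat) (W : set (jet r)) (F : jet r -> R) (k : int) :
  Prop :=
  order_le W F k /\ (forall k', order_le W F k' -> k <= k').

Definition agree_on_qman (r : nat) (W : set (jet r)) (Q : vfield)
  (F G : jet r -> R) : Prop :=
  forall j, W j -> qman Q j -> F j = G j.

Definition over (r : nat) (Omega : set (jet r)) (N : set (R * R * R * R)) :
  set (jet r) :=
  Omega `&` [set j | N (xuu1 j)].

Section Equation.
Variables (r : nat) (Omega : set (jet r)) (L : jet r -> R).
Variable c0 : R * R * R * R.

Definition represented (Q : vfield) (N : set (R * R * R * R)) (F : jet r -> R)
  (k : int) : Prop :=
  [/\ open_nbhs c0 N, smooth_on (over Omega N) F,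
      diff_order (over Omega N) F k & agree_on_qman (over Omega N) Q L F].

Definition coorder (Q : vfield) (k : int) : Prop :=
  (exists N F, represented Q N F k) /\
  (forall k' N F, represented Q N F k' -> k <= k').

Definition singular (Q : vfield) : Prop :=
  exists k : int, coorder Q k /\ k < r%:Z.

Definition ultra_singular (Q : vfield) : Prop :=
  exists N, open_nbhs c0 N /\
    agree_on_qman (over Omega N) Q L (fun=> 0).

Definition reduction_operator (Q : vfield) : Prop :=
  exists N, open_nbhs c0 N /\
    (forall j, over Omega N j -> L j = 0 -> qman Q j -> prolong Q L j = 0).

Section ReducedForm.
Variable xi : R * R * R -> R.

(* The germs of smooth zeta at (x, u) such that L is defined at some point of
   the invariant manifold over c0; for the others the restriction of L to this
   manifold is void near c0. *)
Definition inS (zeta : R * R * R -> R) : Prop :=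
  smooth_near c0.1 zeta /\
  (exists j, [/\ Omega j, qman (reduced xi zeta) j & xuu1 j = c0]).

Definition first_coorder_singular : Prop :=
  (forall zeta, inS zeta ->
     singular (reduced xi zeta) /\
     (forall k, coorder (reduced xi zeta) k -> k <= 1)) /\
  (exists zeta, inS zeta /\ coorder (reduced xi zeta) 1).

(* Whether L is defined at a point of an invariant manifold is decided by the
   coordinates (x, u, u_1) that remain after the elimination, so that the
   restriction of L is a function of these.  This is automatic if L is defined
   on the whole jet space. *)
Definition eliminable_domain : Prop :=
  forall zeta j j', smooth_near c0.1 zeta ->
    qman (reduced xi zeta) j -> qman (reduced xi zeta) j' ->
    xuu1 j = c0 -> xuu1 j' = c0 -> Omega j -> Omega j'.

(* l is the function \tilde L^zeta(x, u, u_1), unique as a germ at c0. *)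
Definition max_rank (zeta : R * R * R -> R) : Prop :=
  forall l : R * R * R * R -> R, smooth_near c0 l ->
    (exists N, open_nbhs c0 N /\
       agree_on_qman (over Omega N) (reduced xi zeta) L (fun j => l (xuu1 j))) ->
    (coorder (reduced xi zeta) 0 ->
       \forall c \near c0,
         l c = 0 -> 'D_((0, 0, 1, 0) : R * R * R * R) l c <> 0) /\
    (coorder (reduced xi zeta) 1 ->
       \forall c \near c0,
         l c = 0 -> 'D_((0, 0, 0, 1) : R * R * R * R) l c <> 0).

(* First co-order singular reduction operators in S, at a base point over which
   the system {L = 0, Q[u] = 0} has points. *)
Definition singular_reduction_operator (zeta : R * R * R -> R) : Prop :=
  [/\ inS zeta,
      exists j, [/\ Omega j, qman (reduced xi zeta) j, xuu1 j = c0 & L j = 0],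
      coorder (reduced xi zeta) 1 &
      reduction_operator (reduced xi zeta)].

(* A family is a pair (f, k0) of f(x, k) and the base value k0 of its parameter;
   c0.1.1 is the base value of x. *)
Definition invariant_family (fk : (R * R * R -> R) * R)
  (zeta : R * R * R -> R) : Prop :=
  \forall p \near (c0.1.1, fk.2),
    qchar (reduced xi zeta) (jet_of r (fun y => fk.1 (y, p.2)) p.1) = 0.

End ReducedForm.

Definition solution_family (fk : (R * R * R -> R) * R) : Prop :=
  let: (f, k0) := fk in
  [/\ smooth_near (c0.1.1, k0) f,
      xuu1 (jet_of r (fun y => f (y, k0)) c0.1.1) = c0,
      \forall p \near (c0.1.1, k0), 'D_((0, 0, 1) : R * R * R) f p <> 0 &
      \forall p \near (c0.1.1, k0),
        Omega (jet_of r (fun y => f (y, p.2)) p.1) /\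
        L (jet_of r (fun y => f (y, p.2)) p.1) = 0].

Definition family_equiv (fk gk : (R * R * R -> R) * R) : Prop :=
  exists theta : R -> R,
    [/\ smooth_near fk.2 theta, theta fk.2 = gk.2,
        \forall k \near fk.2, derive1 theta k <> 0 &
        \forall p \near (c0.1.1, fk.2), gk.1 (p.1, theta p.2) = fk.1 p].

Definition germ_eq (zeta zeta' : R * R * R -> R) : Prop :=
  \forall z \near c0.1, zeta z = zeta' z.

End Equation.
End Jets.

(* rel is the graph of a bijection between A modulo eA and B modulo eB. *)
Definition bijection_mod (X Y : Type) (A : X -> Prop) (eA : X -> X -> Prop)
  (B : Y -> Prop) (eB : Y -> Y -> Prop) (rel : X -> Y -> Prop) : Prop :=
  [/\ forall a, A a -> exists2 b, B b & rel a b,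
      forall b, B b -> exists2 a, A a & rel a b &
      forall a a' b b', A a -> A a' -> B b -> B b' -> rel a b -> rel a' b' ->
        (eA a a' <-> eB b b')].

(* Main.v *)
(** On the invariant manifold of [Q = xi d_1 + d_2 + zeta d_u] the function [L]
    restricts to a function [l (x, u, u_1)].  For a family [f (x, k)] of solutions
    the parameter can be eliminated from [u = f (x, k)], so that
    [zeta := f_2 + xi f_1] becomes a function of [(x, u)].  As [l] vanishes along the
    family, maximal rank excludes co-order 0; hence [l = 0] is equivalent to
    [u_1 = G (x, u)] and consists of the jets of the family, along which the
    prolongation of [Q] differentiates [L] as a derivative of [l] tangent to
    [l = 0].  Conversely, a reduction operator of co-order 1 leaves [u_1 = G]
    invariant, which is the Frobenius condition for [u_1 = G], [u_2 = zeta - xi G];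
    the family is the general solution of this system.  Two families with the same
    [zeta] solve the same system, so the change of parameter does not depend on [x]. *)

Require Import Defs.
From HB Require Import structures.
From mathcomp Require Import all_boot all_order all_algebra.
From mathcomp Require Import all_classical all_reals.
From mathcomp Require Import topology normedtype landau derive.
From mathcomp Require Import realfun sequences exp measure lebesgue_measure lebesgue_integral ftc.
From mathcomp Require Import ring lra.
(* Again, since the libraries shadow [over]. *)
Require Import Defs.

Import Order.TTheory GRing.Theory Num.Theory.
Import numFieldNormedType.Exports.

Set Implicit Arguments.
Unset Strict Implicit.
Unset Printing Implicit Defensive.

Local Open Scope classical_set_scope.
Local Open Scope ring_scope.

(** * Functions of class C^k *)

Section Differentiability.
Variable R : realType.

(** Smoothness is given through iterated directional derivatives, which by themselves yield no chain
    rule; hence the passage to Frechet differentiability in [Ck]. The implicit function theorem and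
    the smooth dependence of solutions on parameters are built on it; in both the unknown is scalar,
    so that monotonicity, Picard iteration and variation of constants suffice. The real obstacle is
    the prolongation. [L] equals [l (x, u, u_1)] only on the invariant manifold, so nothing is known
    about its transversal derivatives, whereas [prolong] uses all partial derivatives of [L]. The
    prolonged field must be shown tangent to the manifold, although the closed formula for its
    coefficients involves derivatives of order r + 1. For this a jet on the manifold is realized by
    a polynomial whose characteristic vanishes at the point together with its derivatives up to
    order r. Pushing the jets of this polynomial onto the manifold does not change their first
    derivative there, and in the direction (xi, 1) this derivative is the prolonged field. *)

Lemma diff_of_bound (V W : normedModType R) (f : V -> W) x (L : {linear V -> W}) :
  continuous L ->
  (forall e, 0 < e -> \forall h \near (0 : V), `|f (h + x) - f x - L h| <= e * `|h|) ->
  differentiable f x /\ 'd f x = L :> (V -> W).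
Proof.
move=> cL H.
have E : f \o shift x = cst (f x) + L +o_ 0 id.
  apply/eqaddoP => e e0; move: (H e e0); apply: filterS => h /=.
  suff -> : ((f \o shift x) - (cst (f x) + L)) h = f (h + x) - f x - L h by [].
  by rewrite !fctE /= opprD addrA.
have dE := diff_unique cL E.
split => //; apply/diff_locallyP; split; first by rewrite dE.
by rewrite dE.
Qed.

Lemma derivable_line (V W : normedModType R) (f : V -> W) (y v : V) (s : R) :
  derivable f (y + s *: v) v ->
  is_derive s 1 (fun t : R => f (y + t *: v)) ('D_v f (y + s *: v)).
Proof.
move=> df.
have E : (fun h : R => h^-1 *: ((fun t => f (y + t *: v)) (h *: 1 + s) - f (y + s *: v)))
   = (fun h => h^-1 *: (f (h *: v + (y + s *: v)) - f (y + s *: v))).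
  by apply/funext => h; rewrite (_ : h *: (1 : R) = h) ?[h *: 1]mulr1 // scalerDl addrCA.
by split; rewrite /derivable /derive /= E.
Qed.

(** Reparametrizing the segment by [s] in [0, 1] treats both signs of [c] at once; the price is that
    the intermediate point is located only by its absolute value. *)
Lemma mvt_dir (V : normedModType R) (f : V -> R) (y v : V) (c : R) :
  (forall t : R, `|t| <= `|c| -> derivable f (y + t *: v) v) ->
  exists2 t, `|t| <= `|c| & f (y + c *: v) - f y = c * 'D_v f (y + t *: v).
Proof.
move=> df.
have cs (s : R) : s \in `[0, 1]%R -> `|c * s| <= `|c|.
  by rewrite in_itv /= => /andP[s0 s1]; rewrite normrM ler_piMr // ger0_norm.
have dg (s : R) : s \in `[0, 1]%R ->
    is_derive s 1 (fun s : R => f (y + (c * s) *: v)) (c * 'D_v f (y + (c * s) *: v)).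
  move=> /cs/df/derivable_line dl.
  have dc : is_derive s (1 : R) (fun s : R => c * s) c.
    by apply: (is_derive_eq (is_deriveZ c (is_derive_id s (1 : R)))); rewrite /GRing.scale /= mulr1.
  have := @is_derive1_comp R (fun t : R => f (y + t *: v)) (fun s => c * s) s _ _ dl dc.
  by rewrite mulrC.
have [|s sin E] := MVT_segment (@ler01 R) (fun s sin => dg s (subset_itv_oo_cc sin)).
  by apply: derivable_within_continuous => s /dg[].
exists (c * s); first exact: cs.
by move: E; rewrite mulr0 mulr1 scale0r addr0 subr0 mulr1.
Qed.

(** Finite dimension is encoded by a reconstruction formula with continuous coordinate functionals
    instead of a basis. *)
Definition coords (V : normedModType R) n (b : 'I_n -> V)
    (c : 'I_n -> {linear V -> R}) :=
  (forall i, continuous (c i)) /\ (forall v, v = \sum_i c i v *: b i).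

Class fd (V : normedModType R) : Prop :=
  fdP : exists n (b : 'I_n -> V) (c : 'I_n -> {linear V -> R}), coords b c.

Lemma linear_functional_bound (V : normedModType R) (L : {linear V -> R}) : continuous L ->
  exists2 C, 0 < C & forall h, `|L h| <= C * `|h|.
Proof.
move=> cL; have /linear_boundedP := (linear_bounded_continuous L).2 cL.
case=> M [Mr HM]; exists (Num.max 1 (M + 1)); first by rewrite lt_max ltr01.
by move=> h; apply: HM; rewrite lt_max ltrDl ltr01 orbT.
Qed.

Lemma uniform_coords_bound (V : normedModType R) n (b : 'I_n -> V) (c : 'I_n -> {linear V -> R}) :
  coords b c -> exists2 C, 0 < C & forall i h, `|c i h| <= C * `|h|.
Proof.
move=> [cc bc].
have /choice[CC HC] : forall i, exists C, 0 < C /\ forall h, `|c i h| <= C * `|h|.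
  by move=> i; have [C C0 HC] := linear_functional_bound (cc i); exists C.
exists (1 + \sum_i CC i).
  by rewrite ltr_pwDl // sumr_ge0 // => i _; rewrite ltW //; case: (HC i).
move=> i h; have [_ /(_ h) /le_trans] := HC i; apply.
rewrite ler_wpM2r // (bigD1 i) //= addrCA lerDl addr_ge0 // sumr_ge0 // => j _.
by rewrite ltW //; case: (HC j).
Qed.

(** The increment is split into steps that change one coordinate each; the mean value theorem and
    the continuity of the partial derivatives at [x] control every step. *)
Lemma C1_differentiable (V : normedModType R) n (b : 'I_n -> V)
    (c : 'I_n -> {linear V -> R}) (f : V -> R) x :
  coords b c ->
  (\forall y \near x, forall i, derivable f y (b i)) ->
  (forall i, {for x, continuous (fun y => 'D_(b i) f y)}) ->
  differentiable f x.
Proof.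
move=> /[dup] bc [cc bcE] df cf.
pose L (h : V) : R := \sum_i c i h * 'D_(b i) f x.
have linL : linear L.
  move=> a u v; rewrite /L scaler_sumr -big_split /=; apply: eq_bigr => i _.
  by rewrite linearP /= mulrDl /GRing.scale /= mulrA.
pose LL := GRing.isLinear.Build _ _ _ _ L linL.
pose Ll : {linear V -> R} := HB.pack L LL.
have Lc : continuous Ll.
  apply: (@continuous_big _ _ _ _ predT) => [|i _]; first exact: add_continuous.
  by move=> y; apply: cvgM; [apply: cc|exact: cvg_cst].
suff [] : differentiable f x /\ 'd f x = Ll :> (V -> R) by [].
apply: diff_of_bound => // e e0.
have [C C0 Cb] := uniform_coords_bound bc.
pose B := 1 + \sum_i `|b i|.
have B0 : 0 < B by rewrite ltr_pwDl // sumr_ge0.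
have Bb i : `|b i| <= B.
  by rewrite /B (bigD1 i) //= addrCA lerDl addr_ge0 // sumr_ge0.
(* There are [n] steps, each with an error of at most [C * |h| * e'], so the total stays below
   [e * |h|]; the summand 1 covers [n = 0]. *)
pose e' := e / (n%:R * C + 1).
have nC : 0 < n%:R * C + 1 by rewrite ltr_wpDl // mulr_ge0 // ltW.
have e'0 : 0 < e' by rewrite divr_gt0.
have : \forall y \near x, forall i, derivable f y (b i) /\
    `|'D_(b i) f y - 'D_(b i) f x| <= e'.
  have K : \forall y \near x, forall i, `|'D_(b i) f y - 'D_(b i) f x| <= e'.
    apply: filter_forall => j.
    have /cvgrPdist_le /(_ _ e'0) := cf j.
    by apply: filterS => z; rewrite distrC.
  by apply: filterS2 df K => y Hy Ky i; split; [exact: Hy|exact: Ky].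
move=> /nbhs_ballP[d /= d0 dH].
(* The partial sum [p k] has norm at most [n * C * B * |h|], and the intermediate point of the next
   step adds one more [C * B * |h|]; thus [|h| < d / D] keeps everything in the ball. *)
pose D := (n.+1%:R * (C * B)).
have D0 : 0 < D by rewrite mulr_gt0 // mulr_gt0.
apply/nbhs_ballP; exists (d / D); first by rewrite /= divr_gt0.
move=> h; rewrite -ball_normE /= sub0r normrN ltr_pdivlMr // => hd.
pose p k := \sum_(i < n | (i < k)%N) c i h *: b i.
have pn : p n = h by rewrite [RHS]bcE /p; apply: eq_bigl => i; rewrite ltn_ord.
have step (k : 'I_n) : p k.+1 = p k + c k h *: b k.
  rewrite /p (bigD1 k) //= addrC; congr (_ + _); apply: eq_bigl => i.
  by rewrite ltnS [in RHS]ltn_neqAle andbC -(inj_eq val_inj) /=.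
have pb k (t : R) (j : 'I_n) : `|t| <= C * `|h| -> ball x d (x + p k + t *: b j).
  move=> th; rewrite -ball_normE /= -addrA opprD addNKr normrN.
  apply: le_lt_trans hd; rewrite /D.
  apply: (le_trans (ler_normD _ _)); rewrite mulrC -addn1 natrD mulrDl mul1r mulrDl.
  apply: lerD; last first.
    by rewrite normrZ mulrAC; apply: ler_pM.
  rewrite /p; apply: (le_trans (ler_norm_sum _ _ _)).
  apply: (@le_trans _ _ (\sum_(i < n) C * B * `|h|)).
    rewrite big_mkcond /=; apply: ler_sum => i _; case: ifP => _.
      by rewrite normrZ mulrAC; apply: ler_pM.
    by rewrite mulr_ge0 // mulr_ge0 // ltW.
  by rewrite sumr_const card_ord -[_ *+ n]mulr_natl mulrA.
have tele : f (h + x) - f x = \sum_(k < n) (f (x + p k.+1) - f (x + p k)).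
  rewrite -(big_mkord predT (fun k => f (x + p k.+1) - f (x + p k))) telescope_sumr //.
  by rewrite pn [x + h]addrC /p big_pred0 ?addr0 // => i; rewrite ltn0.
rewrite /Ll /= /L tele -sumrB.
apply: (le_trans (ler_norm_sum _ _ _)).
apply: (@le_trans _ _ (\sum_(k < n) C * `|h| * e')); last first.
  rewrite sumr_const card_ord -[_ *+ n]mulr_natl.
  have -> : n%:R * (C * `|h| * e') = (n%:R * C / (n%:R * C + 1)) * (e * `|h|).
    by rewrite /e'; field; rewrite gt_eqF.
  rewrite ler_piMl //; first by rewrite mulr_ge0 // ltW.
  by rewrite ler_pdivrMr // mul1r lerDl.
apply: ler_sum => k _.
have [|t tc E] := @mvt_dir V f (x + p k) (b k) (c k h).
  move=> t tc; have := dH (x + p k + t *: b k) => /=; case/(_ _ k) => //.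
  by apply: pb; exact: (le_trans tc).
rewrite step addrA E -mulrBr normrM; apply: ler_pM => //.
by have [|_] := dH (x + p k + t *: b k) _ k => //; apply: pb; exact: (le_trans tc).
Qed.

End Differentiability.

Section Ck.
Variable R : realType.
Implicit Types (V W X : normedModType R).

(** In contrast to [Cn] this asks for Frechet differentiability, which gives the chain rule, and
    admits vector values. For real functions on open sets of finite-dimensional spaces both notions
    agree, see [smooth_Coo]. *)
Fixpoint Ck V W (n : nat) (U : set V) (f : V -> W) : Prop :=
  if n is m.+1 then
    (forall x, U x -> differentiable f x) /\
    (forall v, Ck m U (fun x => 'D_v f x))
  else forall x, U x -> {for x, continuous f}.

Definition Coo V W (U : set V) (f : V -> W) := forall n, Ck n U f.

Lemma Ck_cont V W n (U : set V) (f : V -> W) x :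
  Ck n U f -> U x -> {for x, continuous f}.
Proof.
by case: n => [|n] /=; [exact|move=> [df _] /df /differentiable_continuous].
Qed.

Lemma CkW V W n (U : set V) (f : V -> W) : Ck n.+1 U f -> Ck n U f.
Proof.
elim: n f => [|n IH] f [df Df]; first by move=> x /df /differentiable_continuous.
by split => // v; apply: IH; exact: Df.
Qed.

Lemma Ck_sub V W n (U U' : set V) (f : V -> W) : U' `<=` U -> Ck n U f -> Ck n U' f.
Proof.
move=> UU; elim: n f => [|n IH] f; first by move=> cf x /UU; exact: cf.
by move=> [df Df]; split => [x /UU Ux|v]; [exact: (df x Ux)|apply: IH; exact: Df].
Qed.

Lemma near_open V (x : V) (P : V -> Prop) : (\forall y \near x, P y) ->
  exists A : set V, [/\ open A, A x & forall y, A y -> P y].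
Proof.
move=> Px; have := Px; rewrite -[X in X -> _]/(nbhs x P) nbhsE => -[A [oA Ax] AP].
by exists A.
Qed.

Lemma open_near V (x : V) (A : set V) (P : V -> Prop) : open A -> A x ->
  (forall y, A y -> P y) -> \forall y \near x, P y.
Proof. by move=> oA Ax AP; apply: filterS (open_nbhs_nbhs (conj oA Ax)). Qed.

Lemma near_shift0 V (x : V) (P : V -> Prop) :
  (\forall y \near x, P y) -> \forall h \near (0 : V), P (h + x).
Proof.
move=> /nbhs_ballP[d d0 H]; apply/nbhs_ballP; exists d => // h.
rewrite -ball_normE /= sub0r normrN => hd; apply: H.
by rewrite -ball_normE /= opprD addrCA subrr addr0 normrN.
Qed.

Lemma near_eq_differentiable V W (f g : V -> W) x :
  (\forall y \near x, f y = g y) -> differentiable f x -> differentiable g x.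
Proof.
move=> fg df.
suff [] : differentiable g x /\ 'd g x = 'd f x :> (V -> W) by [].
apply: diff_of_bound; first by apply: (diff_continuous df).
move=> e e0.
have /eqaddoP /(_ _ e0) := diff_locally df.
have fg0 : \forall h \near (0 : V), f (h + x) = g (h + x) by exact: near_shift0 fg.
apply: filterS2 fg0 => h fgh.
have fgx := nbhs_singleton fg.
suff -> : ((f \o shift x) - (cst (f x) + 'd f x)) h = g (h + x) - g x - 'd f x h by [].
by rewrite -fgh -fgx !fctE /= opprD addrA.
Qed.

Lemma near_eq_continuous V W (f g : V -> W) x :
  (\forall y \near x, f y = g y) -> {for x, continuous f} -> {for x, continuous g}.
Proof.
move=> fg cf; rewrite /prop_for /continuous_at -(nbhs_singleton fg).
apply: cvg_trans cf; apply: near_eq_cvg.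
by apply: filterS fg => y ->.
Qed.

Lemma Ck_eq V W n (U : set V) (f g : V -> W) :
  open U -> (forall x, U x -> f x = g x) -> Ck n U f -> Ck n U g.
Proof.
move=> oU; elim: n f g => [|n IH] f g fg.
  move=> cf x Ux; apply: near_eq_continuous (cf x Ux).
  by apply: (open_near oU Ux) => y; exact: fg.
have nfg x : U x -> \forall y \near x, f y = g y.
  by move=> Ux; apply: (open_near oU Ux) => y; exact: fg.
move=> [df Df]; split => [x Ux|v].
  exact: near_eq_differentiable (nfg x Ux) (df x Ux).
apply: (IH (fun x => 'D_v f x)); last exact: Df.
by move=> x Ux; apply: near_eq_derive; exact: nfg.
Qed.

Lemma Ck_cst V W n (U : set V) (a : W) : Ck n U (fun=> a).
Proof.
elim: n a => [|n IH] a; first by move=> x _; exact: cvg_cst.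
split => [x _|v]; first exact: differentiable_cst.
by have -> : (fun x => 'D_v (fun=> a) x) = (fun=> 0) :> (V -> W);
  [apply/funext => x; exact: derive_cst|].
Qed.

Lemma derive_linear V W (f : {linear V -> W}) x v : continuous f -> 'D_v f x = f v.
Proof. by move=> cf; rewrite deriveE ?diff_lin //; exact: linear_differentiable. Qed.

Lemma Ck_linear V W n (U : set V) (f : {linear V -> W}) : continuous f -> Ck n U f.
Proof.
move=> cf; case: n => [|n]; first by move=> x _; exact: cf.
split => [x _|v]; first exact: linear_differentiable.
have -> : (fun x => 'D_v f x) = (fun=> f v) by apply/funext => x; exact: derive_linear.
exact: Ck_cst.
Qed.

Lemma derive_lin_comp V W X (L : {linear W -> X}) (f : V -> W) x v :
  continuous L -> differentiable f x -> 'D_v (L \o f) x = L ('D_v f x).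
Proof.
move=> cL df; rewrite !deriveE //; last first.
  by apply: differentiable_comp => //; exact: linear_differentiable.
by rewrite diff_comp /= ?diff_lin //; exact: linear_differentiable.
Qed.

Lemma Ck_lin_comp V W X n (U : set V) (L : {linear W -> X}) (f : V -> W) :
  open U -> continuous L -> Ck n U f -> Ck n U (L \o f).
Proof.
move=> oU cL; elim: n f => [|n IH] f.
  by move=> cf x Ux; apply: continuous_comp; [exact: cf|exact: cL].
move=> [df Df]; split => [x Ux|v].
  by apply: differentiable_comp; [exact: (df x Ux)|exact: linear_differentiable].
apply: (Ck_eq oU _ (IH _ (Df v))) => x Ux /=.
by rewrite derive_lin_comp //; exact: (df x Ux).
Qed.

Lemma CkD V W n (U : set V) (f g : V -> W) :
  open U -> Ck n U f -> Ck n U g -> Ck n U (fun x => f x + g x).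
Proof.
move=> oU; elim: n f g => [|n IH] f g.
  by move=> cf cg x Ux; apply: cvgD; [exact: cf|exact: cg].
move=> [df Df] [dg Dg]; split => [x Ux|v].
  exact: differentiableD (df x Ux) (dg x Ux).
apply: (Ck_eq oU _ (IH _ _ (Df v) (Dg v))) => x Ux /=.
by rewrite -deriveD //; apply: diff_derivable; [exact: (df x Ux)|exact: (dg x Ux)].
Qed.

Lemma Ck_sum V W n (U : set V) I (s : seq I) (P : pred I) (f : I -> V -> W) :
  open U -> (forall i, P i -> Ck n U (f i)) -> Ck n U (fun x => \sum_(i <- s | P i) f i x).
Proof.
move=> oU H; elim: s => [|i s IH].
  by apply: (Ck_eq oU _ (Ck_cst n U 0)) => x _; rewrite big_nil.
case: (boolP (P i)) => Pi.
  by apply: (Ck_eq oU _ (CkD oU (H i Pi) IH)) => x _; rewrite big_cons Pi.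
by apply: (Ck_eq oU _ IH) => x _; rewrite big_cons (negbTE Pi).
Qed.

Lemma CkM V n (U : set V) (f g : V -> R) :
  open U -> Ck n U f -> Ck n U g -> Ck n U (fun x => f x * g x).
Proof.
move=> oU; elim: n f g => [|n IH] f g.
  by move=> cf cg x Ux; apply: cvgM; [exact: cf|exact: cg].
move=> Cf Cg; have [df Df] := Cf; have [dg Dg] := Cg; split => [x Ux|v].
  exact: differentiableM (df x Ux) (dg x Ux).
apply: (Ck_eq oU _ (CkD oU (IH _ _ (CkW Cf) (Dg v)) (IH _ _ (CkW Cg) (Df v)))) => x Ux /=.
by rewrite -deriveM //; apply: diff_derivable; [exact: (df x Ux)|exact: (dg x Ux)].
Qed.

Lemma CkN V n (U : set V) (f : V -> R) : open U -> Ck n U f -> Ck n U (fun x => - f x).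
Proof.
move=> oU Cf; apply: (Ck_eq oU _ (CkM oU (Ck_cst n U (-1 : R)) Cf)) => x _.
by rewrite mulN1r.
Qed.

Lemma CkB V n (U : set V) (f g : V -> R) :
  open U -> Ck n U f -> Ck n U g -> Ck n U (fun x => f x - g x).
Proof. by move=> oU Cf Cg; apply: CkD => //; exact: CkN. Qed.

Lemma CkV V n (U : set V) (f : V -> R) :
  open U -> (forall x, U x -> f x != 0) -> Ck n U f -> Ck n U (fun x => (f x)^-1).
Proof.
move=> oU f0; elim: n => [|n IH] Cf.
  by move=> x Ux; apply: cvgV; [exact: f0|exact: Cf].
have [df Df] := Cf; have CV := IH (CkW Cf); split => [x Ux|v].
  by apply: differentiableV; [exact: (df x Ux)|exact: f0].
apply: (Ck_eq oU _ (CkM oU (CkN oU (Df v)) (CkM oU CV CV))) => x Ux /=.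
rewrite (deriveV (f0 x Ux)); last by apply: diff_derivable; exact: (df x Ux).
by rewrite /GRing.scale /= expr2 invfM mulNr mulrC mulNr.
Qed.

Lemma scale_cvgl V (b : V) : continuous (fun a : R => a *: b).
Proof. by move=> x; apply: scalel_continuous. Qed.

Definition scall V (b : V) (a : R) : V := a *: b.
Lemma scall_linear V (b : V) : linear (scall b).
Proof. by move=> a x y; rewrite /scall scalerDl scalerA. Qed.
HB.instance Definition _ V (b : V) :=
  GRing.isLinear.Build R R V _ (scall b) (scall_linear b).

Lemma Ck_coords V W n m (b : 'I_m -> W) (c : 'I_m -> {linear W -> R})
    (U : set V) (f : V -> W) :
  open U -> coords b c -> (forall i, Ck n U (c i \o f)) -> Ck n U f.
Proof.
move=> oU [cc bc] Cf.
apply: (@Ck_eq _ _ _ _ (fun x => \sum_i (scall (b i) \o (c i \o f)) x)); [by []|by move=> x _; rewrite [RHS]bc|].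
apply: Ck_sum => // i _; apply: Ck_lin_comp => //; exact: scale_cvgl.
Qed.

Lemma derive_comp V W X (f : V -> W) (g : W -> X) x v :
  differentiable f x -> differentiable g (f x) ->
  'D_v (g \o f) x = 'D_('D_v f x) g (f x).
Proof.
move=> df dg; rewrite !deriveE //; last exact: differentiable_comp.
by rewrite diff_comp.
Qed.

Lemma derive_coords V n (b : 'I_n -> V) (c : 'I_n -> {linear V -> R}) (f : V -> R) x v :
  coords b c -> differentiable f x -> 'D_v f x = \sum_i c i v * 'D_(b i) f x.
Proof.
move=> [_ bc] df; rewrite deriveE // [in LHS](bc v) linear_sum.
by apply: eq_bigr => i _; rewrite linearZ /= deriveE.
Qed.

(** The derivative of [g] at [f x] is taken in the direction ['D_v f x], which varies with [x].
    Coordinates on [W] turn it into a sum of products of functions with fixed directions, to which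
    the induction hypothesis applies. *)
Lemma Ck_compR V W n (U : set V) (U' : set W) (f : V -> W) (g : W -> R) :
  fd W -> open U -> (forall x, U x -> U' (f x)) ->
  Ck n U f -> Ck n U' g -> Ck n U (g \o f).
Proof.
move=> [m [b [c bc]]] oU UU; elim: n f g UU => [|n IH] f g UU.
  by move=> cf cg x Ux; apply: continuous_comp; [exact: cf|apply: cg; exact: UU].
move=> Cf Cg; have [df Df] := Cf; have [dg Dg] := Cg; split => [x Ux|v].
  by apply: differentiable_comp; [exact: (df x Ux)|exact: (dg _ (UU _ Ux))].
apply: (@Ck_eq _ _ _ _ (fun x => \sum_i (c i \o (fun x => 'D_v f x)) x *
   ((fun y => 'D_(b i) g y) \o f) x)) => // [x Ux|].
  have dfx := df x Ux; have dgx := dg _ (UU _ Ux).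
  by rewrite derive_comp // (derive_coords _ bc).
apply: Ck_sum => // i _; apply: CkM => //.
  by apply: Ck_lin_comp => //; [case: bc|exact: Df].
by apply: (IH _ _ UU (CkW Cf)); exact: Dg.
Qed.

Lemma Ck_comp V W X n (U : set V) (U' : set W) (f : V -> W) (g : W -> X) :
  fd W -> fd X -> open U -> open U' -> (forall x, U x -> U' (f x)) ->
  Ck n U f -> Ck n U' g -> Ck n U (g \o f).
Proof.
move=> fW [m [b [c bc]]] oU oU' UU Cf Cg.
apply: (Ck_coords oU bc) => i.
apply: (@Ck_compR _ _ _ _ U' f (c i \o g)) => //.
by apply: Ck_lin_comp => //; case: bc.
Qed.

Lemma Ck_id V n (U : set V) : Ck n U (fun x => x).
Proof. by apply: (@Ck_linear V V n U idfun) => x; exact: cvg_id. Qed.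

(** For functions obtained from existence theorems only derivatives along selected directions are at
    hand; [C1_differentiable] supplies the differential. *)
Lemma Ck_basis V n m (b : 'I_m -> V) (c : 'I_m -> {linear V -> R}) (U : set V) (f : V -> R) :
  open U -> coords b c -> (forall i x, U x -> derivable f x (b i)) ->
  (forall i, Ck n U (fun x => 'D_(b i) f x)) -> Ck n.+1 U f.
Proof.
move=> oU bc df Df.
have dif x : U x -> differentiable f x.
  move=> Ux; apply: (C1_differentiable bc).
    by apply: (open_near oU Ux) => y Uy i; exact: df.
  by move=> i; exact: Ck_cont (Df i) Ux.
split => // v.
apply: (@Ck_eq _ _ _ _ (fun x => \sum_i c i v * 'D_(b i) f x)) => // [x Ux|].
  by rewrite (derive_coords _ bc) //; exact: (dif x Ux).
by apply: Ck_sum => // i _; apply: CkM => //; exact: Ck_cst.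
Qed.

Lemma Cn_Ck V n (U : set V) (f : V -> R) : fd V -> open U -> Cn n U f -> Ck n U f.
Proof.
move=> [m [b [c bc]]] oU.
elim: n f => [|n IH] f; first by case.
move=> [_ H]; apply: (Ck_basis oU bc) => [i|i]; first by case: (H (b i)).
by apply: IH; case: (H (b i)).
Qed.

Lemma Ck_Cn V n (U : set V) (f : V -> R) : Ck n U f -> Cn n U f.
Proof.
elim: n f => [|n IH] f Cf; first by split => // x; exact: Cf.
split=> [x Ux|v]; first exact: Ck_cont Cf Ux.
have [df Df] := Cf; split => [x Ux|]; last exact: IH (Df v).
by apply: diff_derivable; exact: (df x Ux).
Qed.

Lemma smooth_Coo V (U : set V) (f : V -> R) : fd V -> open U -> smooth_on U f <-> Coo U f.
Proof. by move=> fV oU; split => H n; [apply: Cn_Ck|apply: Ck_Cn; exact: H]. Qed.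

Lemma smooth_nearP V (x : V) (f : V -> R) : fd V ->
  smooth_near x f <-> exists U, [/\ open U, U x & Coo U f].
Proof.
move=> fV; split; last by move=> [U [oU Ux /(smooth_Coo f fV oU) sf]]; exists U.
by move=> [U [[oU Ux] /(smooth_Coo f fV oU) sf]]; exists U.
Qed.

Lemma Coo_derive V W (U : set V) (f : V -> W) v : Coo U f -> Coo U (fun x => 'D_v f x).
Proof. by move=> Cf n; have [_] := Cf n.+1; exact. Qed.

Lemma Coo_diff V W (U : set V) (f : V -> W) x : Coo U f -> U x -> differentiable f x.
Proof. by move=> /(_ 1) [df _] Ux; exact: (df x Ux). Qed.

Lemma Coo_cont V W (U : set V) (f : V -> W) x : Coo U f -> U x -> {for x, continuous f}.
Proof. by move=> /(_ 0); exact. Qed.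

End Ck.

Section Finite_dim.
Variable R : realType.

#[global] Instance fd_R : fd R.
Proof.
exists 1, (fun=> 1), (fun=> idfun); split => [i x|v]; first exact: cvg_id.
by rewrite big_ord1 /=; rewrite /GRing.scale /= mulr1.
Qed.

(** Every vector of the system lies on one of the two axes, so that a function on a product, such as
    one of time and parameter, can be examined in each factor separately ([Ck_axes]). *)
Lemma fd_prod_axes (V W : normedModType R) : fd V -> fd W ->
  exists n (b : 'I_n -> (V * W)%type) (c : 'I_n -> {linear (V * W)%type -> R}),
    coords b c /\ forall i, (exists v, b i = (v, 0)) \/ (exists w, b i = (0, w)).
Proof.
move=> [m [b [c bc]]] [n [b' [c' bc']]].
exists (m + n)%N, (fun i : 'I_(m + n) => match fintype.split i with inl i => (b i, 0) | inr j => (0, b' j) end),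
  (fun i : 'I_(m + n) => match fintype.split i with
     | inl i => [the {linear (V * W)%type -> R} of c i \o fst]
     | inr j => [the {linear (V * W)%type -> R} of c' j \o snd] end).
split; last by move=> i; case: fintype.split => j; [left; exists (b j)|right; exists (b' j)].
split => [i|[v w]].
  case: fintype.split => j x; apply: continuous_comp.
  - exact: cvg_fst.
  - by case: bc => + _; exact.
  - exact: cvg_snd.
  - by case: bc' => + _; exact.
rewrite big_split_ord /=.
rewrite (eq_bigr (fun i => (c i v *: b i, 0 : W))); last first.
  by move=> i _; rewrite (unsplitK (inl i)) /=; congr pair; exact: scaler0.
rewrite [X in _ + X](eq_bigr (fun i => (0 : V, c' i w *: b' i))); last first.
  by move=> i _; rewrite (unsplitK (inr i)) /=; congr pair; exact: scaler0.
have S1 k (F : 'I_k -> V) : \sum_i (F i, 0 : W) = (\sum_i F i, 0).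
  by elim/big_rec2: _ => // i x y _ ->; congr pair; exact: addr0.
have S2 k (F : 'I_k -> W) : \sum_i (0 : V, F i) = (0, \sum_i F i).
  by elim/big_rec2: _ => // i x y _ ->; congr pair; exact: addr0.
case: bc => _ bc; case: bc' => _ bc'; rewrite S1 S2 -bc -bc'.
by congr pair; [rewrite /= addr0|rewrite /= add0r].
Qed.

#[global] Instance fd_prod (V W : normedModType R) : fd V -> fd W -> fd (V * W)%type.
Proof.
by move=> fV fW; have [n [b [c [bc _]]]] := fd_prod_axes fV fW; exists n, b, c.
Qed.

Definition rcoord n (i : 'I_n) (v : 'rV[R]_n) : R := v 0 i.
Lemma rcoord_linear n (i : 'I_n) : linear (@rcoord n i).
Proof. by move=> a u v; rewrite /rcoord !mxE. Qed.
HB.instance Definition _ n (i : 'I_n) :=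
  GRing.isLinear.Build R 'rV[R]_n R _ (@rcoord n i) (@rcoord_linear n i).

Lemma coords_rV n : coords (fun i : 'I_n => delta_mx 0 i : 'rV[R]_n) (@rcoord n).
Proof. by split => [i v|v]; [exact: coord_continuous|exact: row_sum_delta]. Qed.

#[global] Instance fd_rV n : fd 'rV[R]_n.
Proof.
by exists n, (fun i => delta_mx 0 i), (@rcoord n); exact: coords_rV.
Qed.

#[global] Instance fd_jet r : fd (jet R r).
Proof. exact: fd_prod. Qed.

End Finite_dim.

(** * Functions on products and the symmetry of second derivatives *)

Section Products.
Variable R : realType.
Implicit Types (V W X : normedModType R).

Definition inl_lin V W (v : V) : V * W := (v, 0).
Lemma inl_linear V W : linear (@inl_lin V W).
Proof. by move=> a x y; congr pair; rewrite /= scaler0 addr0. Qed.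
HB.instance Definition _ V W := GRing.isLinear.Build R V (V * W)%type _ (@inl_lin V W) (@inl_linear V W).

Definition inr_lin V W (w : W) : V * W := (0, w).
Lemma inr_linear V W : linear (@inr_lin V W).
Proof. by move=> a x y; congr pair; rewrite /= scaler0 addr0. Qed.
HB.instance Definition _ V W := GRing.isLinear.Build R W (V * W)%type _ (@inr_lin V W) (@inr_linear V W).

Lemma Ck_pair V W X n (U : set V) (f : V -> W) (g : V -> X) :
  open U -> Ck n U f -> Ck n U g -> Ck n U (fun x => (f x, g x)).
Proof.
move=> oU Cf Cg.
apply: (@Ck_eq _ _ _ _ _ (fun x => ((@inl_lin W X) \o f) x + ((@inr_lin W X) \o g) x)) => // [x _|].
  by congr pair; rewrite /= ?addr0 ?add0r.
apply: CkD => //; apply: Ck_lin_comp => // x.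
  by apply: cvg_pair; [exact: cvg_id|exact: cvg_cst].
by apply: cvg_pair; [exact: cvg_cst|exact: cvg_id].
Qed.

Lemma Ck_fst V W n (U : set (V * W)) : Ck n U (fst : V * W -> V).
Proof. by apply: Ck_linear => x; exact: cvg_fst. Qed.

Lemma Ck_snd V W n (U : set (V * W)) : Ck n U (snd : V * W -> W).
Proof. by apply: Ck_linear => x; exact: cvg_snd. Qed.

Lemma Ck_row V m n (U : set V) (f : V -> 'rV[R]_m) :
  open U -> (forall i, Ck n U (fun x => f x 0 i)) -> Ck n U f.
Proof. by move=> oU H; apply: (Ck_coords oU (@coords_rV R m)) => i; exact: H. Qed.

Lemma derive_pair V W X (f : V -> W) (g : V -> X) x v :
  differentiable f x -> differentiable g x ->
  'D_v (fun y => (f y, g y)) x = ('D_v f x, 'D_v g x).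
Proof.
move=> df dg; rewrite !deriveE //; last exact: differentiable_pair.
by rewrite diff_pair.
Qed.

Lemma Ck_axes V W n (U : set (V * W)) (f : V * W -> R) : fd V -> fd W -> open U ->
  (forall v x, U x -> derivable f x (v, 0)) ->
  (forall w x, U x -> derivable f x (0, w)) ->
  (forall v, Ck n U (fun x => 'D_((v, 0) : V * W) f x)) ->
  (forall w, Ck n U (fun x => 'D_((0, w) : V * W) f x)) ->
  Ck n.+1 U f.
Proof.
move=> fV fW oU d1 d2 C1 C2.
have [m [b [c [bc ax]]]] := fd_prod_axes fV fW.
apply: (Ck_basis oU bc) => [i x Ux|i].
  by case: (ax i) => -[z ->]; [exact: d1|exact: d2].
by case: (ax i) => -[z ->]; [exact: C1|exact: C2].
Qed.

Lemma near_line V (x v : V) (P : V -> Prop) :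
  (\forall y \near x, P y) -> \forall h \near (0 : R), P (x + h *: v).
Proof.
move=> Px.
have : (fun h : R => x + h *: v) @ (0 : R) --> x.
  rewrite -[X in _ --> X]addr0 -(scale0r v).
  by apply: cvgD; [exact: cvg_cst|exact: scalel_continuous].
by move/(_ _ Px).
Qed.

Lemma near0_small (P : R -> Prop) : (\forall h \near (0 : R), P h) ->
  exists2 d, 0 < d & forall h, `|h| <= d -> P h.
Proof.
move=> /nbhs_ballP[d /= d0 H]; exists (d / 2); first by rewrite divr_gt0.
move=> h hd; apply: H; rewrite -ball_normE /= sub0r normrN.
by apply: le_lt_trans hd _; rewrite ltr_pdivrMr // ltr_pMr // ltr1n.
Qed.

Lemma cont_dist_le V W (f : V -> W) x (e : R) :
  {for x, continuous f} -> 0 < e -> \forall y \near x, `|f x - f y| <= e.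
Proof. by move=> cf e0; have /cvgrPdist_le /(_ _ e0) := cf. Qed.

(** The mean value theorem is applied to [y |-> f (y + h w) - f y] along [v], and then to ['D_v f]
    along [w]. *)
Lemma second_difference V (U : set V) (f : V -> R) x v w h :
  0 < h -> Ck 2 U f ->
  (forall s t : R, `|s| <= h -> `|t| <= h -> U (x + s *: v + t *: w)) ->
  exists s t : R, [/\ `|s| <= h, `|t| <= h &
    f (x + h *: v + h *: w) - f (x + h *: v) - (f (x + h *: w) - f x)
      = h * (h * 'D_w (fun y => 'D_v f y) (x + s *: v + t *: w))].
Proof.
move=> h0 [df Df] Uin.
have [dDv _] : Ck 1 U (fun y => 'D_v f y) := Df v.
have h_h : `|h| = h by rewrite gtr0_norm.
pose g y := f (y + h *: w) - f y.
have dg y : U y -> U (y + h *: w) -> is_derive y v g ('D_v f (y + h *: w) - 'D_v f y).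
  move=> Uy Uyw; apply: is_deriveB; last first.
    by apply: derivableP; apply: diff_derivable; exact: (df y Uy).
  have dsh : differentiable (fun y => y + h *: w) y by exact: differentiableD.
  have df' := df _ Uyw.
  split.
    by apply: diff_derivable; exact: (@differentiable_comp _ _ _ _ (fun y => y + h *: w) f).
  rewrite (@derive_comp _ _ _ _ (fun y => y + h *: w) f) //.
  rewrite deriveD ?derive_id ?derive_cst ?addr0 //; exact: derivable_cst.
have h00 : `|0 : R| <= h by rewrite normr0 ltW.
have hh0 : `|h| <= h by rewrite h_h.
have Uin0 (s : R) : `|s| <= h -> U (x + s *: v).
  by move=> sh; have := Uin s 0 sh h00; rewrite scale0r addr0.
have [|s sh E] := @mvt_dir R V g x v h.
  by rewrite h_h => t th; have [] := dg _ (Uin0 t th) (Uin t h th hh0).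
rewrite h_h in sh.
have [|t th E'] := @mvt_dir R V (fun y => 'D_v f y) (x + s *: v) w h.
  by rewrite h_h => t th; apply: diff_derivable; exact: (dDv _ (Uin s t sh th)).
rewrite h_h in th; exists s, t; split => //.
by rewrite -E'; have [_ <-] := dg _ (Uin0 s sh) (Uin s h sh hh0); rewrite -E.
Qed.

(** The second difference is symmetric in [v] and [w]. Computing it in both orders makes the two
    mixed derivatives equal at two points close to [x], and their continuity gives equality at [x]
    up to any [e]. *)
Lemma schwarz V (U : set V) (f : V -> R) x v w :
  open U -> U x -> Ck 2 U f -> 'D_v (fun y => 'D_w f y) x = 'D_w (fun y => 'D_v f y) x.
Proof.
move=> oU Ux Cf; have [_ Df] := Cf.
have [_ Cv] : Ck 1 U (fun y => 'D_v f y) := Df v.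
have [_ Cw] : Ck 1 U (fun y => 'D_w f y) := Df w.
apply/eqP; rewrite -subr_eq0 -normr_le0; apply/ler_addgt0Pr => e e0; rewrite add0r.
have e2 : 0 < e / 2 by rewrite divr_gt0.
have NU : \forall y \near x, U y by apply: open_nbhs_nbhs.
set A := fun y => 'D_v (fun y => 'D_w f y) y.
set B := fun y => 'D_w (fun y => 'D_v f y) y.
have N1 := cont_dist_le (Cw v x Ux : {for x, continuous A}) e2.
have N2 := cont_dist_le (Cv w x Ux : {for x, continuous B}) e2.
have /nbhs_ballP[d /= d0 H] : \forall y \near x, [/\ U y,
    `|A x - A y| <= e / 2 & `|B x - B y| <= e / 2].
  apply: filterS3 NU N1 N2 => y Uy Ay By; split; [exact Uy|exact Ay|exact By].
pose M := `|v| + `|w| + 1.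
have M0 : 0 < M by rewrite ltr_wpDl // addr_ge0.
(* Then [h * (|v| + |w|) = d / 2 - h], so the whole parallelogram lies in the ball of radius [d]. *)
pose h := d / (2 * M).
have h0 : 0 < h by rewrite divr_gt0 // mulr_gt0.
have inB (s t : R) : `|s| <= h -> `|t| <= h -> ball x d (x + s *: v + t *: w).
  move=> sh th; rewrite -ball_normE /= -addrA opprD addNKr normrN.
  apply: (le_lt_trans (ler_normD _ _)); rewrite !normrZ.
  apply: (@le_lt_trans _ _ (h * M - h)).
    rewrite /M mulrDr mulr1 addrK mulrDr.
    by apply: lerD; apply: ler_wpM2r.
  have -> : h * M = d / 2 by rewrite /h; field; rewrite gt_eqF.
  by move: d0 h0; lra.
have Uin (s t : R) : `|s| <= h -> `|t| <= h -> U (x + s *: v + t *: w).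
  by move=> sh th; case: (H _ (inB s t sh th)).
have [s [t [sh th E1]]] := second_difference h0 Cf Uin.
have [t' [s' [th' sh' E2]]] : exists t s : R, [/\ `|t| <= h, `|s| <= h &
    f (x + h *: w + h *: v) - f (x + h *: w) - (f (x + h *: v) - f x)
      = h * (h * 'D_v (fun y => 'D_w f y) (x + t *: w + s *: v))].
  by apply: (second_difference h0 Cf) => a b ah bh; rewrite addrAC; exact: Uin.
have EE : B (x + s *: v + t *: w) = A (x + s' *: v + t' *: w).
  have h1 := mulfI (lt0r_neq0 h0).
  have E : h * (h * B (x + s *: v + t *: w)) = h * (h * A (x + t' *: w + s' *: v)).
    by apply: etrans (esym E1) (etrans _ E2); rewrite [x + h *: w + _]addrAC; ring.
  by rewrite [x + s' *: v + _]addrAC; exact: h1 (h1 _ _ E).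
have [_ _ K1] := H _ (inB s t sh th).
have [_ K2 _] := H _ (inB s' t' sh' th').
rewrite -/(A x) -/(B x) (splitr e); apply: le_trans (lerD K2 K1).
rewrite EE [X in _ <= _ + X]distrC.
by apply: le_trans (ler_normD _ _); rewrite addrA subrK.
Qed.

End Products.

(** * Implicit functions and ordinary differential equations *)

Section Implicit_function.
Variable R : realType.

Lemma mvt_bound (V : normedModType R) (f : V -> R) (y v : V) (c K : R) :
  (forall t : R, `|t| <= `|c| -> derivable f (y + t *: v) v) ->
  (forall t : R, `|t| <= `|c| -> `|'D_v f (y + t *: v)| <= K) ->
  `|f (y + c *: v) - f y| <= `|c| * K.
Proof.
move=> df Kf; have [t tc ->] := mvt_dir df.
by rewrite normrM ler_wpM2l //; exact: Kf.
Qed.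

Lemma cont_pairl (V W : normedModType R) (v : V) (w : W) :
  {for v, continuous (fun v' : V => (v', w))}.
Proof. by apply: differentiable_continuous; exact: differentiable_pair. Qed.

(** As the eliminated variable is real, existence comes from the intermediate value theorem and
    uniqueness from strict monotonicity in it; no contraction argument is involved. *)
Lemma implicit_function_pos (V : normedModType R) (F : V * R -> R) (U : set (V * R)) v0 k0 :
  fd V -> open U -> U (v0, k0) -> Coo U F -> F (v0, k0) = 0 ->
  0 < 'D_((0, 1) : V * R) F (v0, k0) ->
  exists (A : set V) (e : R) (phi : V -> R),
    [/\ open A, A v0, 0 < e, Coo A phi &
     (forall v, A v -> `|phi v - k0| < e /\ F (v, phi v) = 0) /\
     (forall v k, A v -> `|k - k0| < e ->
        U (v, k) /\ 'D_((0, 1) : V * R) F (v, k) != 0 /\ (F (v, k) = 0 -> k = phi v))].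
Proof.
move=> fV oU U0 CF F0 Fk.
pose Fk' := fun z => 'D_((0, 1) : V * R) F z.
(* A uniform lower bound for the last partial derivative: it yields the monotonicity in [k], and the
   continuity of [phi] through [c * |phi v' - phi v| <= |F (v', phi v)|]. *)
pose c := Fk' (v0, k0) / 2.
have c0 : 0 < c by rewrite divr_gt0.
have CFk : Coo U Fk' by exact: Coo_derive.
have /nbhs_ballP[r /= r0 Hr] : \forall z \near (v0, k0), U z /\ c < Fk' z.
  have N1 : \forall z \near (v0, k0), U z by apply: open_nbhs_nbhs.
  have N2 : \forall z \near (v0, k0), c < Fk' z.
    apply: (cvgr_gt (Fk' (v0, k0)) (Coo_cont CFk U0)).
    by rewrite /c ltr_pdivrMr // ltr_pMr // ltr1n.
  by apply: filterS2 N1 N2 => z a b; split.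
(* If [k] and [k'] are within [e] of [k0], the intermediate point [k + t] is within [3 * e < r]. *)
pose e := r / 4.
have e0 : 0 < e by rewrite divr_gt0.
have er : e < r by rewrite /e; move: r0; lra.
have inB v k : ball v0 r v -> `|k - k0| < r -> U (v, k) /\ c < Fk' (v, k).
  move=> Bv Bk; apply: Hr; split => //=; rewrite -ball_normE /= distrC //.
have line (v : V) (k t : R) : (v, k) + t *: (0, 1) = (v, k + t) :> V * R.
  by congr pair => /=; rewrite ?scaler0 ?addr0 // [t *: 1]mulr1.
have dF v k : ball v0 r v -> `|k - k0| < r -> derivable F (v, k) (0, 1).
  move=> Bv Bk; apply: diff_derivable; apply: Coo_diff CF _.
  by have [] := inB v k Bv Bk.
have mv v k k' : ball v0 r v -> `|k - k0| <= e -> `|k' - k0| <= e ->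
   exists t, [/\ `|t| <= `|k' - k|, `|k + t - k0| < r & F (v, k') - F (v, k) = (k' - k) * Fk' (v, k + t)].
  move=> Bv ke ke'.
  have kk : `|k' - k| <= e + e.
    rewrite (_ : k' - k = (k' - k0) - (k - k0)); last by ring.
    by apply: le_trans (ler_normB _ _) _; apply: lerD.
  have inr (t : R) : `|t| <= `|k' - k| -> `|k + t - k0| < r.
    move=> tk; rewrite addrAC; apply: le_lt_trans (ler_normD _ _) _.
    apply: (@le_lt_trans _ _ (e + (e + e))); last by rewrite /e; move: r0; lra.
    by apply: lerD => //; apply: le_trans tk kk.
  have [|t tk] := @mvt_dir R _ F (v, k) (0, 1) (k' - k).
    by move=> t tk; rewrite line; apply: dF => //; exact: inr.
  rewrite !line addrCA subrr addr0 => E.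
  by exists t; split => //; exact: inr.
have mono v k k' : ball v0 r v -> `|k - k0| <= e -> `|k' - k0| <= e -> F (v, k) = F (v, k') -> k = k'.
  move=> Bv ke ke' E; have [t [_ tr]] := mv v k k' Bv ke ke'.
  rewrite E subrr => /esym/eqP; rewrite mulf_eq0 => /orP[|].
    by rewrite subr_eq0 => /eqP.
  by have [_ /(lt_trans c0)] := inB v _ Bv tr; rewrite lt0r => /andP[/negbTE ->].
have B0 : ball v0 r v0 by exact: ballxx.
have k0k0 : `|k0 - k0| <= e by rewrite subrr normr0 ltW.
have kpe : `|k0 + e - k0| <= e by rewrite addrAC subrr add0r gtr0_norm.
have kme : `|k0 - e - k0| <= e by rewrite addrAC subrr add0r normrN gtr0_norm.
have Fp : 0 < F (v0, k0 + e).
  have [t [_ tr]] := mv v0 k0 (k0 + e) B0 k0k0 kpe.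
  rewrite F0 subr0 addrAC subrr add0r => ->; rewrite mulr_gt0 //.
  by have [_] := inB v0 _ B0 tr; exact: lt_trans.
have Fm : F (v0, k0 - e) < 0.
  have [t [_ tr]] := mv v0 k0 (k0 - e) B0 k0k0 kme.
  rewrite F0 subr0 addrAC subrr add0r => ->; rewrite mulNr oppr_lt0 mulr_gt0 //.
  by have [_] := inB v0 _ B0 tr; exact: lt_trans.
have Fcont v k : ball v0 r v -> `|k - k0| <= e -> {for v, continuous (fun v' => F (v', k))}.
  move=> Bv ke; have [Uvk _] := inB v k Bv (le_lt_trans ke er).
  apply: (@continuous_comp _ _ _ (fun v' => (v', k)) F).
    exact: cont_pairl.
  exact: Coo_cont CF Uvk.
have /nbhs_ballP[d /= d0 Hd] : \forall v \near v0, [/\ ball v0 r v, 0 < F (v, k0 + e) & F (v, k0 - e) < 0].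
  have N1 : \forall v \near v0, ball v0 r v by exact: nbhsx_ballx.
  have N2 : \forall v \near v0, 0 < F (v, k0 + e).
    by apply: (cvgr_gt (F (v0, k0 + e)) (Fcont v0 _ B0 kpe)).
  have N3 : \forall v \near v0, F (v, k0 - e) < 0.
    by apply: (cvgr_lt (F (v0, k0 - e)) (Fcont v0 _ B0 kme)).
  apply: filterS3 N1 N2 N3 => v a1 a2 a3; split; [exact a1|exact a2|exact a3].
pose A := ball v0 d.
have oA : open A by exact: ball_open.
have /choice[phi Hphi] : forall v, exists k, A v -> `|k - k0| < e /\ F (v, k) = 0.
  move=> v; have [Av|nAv] := pselect (A v); last by exists 0.
  have [Bv Fp' Fm'] := Hd v Av.
  have inke k : k \in `[k0 - e, k0 + e]%R -> `|k - k0| <= e.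
    by rewrite in_itv /= => /andP[a b]; rewrite ler_norml; move: a b; lra.
  have [|||k kin Fk0] := @IVT R (fun k => F (v, k)) (k0 - e) (k0 + e) 0.
  - by move: e0; lra.
  - apply: derivable_within_continuous => k /inke ke.
    apply/derivable1_diffP; apply: (@differentiable_comp _ _ _ _ (fun k => (v, k)) F).
      by apply: differentiable_pair.
    by apply: Coo_diff CF _; have [] := inB v k Bv (le_lt_trans ke er).
  - by rewrite ge_min le_max (ltW Fm') (ltW Fp') orbT.
  exists k => _; split => //; rewrite lt_neqAle inke // andbT.
  apply/eqP => ke; move: kin; rewrite in_itv /= => /andP[ka kb].
  have [kk|kk] := leP 0 (k - k0).
    have kE : k = k0 + e by move: ke; rewrite ger0_norm //; lra.
    by move: Fp'; rewrite -kE Fk0 ltxx.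
  have kE : k = k0 - e by move: ke; rewrite ltr0_norm //; lra.
  by move: Fm'; rewrite -kE Fk0 ltxx.
have uniq v k : A v -> `|k - k0| < e -> F (v, k) = 0 -> k = phi v.
  move=> Av ke E; have [pe pE] := Hphi v Av; have [Bv _ _] := Hd v Av.
  by apply: (mono v) => //; [exact: ltW|exact: ltW|rewrite E pE].
have cphi v : A v -> {for v, continuous phi}.
  move=> Av; have [pe pE] := Hphi v Av; have [Bv _ _] := Hd v Av.
  apply/cvgrPdist_lt => eps eps0.
  have ce : 0 < c * eps by rewrite mulr_gt0.
  have /cvgrPdist_lt /(_ _ ce) N1 := Fcont v _ Bv (ltW pe).
  have N2 : \forall v' \near v, A v' by apply: open_nbhs_nbhs.
  apply: filterS2 N1 N2 => v' H Av'.
  have [pe' pE'] := Hphi v' Av'; have [Bv' _ _] := Hd v' Av'.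
  have [t [_ tr]] := mv v' (phi v) (phi v') Bv' (ltW pe) (ltW pe').
  rewrite pE' sub0r; have [_ cF] := inB v' _ Bv' tr => E.
  have F0' : 0 < Fk' (v', phi v + t) := lt_trans c0 cF.
  rewrite -(ltr_pM2l c0); apply: le_lt_trans H.
  rewrite pE sub0r E normrM [`|Fk' _|]gtr0_norm // distrC mulrC.
  by rewrite ler_wpM2l // ltW.
have dphi v w : A v -> is_derive v w phi (- ('D_((w, 0) : V * R) F (v, phi v) / Fk' (v, phi v))).
  move=> Av; have [pe pE] := Hphi v Av; have [Bv _ _] := Hd v Av.
  set l := (X in is_derive _ _ _ X).
  suff cv : (fun h : R => h^-1 *: (phi (h *: w + v) - phi v)) @ 0^' --> l.
    by split; [apply/cvg_ex; exists l|apply: cvg_lim].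
  pose Fw := fun z => 'D_((w, 0) : V * R) F z.
  have CFw : Coo U Fw by exact: Coo_derive.
  have per : `|phi v - k0| < r by apply: lt_trans er.
  have [Uv cFv] := inB v _ Bv per.
  (* The difference quotient of [phi] is minus the quotient of two partial derivatives of [F], but
     the two mean value theorems place numerator and denominator at different points; hence a
     function of a pair of points, continuous at the diagonal point. *)
  pose Psi (zz : (V * R) * (V * R)) := - (Fw zz.1 / Fk' zz.2).
  have cPsi : {for ((v, phi v), (v, phi v)), continuous Psi}.
    apply: cvgN; apply: cvgM.
      by apply: (@continuous_comp _ _ _ fst Fw); [exact: cvg_fst|exact: Coo_cont CFw Uv].
    apply: cvgV; first by rewrite gt_eqF // (lt_trans c0).
    by apply: (@continuous_comp _ _ _ snd Fk'); [exact: cvg_snd|exact: Coo_cont CFk Uv].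
  apply/cvgrPdist_le => eps eps0.
  have /cvgrPdist_le /(_ _ eps0) /nbhs_ballP[de /= de0 Hde] := cPsi.
  have Np : \forall h \near (0 : R), [/\ A (v + h *: w), ball v de (v + h *: w), `|phi v - phi (v + h *: w)| < de & ball v r (v + h *: w)].
    apply: (@near_line _ _ v w (fun v' => [/\ A v', ball v de v', `|phi v - phi v'| < de & ball v r v'])).
    have N1 : \forall v' \near v, A v' by apply: open_nbhs_nbhs.
    have N2 : \forall v' \near v, ball v de v' by exact: nbhsx_ballx.
    have N4 : \forall v' \near v, ball v r v' by exact: nbhsx_ballx.
    have /cvgrPdist_lt /(_ _ de0) N3 := cphi v Av.
    have : \forall v' \near v, A v' /\ ball v de v' by apply: filterS2 N1 N2 => z a b; split.
    by move: N4; apply: filterS3 N3 => v' a b [c1 c2]; split; [exact c1|exact c2|exact a|exact b].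
  have [h1 h10 Hh1] := near0_small Np.
  apply/nbhs_ballP; exists h1 => //= h; rewrite -ball_normE /= sub0r normrN => hh1 hn0.
  have Hh (s : R) : `|s| <= `|h| -> [/\ A (v + s *: w), ball v de (v + s *: w), `|phi v - phi (v + s *: w)| < de & ball v r (v + s *: w)].
    by move=> sh; apply: Hh1; apply: le_trans sh (ltW hh1).
  have [Ah Bh phh _] := Hh h (lexx _).
  have [peh pEh] := Hphi _ Ah; have [Bvh _ _] := Hd _ Ah.
  have lineV (s : R) : (v, phi v) + s *: (w, 0) = (v + s *: w, phi v) :> V * R.
    by congr pair => /=; rewrite scaler0 addr0.
  have [|s sh] := @mvt_dir R _ F (v, phi v) (w, 0) h.
    move=> s /Hh [As _ _ _]; have [Bs _ _] := Hd _ As; rewrite lineV.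
    by apply: diff_derivable; apply: Coo_diff CF _; have [] := inB _ (phi v) Bs per.
  rewrite !lineV pE subr0 => E1.
  have [t [ts tr]] := mv _ (phi v) (phi (v + h *: w)) Bvh (ltW pe) (ltW peh).
  rewrite pEh sub0r E1 => E2.
  have [Uh ch] := inB _ _ Bvh tr.
  have fk0 : Fk' (v + h *: w, phi v + t) != 0 by rewrite gt_eqF // (lt_trans c0).
  have -> : h^-1 *: (phi (h *: w + v) - phi v) = Psi ((v + s *: w, phi v), (v + h *: w, phi v + t)).
    have E3 : phi (v + h *: w) - phi v = - (h * Fw (v + s *: w, phi v)) / Fk' (v + h *: w, phi v + t).
      by apply: (mulIf fk0); rewrite divfK //; exact: esym E2.
    by rewrite [h *: w + v]addrC E3 /GRing.scale /Psi /=; field; apply/andP; split.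
  have [_ Bs _ _] := Hh s sh.
  apply: Hde; split; split => //=.
  - exact: ballxx.
  - rewrite -ball_normE /= opprD addNKr normrN.
    by apply: le_lt_trans ts _; rewrite distrC.
exists A, e, phi; split => //.
- exact: ballxx.
(* Bootstrap: the derivatives of [phi] are quotients of smooth functions evaluated on its graph,
   hence as regular as [phi] is already known to be. *)
- elim=> [|n IH]; first exact: cphi.
  have [m [b [cc bc]]] := fV.
  apply: (Ck_basis oA bc) => [i v Av|i].
    by have [] := dphi v (b i) Av.
  apply: (@Ck_eq _ _ _ _ _ (fun v => - ('D_((b i, 0) : V * R) F (v, phi v) * (Fk' (v, phi v))^-1))) => // [v Av|].
    by have [_ ->] := dphi v (b i) Av.
  have Cg : Ck n A (fun v => (v, phi v)) by apply: Ck_pair => //; exact: Ck_id.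
  have Ug v : A v -> U (v, phi v).
    by move=> Av; have [pe _] := Hphi v Av; have [Bv _ _] := Hd v Av; have [] := inB v _ Bv (lt_trans pe er).
  have Fg v : A v -> Fk' (v, phi v) != 0.
    move=> Av; have [pe _] := Hphi v Av; have [Bv _ _] := Hd v Av; have [_ cv] := inB v _ Bv (lt_trans pe er).
    by rewrite gt_eqF // (lt_trans c0).
  apply: CkN => //; apply: CkM => //.
    exact: (@Ck_compR _ _ _ _ _ _ _ (fun z => 'D_((b i, 0) : V * R) F z) _ oA Ug Cg (Coo_derive _ CF n)).
  by apply: CkV => //; exact: (@Ck_compR _ _ _ _ _ _ _ Fk' _ oA Ug Cg (CFk n)).
- split => // v k Av ke; have [Bv _ _] := Hd v Av.
  have [Uk ck] := inB v k Bv (lt_trans ke er).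
  split => //; split; last exact: uniq.
  by rewrite -/(Fk' _) gt_eqF // (lt_trans c0).
Qed.

Theorem implicit_function (V : normedModType R) (F : V * R -> R) (U : set (V * R)) v0 k0 :
  fd V -> open U -> U (v0, k0) -> Coo U F -> F (v0, k0) = 0 ->
  'D_((0, 1) : V * R) F (v0, k0) != 0 ->
  exists (A : set V) (e : R) (phi : V -> R),
    [/\ open A, A v0, 0 < e, Coo A phi &
     (forall v, A v -> `|phi v - k0| < e /\ F (v, phi v) = 0) /\
     (forall v k, A v -> `|k - k0| < e ->
        U (v, k) /\ 'D_((0, 1) : V * R) F (v, k) != 0 /\ (F (v, k) = 0 -> k = phi v))].
Proof.
move=> fV oU U0 CF F0 Fk.
have [Fp|] := ltP 0 ('D_((0, 1) : V * R) F (v0, k0)); first exact: implicit_function_pos.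
rewrite le_eqVlt (negbTE Fk) /= => Fn.
have DN z : U z -> 'D_((0, 1) : V * R) (fun z => - F z) z = - 'D_((0, 1) : V * R) F z.
  by move=> Uz; rewrite deriveN //; apply: diff_derivable; exact: Coo_diff CF Uz.
have CN : Coo U (fun z => - F z) by move=> n; apply: CkN.
have [||A [e [phi [oA A0 e0 Cphi [H1 H2]]]]] := implicit_function_pos fV oU U0 CN.
- by rewrite F0 oppr0.
- by rewrite DN // oppr_gt0.
exists A, e, phi; split => //; split => [v /H1 [? /eqP]|v k Av ke].
  by rewrite oppr_eq0 => /eqP.
have [Uk [Dk uk]] := H2 v k Av ke; split => //; split.
  by move: Dk; rewrite DN // oppr_eq0.
by move=> E; apply: uk; rewrite E oppr0.
Qed.

End Implicit_function.

(** * Antiderivatives, the Gronwall inequality and Picard iteration *)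

Section Primitive.
Variable R : realType.
Implicit Types (a t : R) (g G : R -> R).

Lemma near_dist (V : normedModType R) (x y : V) a :
  `|y - x| < a -> \forall z \near y, `|z - x| < a.
Proof.
move=> ya; have : nbhs y (ball x a).
  by apply: open_nbhs_nbhs; split; [exact: ball_open|rewrite -ball_normE /= distrC].
by apply: filterS => z; rewrite -ball_normE /= distrC.
Qed.

(** [G t] is the integral of [g] from [t0] to [t], on both sides of [t0]. In this form an integral
    equation is a differential equation, and integrals are estimated by the mean value theorem. *)
Definition primitive t0 a g G :=
  G t0 = 0 /\ forall t, `|t - t0| < a -> is_derive t 1 G (g t).

Lemma primitive_bound t0 a g G t (K : R) : primitive t0 a g G -> `|t - t0| < a ->
  (forall s, `|s - t0| <= `|t - t0| -> `|g s| <= K) -> `|G t| <= `|t - t0| * K.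
Proof.
move=> [G0 dG] ta gK.
have E (s : R) : t0 + s *: 1 = t0 + s :> R by rewrite [s *: 1]mulr1.
have inI (s : R) : `|s| <= `|t - t0| -> `|t0 + s - t0| <= `|t - t0|.
  by move=> sl; rewrite addrAC subrr add0r.
have := @mvt_bound R _ G t0 1 (t - t0) K; rewrite E G0 subr0 addrCA subrr addr0.
apply => s sl; rewrite E; have [// _ ->] := dG (t0 + s) (le_lt_trans (inI s sl) ta).
exact/gK/inI.
Qed.

Lemma primitiveB t0 a g G g' G' : primitive t0 a g G -> primitive t0 a g' G' ->
  primitive t0 a (fun s => g s - g' s) (fun s => G s - G' s).
Proof.
move=> [G0 dG] [G0' dG']; split; first by rewrite G0 G0' subrr.
by move=> t ta; apply: is_deriveB; [exact: dG|exact: dG'].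
Qed.

Lemma primitive_uniq t0 a g G g' G' t : primitive t0 a g G -> primitive t0 a g' G' ->
  `|t - t0| < a -> (forall s, `|s - t0| <= `|t - t0| -> g s = g' s) -> G t = G' t.
Proof.
move=> pG pG' ta E; apply/eqP; rewrite -subr_eq0 -normr_le0.
rewrite -(mulr0 `|t - t0|).
apply: (primitive_bound (primitiveB pG pG') ta) => s /E ->.
by rewrite subrr normr0.
Qed.

Lemma primitive_sub t0 a b g G : b <= a -> primitive t0 a g G -> primitive t0 b g G.
Proof. by move=> ba [G0 dG]; split => // t tb; apply: dG; exact: lt_le_trans ba. Qed.

(** The integral is started at the left end of the interval and normalized at [t0] afterwards, which
    spares the distinction between [t < t0] and [t > t0]. *)
Lemma primitive_closed t0 b g : 0 < b ->
  (forall t, `|t - t0| <= b -> {for t, continuous g}) -> exists G, primitive t0 b g G.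
Proof.
move=> b0 cg.
pose c := t0 - b; pose d := t0 + b.
have cd : c < d by rewrite /c /d; move: b0; lra.
have inI t : t \in `[c, d]%R -> `|t - t0| <= b.
  by rewrite in_itv /= /c /d ler_norml => /andP[]; lra.
have ig : lebesgue_measure.-integrable [set` Interval (BLeft c) (BRight d)] (EFin \o g).
  apply: continuous_compact_integrable; first exact: segment_compact.
  apply: continuous_in_subspaceT => t; rewrite inE /= => tI.
  exact/cg/inI.
have dG (t : R) : c < t -> t < d ->
    is_derive t 1 (fun x : R => \int[lebesgue_measure]_(y in [set` Interval (BLeft c) (BRight x)]) g y)%R (g t).
  move=> ct td; have [||D E] := continuous_FTC1 td ig.
  - by rewrite /Order.lt /= ct.
  - by apply/cg/inI; rewrite in_itv /= (ltW ct) (ltW td).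
  by split; [exact: D|rewrite -derive1E; exact: E].
set G := fun x => _ in dG.
exists (fun t => G t - G t0); split; first by rewrite subrr.
move=> t; rewrite ltr_norml => /andP[ta tb].
rewrite -[g t]subr0; apply: is_deriveB; apply: dG; rewrite /c /d; move: ta tb; lra.
Qed.

Lemma primitive_exists t0 a g : 0 < a ->
  (forall t, `|t - t0| < a -> {for t, continuous g}) -> exists G, primitive t0 a g G.
Proof.
move=> a0 cg.
have /choice[H HP] : forall b, exists G, 0 < b < a -> primitive t0 b g G.
  move=> b; have [/andP[b0 ba]|_] := boolP (0 < b < a); last by exists (fun=> 0).
  have [|G pG] := @primitive_closed t0 b g b0; last by exists G.
  by move=> t tb; apply: cg; exact: le_lt_trans ba.
(* [g] may be unbounded near the ends of the open interval, so the primitives on smaller closed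
   intervals are glued. The radius [r t] lies strictly between [|t - t0|] and [a], and uniqueness
   makes the choices compatible. *)
pose r t := (`|t - t0| + a) / 2.
have r0 t : 0 < r t by rewrite divr_gt0 // ltr_wpDl.
have ra t : `|t - t0| < a -> r t < a by rewrite /r; lra.
have rt t : `|t - t0| < a -> `|t - t0| < r t by rewrite /r; lra.
have HH b s : 0 < b < a -> `|s - t0| < b -> H (r s) s = H b s.
  move=> /[dup] bb /andP[b0 ba] sb.
  have sa := lt_trans sb ba.
  have rs : 0 < r s < a by rewrite r0 ra.
  have [le|le] := leP b (r s).
    by apply: (primitive_uniq (primitive_sub le (HP _ rs)) (HP _ bb)).
  by apply: (primitive_uniq (HP _ rs) (primitive_sub (ltW le) (HP _ bb))) => //; exact: rt.
exists (fun t => H (r t) t); split.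
  by have [] : primitive t0 (r t0) g (H (r t0)) by apply: HP; rewrite r0 ra // subrr normr0.
move=> t ta; have rr : 0 < r t < a by rewrite r0 ra.
apply: (@near_eq_is_derive _ _ _ (H (r t))); last by have [_] := HP _ rr; apply; exact: rt.
by apply: filterS (near_dist (rt t ta)) => s sr; rewrite (HH _ _ rr sr).
Qed.

(** A chosen primitive for every integrand, so that integrals with a parameter become functions of
    the parameter. *)
Definition prim t0 a g : R -> R := xget (fun=> 0) (primitive t0 a g).

Lemma primP t0 a g : 0 < a -> (forall t, `|t - t0| < a -> {for t, continuous g}) ->
  primitive t0 a g (prim t0 a g).
Proof. by move=> a0 cg; apply: xgetPex; exact: primitive_exists. Qed.

Lemma primitive_continuous t0 a g G t : primitive t0 a g G -> `|t - t0| < a -> {for t, continuous G}.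
Proof.
by move=> [_ dG] /dG[d _]; apply: differentiable_continuous; exact/derivable1_diffP.
Qed.

Lemma primitive_is_derive t0 a g G t (tau : R) : primitive t0 a g G -> `|t - t0| < a ->
  is_derive t tau G (tau * g t).
Proof.
move=> [_ dG] /dG[/derivable1_diffP dif <-]; split; first exact: diff_derivable.
by rewrite !deriveE // -[in LHS](mulr1 tau) linearZ.
Qed.

Lemma gronwall_small t0 a (K c S : R) D D' : 0 < a -> 0 <= K -> 0 <= c -> a * K <= 2^-1 ->
  primitive t0 a D' D ->
  (forall t, `|t - t0| < a -> `|D' t| <= K * `|D t| + c) ->
  (forall t, `|t - t0| < a -> `|D t| <= S) ->
  forall t, `|t - t0| < a -> `|D t| <= 2 * (a * c).
Proof.
move=> a0 K0 c0 aK pD D'b DS.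
pose X := [set `|D t| | t in [set t | `|t - t0| < a]].
have X0 : X !=set0 by exists `|D t0|; exists t0 => //=; rewrite subrr normr0.
have Xub : has_ubound X by exists S => _ [t ta <-]; exact: DS.
have Xsup t : `|t - t0| < a -> `|D t| <= sup X.
  by move=> ta; apply: ub_le_sup => //; exists t.
have S0 : 0 <= sup X by apply: le_trans (Xsup t0 _) => //; rewrite subrr normr0.
have step t : `|t - t0| < a -> `|D t| <= sup X / 2 + a * c.
  move=> ta; apply: (@le_trans _ _ (`|t - t0| * (K * sup X + c))).
    apply: (primitive_bound pD ta) => s st.
    have sa := le_lt_trans st ta.
    apply: le_trans (D'b s sa) _.
    by rewrite lerD2r ler_wpM2l //; exact: Xsup.
  apply: (@le_trans _ _ (a * (K * sup X + c))).
    by rewrite ler_wpM2r ?(ltW ta) // addr_ge0 // mulr_ge0.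
  rewrite mulrDr lerD2r mulrA [sup X / 2]mulrC.
  by rewrite ler_wpM2r.
have supX : sup X <= sup X / 2 + a * c by apply: ge_sup => // _ [t ta <-]; exact: step.
move=> t ta; apply: le_trans (Xsup t ta) _; move: supX; lra.
Qed.

Lemma half_pow_lt (C e : R) : 0 < e -> exists n : nat, C * 2^-1 ^+ n < e.
Proof.
move=> e0; have h : `|2^-1 : R| < 1 by rewrite gtr0_norm; lra.
have /cvgrPdist_lt /(_ _ e0) [N _ H] := cvg_geometric C h.
exists N; have := H N (leqnn N); rewrite /geometric /= sub0r normrN.
by apply: le_lt_trans; exact: ler_norm.
Qed.

(* The limit is the supremum of the lower bounds [x n - C / 2 ^ n]. *)
Lemma geometric_limit (x : nat -> R) (C : R) : 0 <= C ->
  (forall n, `|x n.+1 - x n| <= C * 2^-1 ^+ n) ->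
  exists l, forall n, `|x n - l| <= 2 * C * 2^-1 ^+ n.
Proof.
move=> C0 H.
pose q n : R := C * 2^-1 ^+ n.
have q0 n : 0 <= q n by rewrite mulr_ge0 // exprn_ge0 // invr_ge0.
have qS n : q n = 2 * q n.+1 by rewrite /q exprS; field.
have dist n k : `|x (n + k)%N - x n| <= 2 * q n - 2 * q (n + k)%N.
  elim: k => [|k IH]; first by rewrite addn0 !subrr normr0.
  rewrite addnS; have := H (n + k)%N; rewrite -/(q _) => H1.
  have E := qS (n + k)%N; have := q0 (n + k).+1.
  move: IH H1; rewrite !ler_norml => /andP[? ?] /andP[? ?] ?.
  by apply/andP; split; lra.
have up n m : x n - 2 * q n <= x m + 2 * q m.
  have [nm|/ltnW mn] := leqP n m.
    have := dist n (m - n)%N; rewrite subnKC // ler_norml => /andP[? ?].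
    by have := q0 m; lra.
  have := dist m (n - m)%N; rewrite subnKC // ler_norml => /andP[? ?].
  by have := q0 n; lra.
pose X := [set x n - 2 * q n | n in [set: nat]].
have X0 : X !=set0 by exists (x 0%N - 2 * q 0%N); exists 0%N.
have Xub m : ubound X (x m + 2 * q m) by move=> _ [n _ <-]; exact: up.
exists (sup X) => n; rewrite -mulrA -/(q n) ler_norml; apply/andP; split.
  by have := ge_sup X0 (Xub n); lra.
have : x n - 2 * q n <= sup X by apply: ub_le_sup; [exists (x n + 2 * q n); exact: Xub|exists n].
lra.
Qed.

(** The condition [a * M <= b] keeps the iterates in the strip [|y| <= b], where [f] is controlled,
    and [a * K <= 1/2] halves the distance of successive iterates. *)
Lemma picard t0 a (b M K : R) (f : R -> R -> R) :
  0 < a -> 0 < b -> 0 <= M -> 0 <= K -> a * M <= b -> a * K <= 2^-1 ->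
  (forall phi : R -> R,
     (forall t, `|t - t0| < a -> {for t, continuous phi} /\ `|phi t| <= b) ->
     forall t, `|t - t0| < a -> {for t, continuous (fun s => f s (phi s))}) ->
  (forall t y, `|t - t0| < a -> `|y| <= b -> `|f t y| <= M) ->
  (forall t y y', `|t - t0| < a -> `|y| <= b -> `|y'| <= b ->
     `|f t y - f t y'| <= K * `|y - y'|) ->
  exists phi, primitive t0 a (fun s => f s (phi s)) phi /\
    forall t, `|t - t0| < a -> `|phi t| <= b.
Proof.
move=> a0 b0 M0 K0 aM aK fc fM fK.
pose good (phi : R -> R) := forall t, `|t - t0| < a -> {for t, continuous phi} /\ `|phi t| <= b.
pose T phi := prim t0 a (fun s => f s (phi s)).
have TP (phi : R -> R) : good phi -> primitive t0 a (fun s => f s (phi s)) (T phi).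
  by move=> gp; apply: primP => //; exact: fc.
have Tb (phi : R -> R) t : good phi -> `|t - t0| < a -> `|T phi t| <= b.
  move=> gp ta; apply: le_trans aM.
  apply: (@le_trans _ _ (`|t - t0| * M)); last by rewrite ler_wpM2r // ltW.
  apply: (primitive_bound (TP _ gp) ta) => s st.
  have sa := le_lt_trans st ta.
  by apply: fM => //; have [] := gp s sa.
have Tg (phi : R -> R) : good phi -> good (T phi).
  move=> gp t ta; split; last exact: Tb.
  exact: primitive_continuous (TP _ gp) ta.
pose phin n : R -> R := iter n T (fun=> 0).
have gn n : good (phin n).
  elim: n => [|n IH]; last exact: Tg.
  by move=> t ta; split; [exact: cvg_cst|rewrite normr0 ltW].
have C0 : 0 <= 2 * b by rewrite mulr_ge0 // ltW.
have dn n t : `|t - t0| < a -> `|phin n.+1 t - phin n t| <= 2 * b * 2^-1 ^+ n.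
  elim: n t => [|n IH] t ta.
    rewrite expr0 mulr1; apply: (le_trans (ler_normB _ _)).
    have [_ ?] := gn 1%N t ta; have [_ ?] := gn 0%N t ta.
    by rewrite mulrDl !mul1r lerD.
  apply: (@le_trans _ _ (`|t - t0| * (K * (2 * b * 2^-1 ^+ n)))).
    apply: (primitive_bound (primitiveB (TP _ (gn n.+1)) (TP _ (gn n))) ta) => s st.
    have sa := le_lt_trans st ta.
    have [_ b1] := gn n.+1 s sa; have [_ b2] := gn n s sa.
    apply: le_trans (fK _ _ _ sa b1 b2) _.
    by rewrite ler_wpM2l //; exact: IH.
  set q := 2 * b * 2^-1 ^+ n; have q0 : 0 <= q by rewrite mulr_ge0 // exprn_ge0 // invr_ge0.
  have -> : 2 * b * 2^-1 ^+ n.+1 = 2^-1 * q by rewrite /q exprS; ring.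
  rewrite mulrA ler_wpM2r //.
  by apply: le_trans aK; rewrite ler_wpM2r // ltW.
have /choice[phi Hphi] : forall t, exists l, `|t - t0| < a -> forall n, `|phin n t - l| <= 2 * (2 * b) * 2^-1 ^+ n.
  move=> t; have [ta|nta] := pselect (`|t - t0| < a); last by exists 0.
  by have [l Hl] := geometric_limit C0 (fun n => dn n t ta); exists l.
have small (e : R) : 0 < e -> exists n, 2 * (2 * b) * 2^-1 ^+ n < e by move=> e0; exact: half_pow_lt.
have gphi : good phi.
  move=> t ta; split.
    apply/cvgrPdist_le => e e0.
    have [n Hn] := small (e / 4) (divr_gt0 e0 (ltr0n _ 4)).
    have [cn _] := gn n t ta.
    have N1 := cont_dist_le cn (divr_gt0 e0 (ltr0n _ 4)).
    apply: filterS2 N1 (near_dist ta) => s Hs sa.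
    have := Hphi t ta n; have := Hphi s sa n; move: Hs Hn.
    set q := _ * _ ^+ n.
    rewrite !ler_norml => /andP[? ?] ? /andP[? ?] /andP[? ?].
    by apply/andP; split; lra.
  apply/ler_addgt0Pr => e e0; have [n Hn] := small e e0.
  have [_ bn] := gn n t ta; have := Hphi t ta n; move: bn Hn; set q := _ * _ ^+ n.
  by rewrite !ler_norml => /andP[? ?] ? /andP[? ?]; apply/andP; split; lra.
(* [T phi] is compared with [phin n.+1], which is [T (phin n)]: the Lipschitz bound carries the
   uniform closeness of [phin n] and [phi] through [T]. *)
have E t : `|t - t0| < a -> T phi t = phi t.
  move=> ta; apply/eqP; rewrite -subr_eq0 -normr_le0; apply/ler_addgt0Pr => e e0; rewrite add0r.
  have [n Hn] := small (e / 2) (divr_gt0 e0 (ltr0n _ 2)).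
  have H1 : `|T phi t - phin n.+1 t| <= e / 2.
    apply: (@le_trans _ _ (`|t - t0| * (K * (e / 2)))).
      apply: (primitive_bound (primitiveB (TP _ gphi) (TP _ (gn n))) ta) => s st.
      have sa := le_lt_trans st ta.
      have [_ b1] := gphi s sa; have [_ b2] := gn n s sa.
      apply: le_trans (fK _ _ _ sa b1 b2) _.
      by rewrite ler_wpM2l // distrC; apply: le_trans (Hphi s sa n) (ltW Hn).
    rewrite mulrA ler_piMl // ?divr_ge0 ?(ltW e0) //.
    apply: le_trans (le_trans aK _); last by lra.
    by rewrite ler_wpM2r // ltW.
  have H2 : `|phin n.+1 t - phi t| <= e / 2.
    apply: le_trans (Hphi t ta n.+1) _; apply: le_trans (ltW Hn).
    rewrite exprS; apply: ler_wpM2l; first by rewrite mulr_ge0.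
    by rewrite ler_piMl ?exprn_ge0 ?invr_ge0 //; lra.
  rewrite (splitr e) (_ : _ - _ = (T phi t - phin n.+1 t) + (phin n.+1 t - phi t)); last by ring.
  by apply: le_trans (ler_normD _ _) (lerD H1 H2).
(* With [T phi] in place of [phi] differentiability is immediate, and only the argument of the
   right-hand side has to be replaced by means of [E]. *)
exists (T phi); split; last by move=> t ta; exact: Tb.
have [p0 pd] := TP _ gphi; split => // t ta.
by rewrite E //; exact: pd.
Qed.

End Primitive.

(** * Local Lipschitz and Taylor estimates *)

Section Local_bounds.
Variable R : realType.
Implicit Types V W : normedModType R.

Lemma is_derive_of_bound V W (f : V -> W) (x v : V) (l : W) :
  (forall e : R, 0 < e -> \forall h \near (0 : R), `|f (x + h *: v) - f x - h *: l| <= `|h| * e) ->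
  is_derive x v f l.
Proof.
move=> H.
suff cv : (fun h : R => h^-1 *: (f (h *: v + x) - f x)) @ 0^' --> l.
  by split; [apply/cvg_ex; exists l|apply: cvg_lim].
apply/cvgrPdist_le => e e0.
have [d d0 Hd] := near0_small (H e e0).
apply/nbhs_ballP; exists d => //= h; rewrite -ball_normE /= sub0r normrN => hd hn0.
have := Hd h (ltW hd); rewrite distrC [x + _]addrC => Hh.
have h0 : 0 < `|h| by rewrite normr_gt0.
by rewrite -(ler_pM2l h0) -normrZ scalerBr scalerA divff // scale1r.
Qed.

Lemma slice_quotient V W (X : normedModType R) (f : V * W -> X) (x v : V) (y : W) :
  (fun h : R => h^-1 *: (f (h *: ((v, 0) : V * W) + (x, y)) - f (x, y))) =
  (fun h : R => h^-1 *: (f (h *: v + x, y) - f (x, y))).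
Proof.
by apply/funext => h; congr (_ *: (f _ - _)); congr pair; rewrite /= scaler0 add0r.
Qed.

Lemma derive_slice V W (X : normedModType R) (f : V * W -> X) (y : W) (x v : V) :
  'D_v (fun x => f (x, y)) x = 'D_((v, 0) : V * W) f (x, y).
Proof. by rewrite /derive /= slice_quotient. Qed.

Lemma is_derive_slice1 V W (X : normedModType R) (f : V * W -> X) (x v : V) (y : W) (l : X) :
  is_derive x v (fun x => f (x, y)) l -> is_derive (x, y) ((v, 0) : V * W) f l.
Proof. by move=> [d <-]; split; rewrite /derivable /derive /= slice_quotient. Qed.

Lemma derive_slice2 V W (X : normedModType R) (f : V * W -> X) (x : V) (y w : W) :
  'D_w (fun y => f (x, y)) y = 'D_((0, w) : V * W) f (x, y).
Proof.
have E : (fun h : R => h^-1 *: (f (h *: ((0, w) : V * W) + (x, y)) - f (x, y)))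
    = (fun h : R => h^-1 *: (f (x, h *: w + y) - f (x, y))).
  by apply/funext => h; congr (_ *: (f _ - _)); congr pair; rewrite /= scaler0 add0r.
by rewrite /derive /= E.
Qed.

(** The vector [v] is shorter than [2 r / 3], so even [z - v] stays in the ball of radius [r].
    Negative [t] must be allowed because [mvt_dir] bounds only [|t|]. *)
Lemma in_ball_segment V (x z v : V) (r t : R) : `|t| <= 1 ->
  ball x (r / 3) z -> ball x (r / 3) (z + v) -> ball x r (z + t *: v).
Proof.
move=> t1; rewrite -!ball_normE /= => xz xzv.
have vr : `|v| < r / 3 + r / 3.
  rewrite (_ : v = (x - z) - (x - (z + v))).
    by apply: le_lt_trans (ler_normB _ _) (ltrD xz xzv).
  by rewrite !opprD !opprK addrACA subrr add0r addrA addNr add0r.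
rewrite opprD addrA; apply: le_lt_trans (ler_normB _ _) _.
rewrite normrZ; have : `|t| * `|v| <= `|v| by rewrite ler_piMl.
move: xz vr; set A := `|x - z|; set B := `|v|; set D := _ * B; lra.
Qed.

Lemma derive_locally_bounded V (U : set V) (f : V -> R) x : fd V -> open U -> U x -> Coo U f ->
  exists r K : R, [/\ 0 < r, 0 < K, ball x r `<=` U &
    forall z v, ball x r z -> `|'D_v f z| <= K * `|v|].
Proof.
move=> [n [b [c bc]]] oU Ux Cf.
have [C C0 HC] := uniform_coords_bound bc.
pose S := \sum_i (`|'D_(b i) f x| + 1).
have S0 : 0 <= S by rewrite sumr_ge0 // => i _; rewrite addr_ge0.
have N1 : \forall z \near x, U z by apply: open_nbhs_nbhs.
have N2 : \forall z \near x, forall i, `|'D_(b i) f z| <= `|'D_(b i) f x| + 1.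
  apply: filter_forall => i.
  have := cont_dist_le (Coo_cont (Coo_derive (b i) Cf) Ux) ltr01.
  apply: filterS => z Hz.
  rewrite -[X in `|X|](subKr ('D_(b i) f x)); apply: le_trans (ler_normB _ _) _.
  by rewrite lerD2l.
have /nbhs_ballP[r /= r0 Hr] : \forall z \near x, U z /\ forall i, `|'D_(b i) f z| <= `|'D_(b i) f x| + 1.
  by apply: filterS2 N1 N2 => z Uz Hz; split.
exists r, (C * S + 1); split => //.
- by rewrite ltr_wpDl // mulr_ge0 // ltW.
- by move=> z /Hr[].
move=> z v /Hr[Uz Hz].
rewrite (derive_coords _ bc); last exact: Coo_diff Cf Uz.
apply: (le_trans (ler_norm_sum _ _ _)).
apply: (@le_trans _ _ (\sum_i C * `|v| * (`|'D_(b i) f x| + 1))).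
  by apply: ler_sum => i _; rewrite normrM; apply: ler_pM.
rewrite -mulr_sumr -/S mulrAC ler_wpM2r // lerDl; exact: ler01.
Qed.

Lemma locally_lipschitz V (U : set V) (f : V -> R) x : fd V -> open U -> U x -> Coo U f ->
  exists r K : R, [/\ 0 < r, 0 < K, ball x r `<=` U &
    forall z v, ball x r z -> ball x r (z + v) -> `|f (z + v) - f z| <= K * `|v|].
Proof.
move=> fV oU Ux Cf.
have [r [K [r0 K0 rU HK]]] := derive_locally_bounded fV oU Ux Cf.
have r30 : 0 < r / 3 by rewrite divr_gt0.
have r3 : ball x (r / 3) `<=` ball x r by apply: le_ball; lra.
exists (r / 3), K; split => // [z /r3/rU //|z v zB zvB].
have := @mvt_bound R V f z v 1 (K * `|v|); rewrite scale1r normr1 mul1r; apply => t t1.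
  by apply: diff_derivable; apply: (Coo_diff Cf); apply: rU; exact: in_ball_segment.
by apply: HK; exact: in_ball_segment.
Qed.

(** By the mean value theorem the remainder is an increment of first derivatives, which are locally
    Lipschitz. *)
Lemma locally_quadratic V (U : set V) (f : V -> R) x : fd V -> open U -> U x -> Coo U f ->
  exists r K : R, [/\ 0 < r, 0 < K, ball x r `<=` U &
    forall z v, ball x r z -> ball x r (z + v) ->
      `|f (z + v) - f z - 'D_v f z| <= K * `|v| ^+ 2].
Proof.
move=> fV oU Ux Cf.
have [n [b [c bc]]] := fV.
have [C C0 HC] := uniform_coords_bound bc.
have /choice[rK HrK] : forall i, exists rK : R * R, [/\ 0 < rK.1, 0 < rK.2, ball x rK.1 `<=` U &
    forall z v, ball x rK.1 z -> ball x rK.1 (z + v) ->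
      `|'D_(b i) f (z + v) - 'D_(b i) f z| <= rK.2 * `|v|].
  move=> i; have [r [K H]] := locally_lipschitz fV oU Ux (Coo_derive (b i) Cf).
  by exists (r, K).
have /nbhs_ballP[r /= r0 Hr] : \forall z \near x, U z /\ forall i, ball x (rK i).1 z.
  have N1 : \forall z \near x, U z by apply: open_nbhs_nbhs.
  have N2 : \forall z \near x, forall i, ball x (rK i).1 z.
    by apply: filter_forall => i; apply: nbhsx_ballx; case: (HrK i).
  by apply: filterS2 N1 N2 => z Uz Hz; split.
pose S := \sum_i (rK i).2.
have S0 : 0 <= S by rewrite sumr_ge0 // => i _; rewrite ltW //; case: (HrK i).
have r30 : 0 < r / 3 by rewrite divr_gt0.
have r3 : ball x (r / 3) `<=` ball x r by apply: le_ball; lra.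
exists (r / 3), (C * S + 1); split => // [|z /r3/Hr[] //|z v zB zvB].
  by rewrite ltr_wpDl // mulr_ge0 // ltW.
have dseg (t : R) : `|t| <= `|1 : R| -> U (z + t *: v).
  by rewrite normr1 => t1; have [] := Hr _ (in_ball_segment t1 zB zvB).
have [|t t1] := @mvt_dir R V f z v 1.
  by move=> t /dseg Ut; apply: diff_derivable; exact: Coo_diff Cf Ut.
rewrite scale1r mul1r => ->.
have Uz : U z by have [] := Hr _ (r3 _ zB).
rewrite !(derive_coords _ bc); [|exact: Coo_diff Cf Uz|exact: Coo_diff Cf (dseg t t1)].
rewrite -sumrB; apply: (le_trans (ler_norm_sum _ _ _)).
apply: (@le_trans _ _ (\sum_i C * `|v| * ((rK i).2 * `|v|))).
  apply: ler_sum => i _; rewrite -mulrBr normrM; apply: ler_pM => //.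
  have [_ /ltW k0 _ Hi] := HrK i.
  have [_ B1] := Hr _ (r3 _ zB).
  rewrite normr1 in t1; have [_ B2] := Hr _ (in_ball_segment t1 zB zvB).
  apply: le_trans (Hi _ _ (B1 i) (B2 i)) _.
  by rewrite ler_wpM2l // normrZ ler_piMl.
rewrite -mulr_sumr -mulr_suml -/S expr2.
rewrite (_ : _ * (S * _) = C * S * (`|v| * `|v|)); last by ring.
by rewrite ler_wpM2r ?mulr_ge0 // lerDl ler01.
Qed.

End Local_bounds.

(** * Integrals depending on a parameter *)

Section Parametric_primitive.
Variables (R : realType) (P : normedModType R) (fP : fd P).
Variables (t0 a : R) (p0 : P) (rho : R) (a0 : 0 < a).

Definition box : set (R * P) := [set z | `|z.1 - t0| < a /\ `|z.2 - p0| < rho].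

Lemma open_box : open box.
Proof.
rewrite openE => -[t p] [/= ta pr].
have N1 := near_dist ta; have N2 := near_dist pr.
by exists ([set s | `|s - t0| < a], [set q | `|q - p0| < rho]) => // -[s q] [].
Qed.

Lemma cont_slice (g : R * P -> R) p t : {for (t, p), continuous g} ->
  {for t, continuous (fun s => g (s, p))}.
Proof. by move=> cg; apply: (@continuous_comp _ _ _ (fun s => (s, p)) g) => //; exact: cont_pairl. Qed.

Definition pprim (g : R * P -> R) (z : R * P) : R := prim t0 a (fun s => g (s, z.2)) z.1.

Lemma pprimP (g : R * P -> R) p : (forall z, box z -> {for z, continuous g}) -> `|p - p0| < rho ->
  primitive t0 a (fun s => g (s, p)) (prim t0 a (fun s => g (s, p))).
Proof. by move=> cg pr; apply: primP => // t ta; apply: cont_slice; apply: cg. Qed.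

(** Compactness of the time interval of radius [d < a] makes the continuity in the parameter uniform
    in time. *)
Lemma tube (g : R * P -> R) p (d e : R) : (forall z, box z -> {for z, continuous g}) ->
  `|p - p0| < rho -> d < a -> 0 < e ->
  \forall q \near p, `|q - p0| < rho /\ forall s, `|s - t0| <= d -> `|g (s, q) - g (s, p)| <= e.
Proof.
move=> cg pr da e0.
have cpt : compact [set` `[t0 - d, t0 + d]%R] by exact: segment_compact.
have /compact_near_coveringP cov := cpt.
have : \forall q \near p, [set` `[t0 - d, t0 + d]%R] `<=` (fun s => `|g (s, q) - g (s, p)| <= e).
  apply: (cov P (nbhs p) (fun q s => `|g (s, q) - g (s, p)| <= e)) => s.
  rewrite /= in_itv /= => /andP[s1 s2].
  have sa : `|s - t0| < a by rewrite ltr_norml; apply/andP; split; lra.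
  have e2 : 0 < e / 2 by rewrite divr_gt0.
  have N1 := cont_dist_le (cg (s, p) (conj sa pr)) e2.
  have N2 := cont_dist_le (cont_slice (cg (s, p) (conj sa pr))) e2.
  case: N1 => -[A B] /= [As Bp] H1.
  exists ([set x | A x /\ `|g (s, p) - g (x, p)| <= e / 2], B) => /=.
    by split => //; apply: filterI.
  move=> [x q] /= [[Ax H2] Bq]; have /= H3 := H1 (x, q) (conj Ax Bq).
  rewrite (splitr e) (_ : _ - _ = (g (s, p) - g (x, p)) - (g (s, p) - g (x, q))); last by ring.
  by apply: le_trans (ler_normB _ _) (lerD H2 H3).
apply: filterS2 (near_dist pr) => q qr H; split => // s sd.
by apply: H; rewrite /= in_itv /=; move: sd; rewrite ler_norml => /andP[? ?]; apply/andP; split; lra.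
Qed.

Lemma pprim_cont (g : R * P -> R) z : (forall z, box z -> {for z, continuous g}) -> box z ->
  {for z, continuous (pprim g)}.
Proof.
case: z => t p cg [/= ta pr].
apply/cvgrPdist_le => e e0.
pose d := (`|t - t0| + a) / 2.
have da : d < a by rewrite /d; lra.
have td : `|t - t0| < d by rewrite /d; lra.
have e2 : 0 < e / (2 * a) by rewrite divr_gt0 // mulr_gt0.
have e22 : 0 < e / 2 by rewrite divr_gt0.
have N1 := tube cg pr da e2.
have pp := pprimP cg pr.
have N2 := cont_dist_le (primitive_continuous pp ta) e22.
exists ([set s | `|s - t0| < d /\ `|pprim g (t, p) - pprim g (s, p)| <= e / 2],
  [set q | `|q - p0| < rho /\ forall s, `|s - t0| <= d -> `|g (s, q) - g (s, p)| <= e / (2 * a)]).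
  by split => //=; apply: filterI => //; exact: near_dist td.
move=> [s q] /= [[sd H1] [qr H2]].
have sa := lt_trans sd da.
have pq := pprimP cg qr.
have H3 : `|pprim g (s, q) - pprim g (s, p)| <= e / 2.
  rewrite /pprim /=; apply: (@le_trans _ _ (`|s - t0| * (e / (2 * a)))).
    apply: (primitive_bound (primitiveB pq pp) sa) => y ys; apply: H2.
    exact: le_trans ys (ltW sd).
  rewrite (_ : e / 2 = a * (e / (2 * a))); last by field; rewrite gt_eqF.
  by rewrite ler_wpM2r // ltW.
rewrite (splitr e) (_ : _ - _ = (pprim g (t, p) - pprim g (s, p)) - (pprim g (s, q) - pprim g (s, p))); last by ring.
by apply: le_trans (ler_normB _ _) (lerD H1 H3).
Qed.

Lemma primitiveZ (g G : R -> R) (k : R) : primitive t0 a g G ->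
  primitive t0 a (fun s => k * g s) (fun s => k * G s).
Proof.
move=> [G0 dG]; split; first by rewrite G0 mulr0.
by move=> t /dG dGt; apply: is_deriveZ.
Qed.

Lemma is_derive_pprim_time (g : R * P -> R) t p (tau : R) :
  (forall z, box z -> {for z, continuous g}) -> box (t, p) ->
  is_derive (t, p) ((tau, 0) : R * P) (pprim g) (tau * g (t, p)).
Proof.
move=> cg [/= ta pr]; apply: is_derive_slice1.
exact: (primitive_is_derive tau (pprimP cg pr) ta).
Qed.

(** Differentiation under the integral sign: the mean value theorem writes the increment of the
    integrand as [h] times its parameter derivative at an intermediate parameter, which by [tube] is
    uniformly close to the derivative at [p]. *)
Lemma is_derive_pprim_param (g : R * P -> R) (v : P) z :
  (forall z, box z -> {for z, continuous g}) ->
  (forall z, box z -> derivable g z (0, v)) ->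
  (forall z, box z -> {for z, continuous (fun z => 'D_((0, v) : R * P) g z)}) -> box z ->
  is_derive z ((0, v) : R * P) (pprim g) (pprim (fun z => 'D_((0, v) : R * P) g z) z).
Proof.
case: z => t p cg dg cDg [/= ta pr].
set Dg := fun z => _ in cDg *.
apply: is_derive_of_bound => e e0.
pose d := (`|t - t0| + a) / 2.
have da : d < a by rewrite /d; lra.
have td : `|t - t0| < d by rewrite /d; lra.
have e2 : 0 < e / a by rewrite divr_gt0.
have [h1 h10 Hh1] := near0_small (@near_line R _ p v _ (tube cDg pr da e2)).
have Nh : \forall h \near (0 : R), `|h| < h1.
  by have := @near_dist R R 0 0 h1; rewrite subr0 normr0 => /(_ h10); apply: filterS => h; rewrite subr0.
apply: filterS Nh => h /ltW hh1.
have line (s tau : R) : (s, p) + tau *: (0, v) = (s, p + tau *: v) :> R * P.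
  by congr pair => /=; rewrite scaler0 addr0.
have [qr _] := Hh1 h hh1.
rewrite line /pprim /=.
have pq := pprimP cg qr; have pp := pprimP cg pr; have pD := pprimP cDg pr.
apply: (@le_trans _ _ (`|t - t0| * (`|h| * (e / a)))).
  apply: (primitive_bound (primitiveB (primitiveB pq pp) (primitiveZ h pD)) ta) => s st.
  have sd := le_trans st (ltW td); have sa := le_lt_trans sd da.
  have [|tau tauh] := @mvt_dir R _ g (s, p) (0, v) h.
    move=> tau tauh; rewrite line; apply: dg; split => //.
    by have [] := Hh1 tau (le_trans tauh hh1).
  rewrite !line => ->; rewrite -mulrBr normrM ler_wpM2l //.
  by have [_ H] := Hh1 tau (le_trans tauh hh1); exact: H.
rewrite mulrCA ler_wpM2l // mulrA ler_pdivrMr // [leRHS]mulrC.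
by rewrite ler_wpM2r ?ltW.
Qed.

(** A time derivative returns [g] itself and a parameter derivative is again of the form [pprim], so
    the induction closes. *)
Lemma Ck_pprim n (g : R * P -> R) : Ck n box g -> Ck n box (pprim g).
Proof.
elim: n g => [|n IH] g Cg; first by move=> z bz; apply: pprim_cont.
have cg z : box z -> {for z, continuous g} by exact: Ck_cont Cg.
have [dg Dg] := Cg.
have dgv v z : box z -> derivable g z ((0, v) : R * P).
  by move=> bz; apply: diff_derivable; exact: dg z bz.
have cDg v z : box z -> {for z, continuous (fun z => 'D_((0, v) : R * P) g z)}.
  exact: Ck_cont (Dg (0, v)).
apply: (@Ck_axes R R P n box _ _ fP open_box).
- by move=> tau [t p] bz; have [] := is_derive_pprim_time tau cg bz.
- by move=> v z bz; have [] := is_derive_pprim_param cg (dgv v) (cDg v) bz.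
- move=> tau; apply: (@Ck_eq _ _ _ _ _ (fun z => tau * g z)) => [|[t p] bz|].
  + exact: open_box.
  + by have [_ ->] := is_derive_pprim_time tau cg bz.
  + apply: CkM; [exact: open_box|exact: Ck_cst|exact: CkW Cg].
- move=> v; apply: (@Ck_eq _ _ _ _ _ (pprim (fun z => 'D_((0, v) : R * P) g z))) => [|z bz|].
  + exact: open_box.
  + by have [_ ->] := is_derive_pprim_param cg (dgv v) (cDg v) bz.
  + by apply: IH; exact: Dg.
Qed.

End Parametric_primitive.

Section Exponential.
Variable R : realType.

Lemma Ck_expR n : Ck n [set: R] (@expR R).
Proof.
elim: n => [|n IH]; first by move=> x _; exact: continuous_expR.
split => [x _|v]; first by apply/derivable1_diffP; exact: derivable_expR.
apply: (@Ck_eq _ _ _ _ _ (fun x => v * expR x)) => [|x _|].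
- exact: openT.
- have dx : differentiable (@expR R) x by apply/derivable1_diffP; exact: derivable_expR.
  rewrite deriveE // -[in RHS](mulr1 v) linearZ /= -deriveE //.
  by have /(congr1 (fun f => f x)) -> := @derive_expR R.
- by apply: CkM; [exact: openT|exact: Ck_cst|].
Qed.

Lemma Ck_exp (V : normedModType R) n (U : set V) (f : V -> R) : open U ->
  Ck n U f -> Ck n U (fun x => expR (f x)).
Proof.
move=> oU Cf; exact: (@Ck_compR _ _ _ _ U [set: R] f (@expR R) _ oU _ Cf (Ck_expR n)).
Qed.

End Exponential.

(** * Ordinary differential equations with smooth dependence on parameters *)

Section Flow.
Variable R : realType.

Lemma cont_pair (V W X : normedModType R) (f : V -> W) (g : V -> X) x :
  {for x, continuous f} -> {for x, continuous g} -> {for x, continuous (fun y => (f y, g y))}.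
Proof. by move=> cf cg; apply: (cvg_pair cf cg). Qed.

(** Treating only the initial value 0 is enough: after a shift of the unknown, other initial values
    become parameters. Differentiability in the parameter is obtained by comparing two solutions
    with the solution of the linearized equation. *)
Theorem ode_flow (P : normedModType R) (F : R * R * P -> R) (U : set (R * R * P)) t0 p0 :
  fd P -> open U -> U ((t0, 0), p0) -> Coo U F ->
  exists (a rho : R) (phi : R * P -> R),
    [/\ 0 < a, 0 < rho, Coo (box t0 a p0 rho) phi,
     (forall p, `|p - p0| < rho -> phi (t0, p) = 0) &
     forall z, box t0 a p0 rho z -> U ((z.1, phi z), z.2) /\
       'D_((1, 0) : R * P) phi z = F ((z.1, phi z), z.2)].
Proof.
move=> fP oU Uc CF.
set c := ((t0, 0), p0) in Uc.
have [r1 [K1 [r10 K10 r1U H1]]] := derive_locally_bounded _ oU Uc CF.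
have [r2 [K2 [r20 K20 r2U H2]]] := locally_lipschitz _ oU Uc CF.
have [r3 [K3 [r30 K30 r3U H3]]] := locally_quadratic _ oU Uc CF.
pose r := Num.min r1 (Num.min r2 r3).
pose K := Num.max K1 (Num.max K2 K3).
have r0 : 0 < r by rewrite !lt_min r10 r20 r30.
have K0 : 0 < K by rewrite lt_max K10.
have rr1 : r <= r1 by rewrite ge_min lexx.
have rr2 : r <= r2 by rewrite !ge_min lexx orbT.
have rr3 : r <= r3 by rewrite !ge_min lexx !orbT.
have KK1 : K1 <= K by rewrite le_max lexx.
have KK2 : K2 <= K by rewrite !le_max lexx orbT.
have KK3 : K3 <= K by rewrite !le_max lexx !orbT.
have Fb z v : ball c r z -> `|'D_v F z| <= K * `|v|.
  move=> /(le_ball rr1) B1; apply: le_trans (H1 z v B1) _; by rewrite ler_wpM2r.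
have Fl z v : ball c r z -> ball c r (z + v) -> `|F (z + v) - F z| <= K * `|v|.
  move=> /(le_ball rr2) B1 /(le_ball rr2) B2; apply: le_trans (H2 _ _ B1 B2) _.
  by rewrite ler_wpM2r.
have Fq z v : ball c r z -> ball c r (z + v) -> `|F (z + v) - F z - 'D_v F z| <= K * `|v| ^+ 2.
  move=> /(le_ball rr3) B1 /(le_ball rr3) B2; apply: le_trans (H3 _ _ B1 B2) _.
  by rewrite ler_wpM2r // exprn_ge0.
have rU : ball c r `<=` U by move=> z /(le_ball rr1)/r1U.
clear H1 H2 H3 r1U r2U r3U rr1 rr2 rr3 KK1 KK2 KK3.
pose b := r / 2.
have b0 : 0 < b by rewrite divr_gt0.
have br : b < r by rewrite /b; lra.
pose M := `|F c| + K * r.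
have M0 : 0 <= M by rewrite addr_ge0 // mulr_ge0 // ltW.
(* [M] bounds [F] on the ball around [c]. The three terms keep the time in this ball, keep the
   solution in [|y| <= b], and make the Picard map halve distances. *)
pose a := Num.min r (Num.min (b / (M + 1)) (2 * K)^-1).
have a0 : 0 < a.
  by rewrite lt_min r0 /= lt_min; apply/andP; split; [rewrite divr_gt0 // ltr_wpDl|rewrite invr_gt0 mulr_gt0].
have ar : a <= r by rewrite ge_min lexx.
have aM : a * M <= b.
  apply: (@le_trans _ _ (b / (M + 1) * M)).
    by rewrite ler_wpM2r // !ge_min lexx orbT.
  rewrite mulrAC ler_pdivrMr ?ltr_wpDl // ler_wpM2l ?(ltW b0) // lerDl; exact: ler01.
have aK : a * K <= 2^-1.
  apply: (@le_trans _ _ ((2 * K)^-1 * K)).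
    by rewrite ler_wpM2r ?(ltW K0) // !ge_min lexx !orbT.
  by rewrite invfM mulfVK ?gt_eqF.
have inB t y p : `|t - t0| < a -> `|y| <= b -> `|p - p0| < r -> ball c r ((t, y), p).
  move=> ta yb pr; split; last by rewrite -ball_normE /= distrC.
  split => /=; first by rewrite -ball_normE /= distrC (lt_le_trans ta ar).
  by rewrite -ball_normE /= sub0r normrN (le_lt_trans yb br).
have shift t y y' p p' : ((t, y), p) + ((0, y' - y), p' - p) = ((t, y'), p') :> R * R * P.
  by congr pair; [congr pair|] => /=; rewrite ?addr0 // addrC subrK.
have normv y (w : P) : `|((0, y), w) : R * R * P| <= `|y| + `|w|.
  rewrite !prod_normE /= normr0 !ge_max.
  by apply/andP; split; [apply/andP; split; [rewrite addr_ge0|rewrite lerDl]|rewrite lerDr].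
have FM t y p : `|t - t0| < a -> `|y| <= b -> `|p - p0| < r -> `|F ((t, y), p)| <= M.
  move=> ta yb pr; have Bz := inB t y p ta yb pr.
  have Bc : ball c r c by exact: ballxx.
  have E : c + (((t, y), p) - c) = ((t, y), p) by rewrite addrC subrK.
  have := Fl c (((t, y), p) - c) Bc; rewrite E => /(_ Bz) H.
  have Nz : `|((t, y), p) - c| <= r.
    by move: (Bz); rewrite -ball_normE /= distrC => /ltW.
  rewrite -[F _](subrK (F c)) /M addrC; apply: le_trans (ler_normD _ _) _.
  by rewrite lerD2l; apply: le_trans H _; rewrite ler_wpM2l // ltW.
have FK t y y' p p' : `|t - t0| < a -> `|y| <= b -> `|y'| <= b -> `|p - p0| < r -> `|p' - p0| < r ->
    `|F ((t, y'), p') - F ((t, y), p)| <= K * (`|y' - y| + `|p' - p|).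
  move=> ta yb yb' pr pr'.
  have := Fl ((t, y), p) ((0, y' - y), p' - p) (inB _ _ _ ta yb pr).
  rewrite shift => /(_ (inB _ _ _ ta yb' pr')) /le_trans; apply.
  by rewrite ler_wpM2l // ltW.
have Fc t y p : `|t - t0| < a -> `|y| <= b -> `|p - p0| < r -> {for ((t, y), p), continuous F}.
  by move=> ta yb pr; apply: Coo_cont CF _; apply: rU; exact: inB.
have /choice[Phi HPhi] : forall p, exists phi, `|p - p0| < r ->
    primitive t0 a (fun s => F ((s, phi s), p)) phi /\ forall t, `|t - t0| < a -> `|phi t| <= b.
  move=> p; have [pr|npr] := pselect (`|p - p0| < r); last by exists (fun=> 0).
  have [|||phi Hphi] := @picard R t0 a b M K (fun t y => F ((t, y), p)) a0 b0 M0 (ltW K0) aM aK.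
  - move=> phi Hphi t ta; have [cp pb] := Hphi t ta.
    apply: (@continuous_comp _ _ _ (fun s => ((s, phi s), p)) F); last exact: Fc.
    by apply: cont_pair; [apply: cont_pair => //; exact: cvg_id|exact: cvg_cst].
  - by move=> t y ta yb; exact: FM.
  - move=> t y y' ta yb yb'; apply: le_trans (FK _ _ _ _ _ ta yb' yb pr pr) _.
    by rewrite subrr normr0 addr0.
  by exists phi.
(* The constant given by [gronwall_small] is [2 * a * K], which is at most 1. *)
have Phi_lip p q t : `|p - p0| < r -> `|q - p0| < r -> `|t - t0| < a -> `|Phi q t - Phi p t| <= `|q - p|.
  move=> pr qr; have [pp pb] := HPhi p pr; have [pq qb] := HPhi q qr; move: t.
  have := @gronwall_small R t0 a K (K * `|q - p|) (2 * b) _ _ a0 (ltW K0) _ aK (primitiveB pq pp).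
  move=> H t ta; apply: le_trans (H _ _ _ t ta) _.
  - by rewrite mulr_ge0 // ltW.
  - by move=> s sa; rewrite -mulrDr; apply: FK => //; [exact: pb|exact: qb].
  - move=> s sa; apply: le_trans (ler_normB _ _) _; rewrite mulrDl !mul1r.
    by apply: lerD; [exact: qb|exact: pb].
  rewrite !mulrA ler_piMl //.
  by rewrite -mulrA; move: aK; lra.
pose B := box t0 a p0 r.
have oB : open B by exact: open_box.
pose phi z := Phi z.2 z.1.
have cphi z : B z -> {for z, continuous phi}.
  case: z => t p [/= ta pr]; apply/cvgrPdist_le => e e0.
  have e2 : 0 < e / 2 by rewrite divr_gt0.
  have [pp pb] := HPhi p pr.
  have N1 := cont_dist_le (primitive_continuous pp ta) e2.
  have pp0 : `|p - p| < e / 2 by rewrite subrr normr0.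
  exists ([set s | `|s - t0| < a /\ `|Phi p t - Phi p s| <= e / 2],
          [set q | `|q - p0| < r /\ `|q - p| < e / 2]).
    split => /=; apply: filterI.
    - exact: (near_dist ta).
    - exact: N1.
    - exact: (near_dist pr).
    - exact: (near_dist pp0).
  move=> [s q] /= [[sa H1] [qr H2]].
  have H3 := Phi_lip p q s pr qr sa.
  rewrite (splitr e) (_ : _ - _ = (Phi p t - Phi p s) - (Phi q s - Phi p s)); last by rewrite /phi /=; ring.
  by apply: le_trans (ler_normB _ _) (lerD H1 (le_trans H3 (ltW H2))).
pose j (z : R * P) : R * R * P := ((z.1, phi z), z.2).
have jB z : B z -> ball c r (j z).
  by case: z => t p [/= ta pr]; apply: inB => //; have [_] := HPhi p pr; apply.
have jU z : B z -> U (j z) by move=> Bz; apply: rU; exact: jB.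
have Cj n : Ck n B phi -> Ck n B j.
  move=> Cp; apply: Ck_pair => //; last exact: Ck_snd.
  by apply: Ck_pair => //; exact: Ck_fst.
have Cdir n w : Ck n B phi -> Ck n B (fun z => 'D_w F (j z)).
  move=> Cp; exact: (@Ck_compR _ _ _ _ B U j (fun y => 'D_w F y) _ oB jU (Cj n Cp) (Coo_derive w CF n)).
(* [psi v] is the solution of the variational equation [psi' = A psi + Bv v] with initial value 0,
   written by variation of constants. Being explicit, it is as smooth as [phi], by [Ck_pprim]. *)
pose A z := 'D_(((0, 1), 0) : R * R * P) F (j z).
pose Bv v z := 'D_(((0, 0), v) : R * R * P) F (j z).
pose E z := expR (pprim t0 a A z).
pose psi v z := E z * pprim t0 a (fun z => Bv v z * expR (- pprim t0 a A z)) z.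
have Cpsi n v : Ck n B phi -> Ck n B (psi v).
  move=> Cp; have CA := Ck_pprim fP a0 (Cdir n ((0, 1), 0) Cp).
  apply: CkM => //; first exact: Ck_exp.
  apply: Ck_pprim => //; apply: CkM => //; first exact: Cdir.
  by apply: Ck_exp => //; apply: CkN.
have dphi_time tau z : B z -> is_derive z ((tau, 0) : R * P) phi (tau * F (j z)).
  case: z => t p [/= ta pr]; have [pp pb] := HPhi p pr.
  apply: is_derive_slice1; rewrite /phi /=.
  exact: (primitive_is_derive tau pp ta).
have dphi_param v z : B z -> is_derive z ((0, v) : R * P) phi (psi v z).
  case: z => t p [/= ta pr]; have [pp pb] := HPhi p pr.
  have cA z : B z -> {for z, continuous A} by exact: (Cdir 0 _ cphi z).
  have AP := pprimP a0 cA pr.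
  have CAE : Ck 0 B (fun z => Bv v z * expR (- pprim t0 a A z)).
    apply: (CkM oB (Cdir 0 _ cphi)); apply: (Ck_exp oB); apply: (CkN oB).
    by apply: Ck_pprim => // z; exact: cA.
  have JP := pprimP a0 CAE pr.
  pose G s := psi v (s, p).
  have pG : primitive t0 a (fun s => A (s, p) * G s + Bv v (s, p)) G.
    split; first by have [J0 _] := JP; rewrite /G /psi /pprim /= J0 mulr0.
    move=> s sa; have [_ /(_ s sa) dA] := AP; have [_ /(_ s sa) dJ] := JP.
    have dE := @is_derive1_comp R (@expR R) _ s _ _ (is_derive_expR _) dA.
    have := is_deriveM dE dJ; rewrite /G /psi /E /pprim /=.
    set pA := prim t0 a (fun s => A (s, p)); set pJ := prim t0 a _.
    move=> H; apply: (is_derive_eq H); rewrite /GRing.scale /= expRN.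
    by field; rewrite gt_eqF // expR_gt0.
  have n1 : `|((0, 1), 0) : R * R * P| <= 1 by apply: le_trans (normv _ _) _; rewrite normr1 normr0 addr0.
  have n2 : `|((0, 0), v) : R * R * P| <= `|v| by apply: le_trans (normv _ _) _; rewrite normr0 add0r.
  have Ab s : `|s - t0| < a -> `|A (s, p)| <= K.
    move=> sa; apply: le_trans (Fb _ _ (jB (s, p) (conj sa pr))) _.
    by rewrite -[leRHS]mulr1 ler_wpM2l // ltW.
  have Bb s : `|s - t0| < a -> `|Bv v (s, p)| <= K * `|v|.
    move=> sa; apply: le_trans (Fb _ _ (jB (s, p) (conj sa pr))) _.
    by rewrite ler_wpM2l // ltW.
  have pAb s : `|s - t0| < a -> `|pprim t0 a A (s, p)| <= a * K.
    move=> sa; apply: (@le_trans _ _ (`|s - t0| * K)); last by rewrite ler_wpM2r // ltW.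
    by apply: (primitive_bound AP sa) => y ys; apply: Ab; exact: le_lt_trans sa.
  pose X := expR (a * K).
  have X0 : 0 <= X by exact: expR_ge0.
  (* A crude bound, used only as the a priori bound that [gronwall_small] requires. *)
  have Gb s : `|s - t0| < a -> `|G s| <= X * (a * (K * `|v| * X)).
    move=> sa; rewrite /G /psi normrM; apply: ler_pM => //.
      rewrite ger0_norm ?expR_ge0 // ler_expR; apply: le_trans (ler_norm _) _; exact: pAb.
    apply: (@le_trans _ _ (`|s - t0| * (K * `|v| * X))).
      apply: (primitive_bound JP sa) => y ys; have ya := le_lt_trans ys sa.
      rewrite normrM; apply: ler_pM => //; first exact: Bb.
      rewrite ger0_norm ?expR_ge0 // ler_expR; apply: le_trans (ler_norm _) _.
      by rewrite normrN; exact: pAb.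
    by rewrite ler_wpM2r ?(ltW sa) // !mulr_ge0 // ltW.
  apply: is_derive_of_bound => e e0.
  pose C := 2 * (a * (K * (2 * `|v|) ^+ 2)).
  have C0 : 0 <= C by rewrite !mulr_ge0 ?exprn_ge0 ?mulr_ge0 // ltW.
  have N1 : \forall h \near (0 : R), `|h| < e / (C + 1).
    have h0 : `|0 - 0 : R| < e / (C + 1) by rewrite subr0 normr0 divr_gt0 // ltr_wpDl.
    by apply: filterS (near_dist h0) => h; rewrite subr0.
  have N2 := @near_line R _ p v _ (near_dist pr).
  apply: filterS2 N1 N2 => h hC qr; set q := p + h *: v in qr.
  have -> : (t, p) + h *: (0, v) = (t, q) :> R * P by congr pair => /=; rewrite scaler0 addr0.
  have [pq qb] := HPhi q qr.
  have qp : `|q - p| = `|h| * `|v| by rewrite /q addrAC subrr add0r normrZ.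
  (* The Taylor remainder of [F]: by [Phi_lip] the increment [w] of its argument has norm at most
     [2 * |h| * |v|]. Since [c1] is quadratic in [h], so is the error after the Gronwall
     estimate. *)
  pose c1 := K * (2 * (`|h| * `|v|)) ^+ 2.
  have D'b s : `|s - t0| < a ->
     `|F ((s, Phi q s), q) - F ((s, Phi p s), p) - h * (A (s, p) * G s + Bv v (s, p))|
       <= K * `|Phi q s - Phi p s - h * G s| + c1.
    move=> sa; set d := Phi q s - Phi p s.
    pose w : R * R * P := ((0, d), q - p).
    have zw : ((s, Phi p s), p) + w = ((s, Phi q s), q) by exact: shift.
    have Bp : ball c r ((s, Phi p s), p) by apply: inB => //; exact: pb.
    have Bq : ball c r (((s, Phi p s), p) + w) by rewrite zw; apply: inB => //; exact: qb.
    have dF : differentiable F ((s, Phi p s), p) by apply: Coo_diff CF _; exact: rU.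
    have Dw : 'D_w F ((s, Phi p s), p) = d * A (s, p) + h * Bv v (s, p).
      have -> : w = d *: ((0, 1), 0) + h *: ((0, 0), v).
        rewrite /w /q; congr pair; [congr pair|] => /=.
        - by rewrite !scaler0 addr0.
        - by rewrite scaler0 addr0 [d *: 1]mulr1.
        - by rewrite scaler0 add0r addrAC subrr add0r.
      by rewrite /A /Bv /j /phi /= !deriveE // linearD !linearZ.
    have nw : `|w| <= 2 * (`|h| * `|v|).
      apply: le_trans (normv _ _) _; rewrite mulrDl mul1r -qp lerD2r.
      exact: Phi_lip.
    have Q := Fq _ _ Bp Bq; rewrite zw Dw in Q.
    have Qc : K * `|w| ^+ 2 <= c1.
      by rewrite /c1 ler_wpM2l ?(ltW K0) // lerXn2r ?nnegrE ?mulr_ge0.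
    rewrite (_ : _ - _ = A (s, p) * (d - h * G s) +
      (F ((s, Phi q s), q) - F ((s, Phi p s), p) - (d * A (s, p) + h * Bv v (s, p)))); last by ring.
    apply: le_trans (ler_normD _ _) (lerD _ (le_trans Q Qc)).
    by rewrite normrM ler_wpM2r //; exact: Ab.
  have := @gronwall_small R t0 a K c1 (2 * b + `|h| * (X * (a * (K * `|v| * X)))) _ _ a0 (ltW K0) _ aK
    (primitiveB (primitiveB pq pp) (primitiveZ h pG)) D'b.
  move=> H; apply: le_trans (H _ _ t ta) _.
  - by rewrite mulr_ge0 ?exprn_ge0 ?mulr_ge0 // ltW.
  - move=> s sa; apply: le_trans (ler_normB _ _) _; apply: lerD.
      apply: le_trans (ler_normB _ _) _; rewrite mulrDl !mul1r.
      by apply: lerD; [exact: qb|exact: pb].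
    by rewrite normrM ler_wpM2l //; exact: Gb.
  have -> : 2 * (a * c1) = `|h| * (C * `|h|) by rewrite /c1 /C; ring.
  rewrite ler_wpM2l //; have : C * `|h| <= (C + 1) * `|h| by rewrite ler_wpM2r // lerDl ler01.
  by move=> /le_trans; apply; rewrite mulrC -ler_pdivlMr ?ltr_wpDl // ltW.
(* Bootstrap: the time derivative [F (j z)] and the parameter derivative [psi v] are of class C^n as
   soon as [phi] is. *)
have Cphi n : Ck n B phi.
  elim: n => [|n IH]; first exact: cphi.
  apply: Ck_axes => //.
  - by move=> tau z Bz; have [] := dphi_time tau z Bz.
  - by move=> v z Bz; have [] := dphi_param v z Bz.
  - move=> tau; apply: (@Ck_eq _ _ _ _ _ (fun z => tau * F (j z))) => [//|z Bz|].
      by have [_ ->] := dphi_time tau z Bz.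
    apply: CkM => //; first exact: Ck_cst.
    exact: (@Ck_compR _ _ _ _ B U j F _ oB jU (Cj n IH) (CF n)).
  - move=> v; apply: (@Ck_eq _ _ _ _ _ (psi v)) => [//|z Bz|]; last exact: Cpsi.
    by have [_ ->] := dphi_param v z Bz.
exists a, r, phi; split => //.
  by move=> p pr; have [[]] := HPhi p pr.
move=> z Bz; split; first exact: jU.
by have [_ ->] := dphi_time 1 z Bz; rewrite mul1r.
Qed.

End Flow.

(** * The Frobenius theorem *)

Section Chain_rules.
Variable R : realType.
Implicit Types V W X : normedModType R.

Lemma Ck_fst_comp V W X n (U : set V) (f : V -> W * X) :
  open U -> Ck n U f -> Ck n U (fun x => (f x).1).
Proof. by move=> oU Cf; apply: (@Ck_lin_comp _ _ _ _ _ _ (fst : W * X -> W)) => // x; exact: cvg_fst. Qed.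

Lemma Ck_snd_comp V W X n (U : set V) (f : V -> W * X) :
  open U -> Ck n U f -> Ck n U (fun x => (f x).2).
Proof. by move=> oU Cf; apply: (@Ck_lin_comp _ _ _ _ _ _ (snd : W * X -> X)) => // x; exact: cvg_snd. Qed.

Lemma derive_dirD V W (f : V -> W) x v w : differentiable f x ->
  'D_(v + w) f x = 'D_v f x + 'D_w f x.
Proof. by move=> df; rewrite !deriveE // linearD. Qed.

Lemma derive_dirZ V W (f : V -> W) x (c : R) v : differentiable f x ->
  'D_(c *: v) f x = c *: 'D_v f x.
Proof. by move=> df; rewrite !deriveE // linearZ. Qed.

Lemma derive_dir_pair V (F : V * R -> R) z (v : V) (c : R) : differentiable F z ->
  'D_((v, c) : V * R) F z = 'D_((v, 0) : V * R) F z + c * 'D_((0, 1) : V * R) F z.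
Proof.
move=> dF; have -> : (v, c) = (v, 0) + c *: (0, 1) :> V * R.
  by congr pair => /=; rewrite ?scaler0 ?addr0 // add0r [c *: 1]mulr1.
by rewrite derive_dirD // derive_dirZ.
Qed.

Lemma derive_graph V W (h : V -> W) (f : V -> R) (F : W * R -> R) z v :
  differentiable h z -> differentiable f z -> differentiable F (h z, f z) ->
  'D_v (fun y => F (h y, f y)) z =
    'D_(('D_v h z, 0) : W * R) F (h z, f z) + 'D_v f z * 'D_((0, 1) : W * R) F (h z, f z).
Proof.
move=> dh df dF.
rewrite (@derive_comp _ _ _ _ (fun y => (h y, f y)) F) //; last exact: differentiable_pair.
by rewrite derive_pair // derive_dir_pair.
Qed.

Lemma differentiable_fst V W (z : V * W) : differentiable (fst : V * W -> V) z.
Proof. by apply: linear_differentiable => x; exact: cvg_fst. Qed.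

Lemma derive_fst V W (z v : V * W) : 'D_v (fst : V * W -> V) z = v.1.
Proof. by apply: derive_linear => x; exact: cvg_fst. Qed.

Lemma derive_fst_comp V W X (f : V -> W * X) x v : differentiable f x ->
  'D_v (fun x => (f x).1) x = ('D_v f x).1.
Proof. by move=> df; apply: (@derive_lin_comp _ _ _ _ (fst : W * X -> W)) => // y; exact: cvg_fst. Qed.

Lemma derive_snd_comp V W X (f : V -> W * X) x v : differentiable f x ->
  'D_v (fun x => (f x).2) x = ('D_v f x).2.
Proof. by move=> df; apply: (@derive_lin_comp _ _ _ _ (snd : W * X -> X)) => // y; exact: cvg_snd. Qed.

Lemma derive_snd V W (z v : V * W) : 'D_v (snd : V * W -> W) z = v.2.
Proof. by apply: derive_linear => x; exact: cvg_snd. Qed.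

Lemma differentiable_snd V W (z : V * W) : differentiable (snd : V * W -> W) z.
Proof. by apply: linear_differentiable => x; exact: cvg_snd. Qed.

Lemma derive_sum2 V (f g : V -> R) x v : differentiable f x -> differentiable g x ->
  'D_v (fun x => f x + g x) x = 'D_v f x + 'D_v g x.
Proof. by move=> df dg; rewrite deriveD //; apply: diff_derivable. Qed.

Lemma derive_mul V (f g : V -> R) x v : differentiable f x -> differentiable g x ->
  'D_v (fun x => f x * g x) x = 'D_v f x * g x + f x * 'D_v g x.
Proof.
move=> df dg; rewrite deriveM; [|exact: diff_derivable|exact: diff_derivable].
by rewrite /GRing.scale /= addrC [g x * _]mulrC.
Qed.

Lemma derive_subM V (A B C : V -> R) x v :
  differentiable A x -> differentiable B x -> differentiable C x ->
  'D_v (fun y => A y - B y * C y) x = 'D_v A x - ('D_v B x * C x + B x * 'D_v C x).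
Proof.
move=> dA dB dC; have dBC := differentiableM dB dC.
by rewrite -derive_mul //; exact: deriveB (diff_derivable dA) (diff_derivable dBC).
Qed.

Lemma open_preimage_within V W (A : set V) (B : set W) (h : V -> W) :
  open A -> open B -> (forall z, A z -> {for z, continuous h}) -> open (A `&` [set z | B (h z)]).
Proof.
move=> oA oB ch; rewrite openE => z [Az Bz]; apply: filterI.
  by apply: open_nbhs_nbhs.
by apply: (ch z Az); apply: open_nbhs_nbhs.
Qed.

End Chain_rules.

Section Frobenius.
Variable R : realType.
Local Notation R3 := (R * R * R)%type.

(** The system is [f_1 = G], [f_2 = H] on the graph of [f]. Two successive integrations give
    [f_2 = H] everywhere but [f_1 = G] only on the initial line. By compatibility the defect
    [w = f_1 - G] satisfies the linear equation [w_2 = H_u w] and vanishes on that line, hence near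
    it. *)
Theorem frobenius (G H : R3 -> R) (U : set R3) (a1 a2 u0 : R) :
  open U -> U ((a1, a2), u0) -> Coo U G -> Coo U H ->
  (forall z, U z ->
    'D_((0, 1, 0) : R3) G z + H z * 'D_((0, 0, 1) : R3) G z =
    'D_((1, 0, 0) : R3) H z + G z * 'D_((0, 0, 1) : R3) H z) ->
  exists (f : R3 -> R) (N : set R3),
    [/\ open N, N ((a1, a2), u0), Coo N f,
      (forall k, N ((a1, a2), k) -> f ((a1, a2), k) = k) &
      (forall z, N z -> [/\ U (z.1, f z),
         'D_((1, 0, 0) : R3) f z = G (z.1, f z) &
         'D_((0, 1, 0) : R3) f z = H (z.1, f z)])].
Proof.
move=> oU U0 CG CH compat.
(* first along the line [x_2 = a2] *)
pose h1 (w : R3) : R3 := ((w.1.1, a2), w.1.2 + w.2).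
have Ch1 n A : open A -> Ck n A h1.
  move=> oA; apply: Ck_pair => //; first apply: Ck_pair => //.
  - by apply: Ck_fst_comp => //; exact: Ck_fst.
  - exact: Ck_cst.
  - by apply: CkD => //; [apply: Ck_snd_comp => //; exact: Ck_fst|exact: Ck_snd].
pose U1 := setT `&` [set w | U (h1 w)].
have oU1 : open U1.
  by apply: open_preimage_within => //; [exact: openT|move=> z _; exact: (Ck_cont (Ch1 0%N _ (@openT _)))].
have CF1 : Coo U1 (fun w => G (h1 w)).
  by move=> n; apply: (@Ck_compR _ _ _ _ U1 U h1 G _ oU1 _ (Ch1 n _ oU1) (CG n)) => w [].
have [|e1 [r1 [phi1 [e10 r10 C1 phi10 H1]]]] := @ode_flow R R (fun w => G (h1 w)) U1 a1 u0 _ oU1 _ CF1.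
  by split => //; rewrite /= /h1 /= add0r.
pose B1 := box a1 e1 u0 r1.
have oB1 : open B1 by exact: open_box.
(* [phi1] starts from 0; adding the parameter gives the solution that starts from it. *)
pose g (w : R * R) := phi1 w + w.2.
have Cg : Coo B1 g by move=> n; apply: CkD => //; exact: Ck_snd.
have dg w : B1 w -> U ((w.1, a2), g w) /\ 'D_((1, 0) : R * R) g w = G ((w.1, a2), g w).
  move=> Bw; have [[_ Uw] Dw] := H1 w Bw; split => //.
  have d1 := Coo_diff C1 Bw.
  rewrite deriveD; [|exact: diff_derivable|by apply: diff_derivable; exact: (Coo_diff (fun n => @Ck_snd R _ _ n B1) Bw)].
  by rewrite Dw derive_linear ?addr0 // => x; exact: cvg_snd.
have g0 k : `|k - u0| < r1 -> g (a1, k) = k by move=> kr; rewrite /g phi10 // add0r.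
(* then in the direction of [x_2] *)
pose h2 (w : R * R * (R * R)) : R3 := ((w.2.1, w.1.1), w.1.2 + g w.2).
pose A2 := [set w : R * R * (R * R) | B1 w.2].
have oA2 : open A2.
  have := @open_preimage_within R (R * R * (R * R))%type _ setT B1 snd (@openT _) oB1.
  by rewrite setTI; apply => z _; exact: cvg_snd.
have Ch2 n A : open A -> A `<=` A2 -> Ck n A h2.
  move=> oA AA; have C2 m : Ck m A (snd : R * R * (R * R) -> R * R) by exact: Ck_snd.
  apply: Ck_pair => //; first apply: Ck_pair => //.
  - by apply: Ck_fst_comp.
  - by apply: Ck_fst_comp => //; exact: Ck_fst.
  - apply: CkD => //; first by apply: Ck_snd_comp => //; exact: Ck_fst.
    exact: (@Ck_compR _ _ _ _ A B1 snd g _ oA AA (C2 n) (Cg n)).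
pose U2 := A2 `&` [set w | U (h2 w)].
have oU2 : open U2.
  by apply: open_preimage_within => // z Az; exact: (Ck_cont (Ch2 0%N _ oA2 (@subset_refl _ _)) Az).
have U2A : U2 `<=` A2 by move=> w [].
have CF2 : Coo U2 (fun w => H (h2 w)).
  by move=> n; apply: (@Ck_compR _ _ _ _ U2 U h2 H _ oU2 _ (Ch2 n _ oU2 U2A) (CH n)) => w [].
have r1u : `|u0 - u0| < r1 by rewrite subrr normr0.
have B10 : B1 (a1, u0) by split => //=; rewrite subrr normr0.
have [|e2 [r2 [phi2 [e20 r20 C2 phi20 H2]]]] := @ode_flow R (R * R)%type (fun w => H (h2 w)) U2 a2 (a1, u0) _ oU2 _ CF2.
  by split => //; rewrite /= /h2 /= add0r g0.
pose B2 := box a2 e2 (a1, u0) r2.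
have oB2 : open B2 by exact: open_box.
(* Time comes first in [ode_flow]: here it is [x_2], while [x_1] and [k] form the parameter. *)
pose q (z : R3) : R * (R * R) := (z.1.2, (z.1.1, z.2)).
have Cq n A : open A -> Ck n A q.
  move=> oA; have Cf m : Ck m A (fst : R3 -> R * R) by exact: Ck_fst.
  apply: Ck_pair => //; first by apply: Ck_snd_comp.
  by apply: Ck_pair => //; [apply: Ck_fst_comp|exact: Ck_snd].
pose f z := phi2 (q z) + g (q z).2.
pose D0 := setT `&` [set z | B2 (q z)].
have oD0 : open D0.
  apply: (@open_preimage_within _ _ _ setT B2 q (@openT _) oB2) => z _.
  exact: (Ck_cont (Cq 0%N _ (@openT _)) I).
have D0B1 z : D0 z -> B1 (q z).2 by move=> [_ /H2 [[]]].
have Cf : Coo D0 f.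
  move=> n; apply: CkD => //.
    by apply: (@Ck_compR _ _ _ _ D0 B2 q phi2 _ oD0 _ (Cq n _ oD0) (C2 n)) => z [].
  apply: (@Ck_compR _ _ _ _ D0 B1 (fun z => (q z).2) g _ oD0 D0B1 _ (Cg n)).
  by apply: Ck_snd_comp => //; exact: Cq.
have fU z : D0 z -> U (z.1, f z).
  by case: z => -[s t] k [_ /H2 [[_ Uz] _]].
have f2 z : D0 z -> 'D_((0, 1, 0) : R3) f z = H (z.1, f z).
  move=> Dz; have Bq : B2 (q z) by case: Dz.
  have dq y : differentiable q y by exact: (Coo_diff (fun n => Cq n _ (@openT _))).
  have Dq y : 'D_((0, 1, 0) : R3) q y = (1, (0, 0)).
    have df := @differentiable_fst R (R * R)%type R y.
    have dfa : differentiable (fun z : R3 => z.1.1) y by apply: differentiable_comp => //; exact: differentiable_fst.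
    have dfb : differentiable (fun z : R3 => z.1.2) y by apply: differentiable_comp => //; exact: differentiable_snd.
    have ds := @differentiable_snd R (R * R)%type R y.
    rewrite (@derive_pair _ _ _ _ (fun z : R3 => z.1.2)) //; last exact: differentiable_pair.
    rewrite (@derive_pair _ _ _ _ (fun z : R3 => z.1.1)) //.
    by rewrite (derive_snd_comp _ df) (derive_fst_comp _ df) derive_fst derive_snd.
  have dq2 : differentiable (fun z => (q z).2) z.
    apply: (Coo_diff (U := setT)) => // n; apply: Ck_snd_comp; first exact: openT.
    by apply: Cq; exact: openT.
  have dphi := Coo_diff C2 Bq; have dgq := Coo_diff Cg (D0B1 z Dz).
  have dpq : differentiable (phi2 \o q) z by exact: differentiable_comp.
  have dgq2 : differentiable (g \o (fun z => (q z).2)) z by exact: differentiable_comp.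
  have [_ E2] := H2 _ Bq.
  rewrite (derive_sum2 _ dpq dgq2) (derive_comp _ (dq z) dphi) (derive_comp _ dq2 dgq).
  rewrite (derive_snd_comp _ (dq z)) Dq /= E2 (derive0 g) addr0.
  by case: (z) => -[].
have nD0 : \forall z \near ((a1, a2), u0), D0 z.
  apply: open_nbhs_nbhs; split => //; split => //=; split => /=.
    by rewrite subrr normr0.
  by rewrite subrr normr0.
have f1a s k : D0 ((s, a2), k) -> f ((s, a2), k) = g (s, k).
  by move=> [_ [_ /= Bs]]; rewrite /f /q /= phi20 // add0r.
have f0 k : D0 ((a1, a2), k) -> f ((a1, a2), k) = k.
  move=> Dk; rewrite f1a // g0 //.
  by have [_] := D0B1 _ Dk.
have f1 s k : D0 ((s, a2), k) -> 'D_((1, 0, 0) : R3) f ((s, a2), k) = G ((s, a2), f ((s, a2), k)).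
  move=> Ds; have [_ /= Eg] := dg _ (D0B1 _ Ds); rewrite [in RHS]f1a // -Eg.
  have line (tau : R) : ((s, a2), k) + tau *: (1, 0, 0) = ((s + tau, a2), k) :> R3.
    by congr pair; [congr pair|] => /=; rewrite ?scaler0 ?addr0 // [tau *: 1]mulr1.
  have lineg (tau : R) : (s, k) + tau *: (1, 0) = (s + tau, k) :> R * R.
    by congr pair => /=; rewrite ?scaler0 ?addr0 // [tau *: 1]mulr1.
  have := @derivable_line R _ _ f ((s, a2), k) (1, 0, 0) 0.
  have := @derivable_line R _ _ g (s, k) (1, 0) 0.
  rewrite scale0r addr0 => /(_ (diff_derivable (Coo_diff Cg (D0B1 _ Ds)))) dg1.
  rewrite scale0r addr0 => /(_ (diff_derivable (Coo_diff Cf Ds))) [_ <-].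
  case: dg1 => _ <-; apply: near_eq_derive.
  have := @near_line R _ ((s, a2), k) (1, 0, 0) D0 (open_nbhs_nbhs (conj oD0 Ds)).
  by apply: filterS => tau; rewrite line lineg; exact: f1a.
pose A z := 'D_((0, 0, 1) : R3) H (z.1, f z).
pose w z := 'D_((1, 0, 0) : R3) f z - G (z.1, f z).
have Cgr n : Ck n D0 (fun z : R3 => (z.1, f z)) by apply: Ck_pair => //; exact: Ck_fst.
have CA : Coo D0 A.
  move=> n; exact: (@Ck_compR _ _ _ _ D0 U _ (fun z => 'D_((0, 0, 1) : R3) H z) _ oD0 fU (Cgr n) (Coo_derive _ CH n)).
have Cw : Coo D0 w.
  move=> n; apply: CkB => //; first exact: (Coo_derive _ Cf n).
  exact: (@Ck_compR _ _ _ _ D0 U _ G _ oD0 fU (Cgr n) (CG n)).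
have w2 z : D0 z -> 'D_((0, 1, 0) : R3) w z = A z * w z.
  move=> Dz; have Uz := fU z Dz.
  have df := Coo_diff Cf Dz.
  have dGz := Coo_diff CG Uz; have dHz := Coo_diff CH Uz.
  have dfst := @differentiable_fst R (R * R)%type R z.
  have dgr := differentiable_pair dfst df.
  have dGg : differentiable (fun z => G (z.1, f z)) z by exact: (@differentiable_comp _ _ _ _ (fun z : R3 => (z.1, f z)) G).
  have ddf : differentiable (fun z => 'D_((1, 0, 0) : R3) f z) z by exact: Coo_diff (Coo_derive _ Cf) Dz.
  rewrite /w deriveB; [|exact: diff_derivable|exact: diff_derivable].
  rewrite derive_graph // derive_fst /= f2 //.
  rewrite (schwarz _ _ oD0 Dz (Cf 2%N)).
  rewrite (near_eq_derive (g := fun z => H (z.1, f z))); last first.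
    by apply: (open_near oD0 Dz) => y; exact: f2.
  rewrite derive_graph // derive_fst /= -/(A z).
  have := compat _ Uz; rewrite -/(A z).
  by move=> /(canRL (addrK _)) ->; ring.
have c0 : D0 ((a1, a2), u0) by exact: nbhs_singleton nD0.
pose K := `|A ((a1, a2), u0)| + 1.
pose S := `|w ((a1, a2), u0)| + 1.
have bnd (F : R3 -> R) : Coo D0 F -> \forall z \near ((a1, a2), u0), `|F z| <= `|F ((a1, a2), u0)| + 1.
  move=> CF; have := cont_dist_le (Coo_cont CF c0) ltr01.
  apply: filterS => z Hz; rewrite -[X in `|X|](subKr (F ((a1, a2), u0))).
  by apply: le_trans (ler_normB _ _) _; rewrite lerD2l.
have /nbhs_ballP[e /= e0 He] : \forall z \near ((a1, a2), u0), [/\ D0 z, `|A z| <= K & `|w z| <= S].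
  apply: filterS3 nD0 (bnd _ CA) (bnd _ Cw) => z Z1 Z2 Z3.
  by split; [exact: Z1|exact: Z2|exact: Z3].
have K0 : 0 < K by rewrite ltr_wpDl.
(* With [d * K <= 1/2], [gronwall_small] applies with [c = 0] and forces [w] to vanish. *)
pose d := Num.min e (2 * K)^-1.
have d0 : 0 < d by rewrite lt_min e0 /= invr_gt0 mulr_gt0.
have dK : d * K <= 2^-1.
  apply: (@le_trans _ _ ((2 * K)^-1 * K)).
    by rewrite ler_wpM2r ?(ltW K0) // ge_min lexx orbT.
  by rewrite invfM mulfVK ?gt_eqF.
have de : d <= e by rewrite ge_min lexx.
have inB s t k : `|s - a1| < d -> `|t - a2| < d -> `|k - u0| < d -> ball ((a1, a2), u0) e ((s, t), k).
  move=> sd td kd; split; [split|]; rewrite /= -ball_normE /= distrC; exact: lt_le_trans de.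
have w0 s t k : `|s - a1| < d -> `|t - a2| < d -> `|k - u0| < d -> w ((s, t), k) = 0.
  move=> sd td kd.
  have pw : primitive a2 d (fun t => A ((s, t), k) * w ((s, t), k)) (fun t => w ((s, t), k)).
    split.
      have a2d : `|a2 - a2| < d by rewrite subrr normr0.
      have [Dz _ _] := He _ (inB s a2 k sd a2d kd).
      by rewrite /w f1 // subrr.
    move=> y yd; have [Dz _ _] := He _ (inB s y k sd yd kd).
    have line (tau : R) : ((s, 0), k) + tau *: (0, 1, 0) = ((s, tau), k) :> R3.
      by congr pair; [congr pair|] => /=; rewrite ?scaler0 ?addr0 // add0r [tau *: 1]mulr1.
    have := @derivable_line R _ _ w ((s, 0), k) (0, 1, 0) y.
    rewrite line w2 // => /(_ (diff_derivable (Coo_diff Cw Dz))).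
    by congr is_derive; apply/funext => tau; rewrite line.
  apply/eqP; rewrite -normr_le0.
  have := @gronwall_small R a2 d K 0 S _ _ d0 (ltW K0) (lexx _) dK pw.
  rewrite mulr0 mulr0; apply => // y yd; have [Dz Ab Sb] := He _ (inB s y k sd yd kd) => //.
  by rewrite addr0 normrM ler_wpM2r.
exists f, (ball ((a1, a2), u0) d); split.
- exact: ball_open.
- exact: ballxx.
- by move=> n; apply: Ck_sub (Cf n) => z Bz; have [] := He _ (le_ball de Bz).
- by move=> k Bk; have [Dk _ _] := He _ (le_ball de Bk); exact: f0.
move=> [[s t] k] Bz; have [Dz _ _] := He _ (le_ball de Bz); split; [exact: fU| |exact: f2].
have : w ((s, t), k) = 0.
  by case: Bz => -[/= b1 b2] b3; move: b1 b2 b3; rewrite -!ball_normE /= => b1 b2 b3; apply: w0; rewrite distrC.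
by rewrite /w => /eqP; rewrite subr_eq0 => /eqP.
Qed.

End Frobenius.

(** * Jets *)

Section Jet_coordinates.
Variables (R : realType) (r : nat).
Implicit Types (j : jet R r) (i : 'I_#|multi r|) (a b : nat).

Lemma mu_inj : injective (@mu r).
Proof.
move=> i i' [] e1 e2; apply: enum_val_inj; apply: val_inj.
by apply: injective_projections; exact: val_inj.
Qed.

Lemma mu_le i : ((mu i).1 + (mu i).2 <= r)%N.
Proof. exact: valP (enum_val i). Qed.

Lemma mu_ex a b : (a + b <= r)%N -> exists i, mu i = (a, b).
Proof.
move=> ab.
have ar : (a < r.+1)%N by rewrite ltnS (leq_trans _ ab) // leq_addr.
have br : (b < r.+1)%N by rewrite ltnS (leq_trans _ ab) // leq_addl.
pose m : multi r := Sub (Ordinal ar, Ordinal br) ab.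
by exists (enum_rank m); rewrite /mu enum_rankK.
Qed.

Lemma ucoord_mu j i : ucoord j (mu i).1 (mu i).2 = j.2 0 i.
Proof.
rewrite /ucoord -surjective_pairing (big_pred1 i) // => i'.
by rewrite (inj_eq mu_inj).
Qed.

Lemma ucoordE j i a b : mu i = (a, b) -> ucoord j a b = j.2 0 i.
Proof. by move=> e; rewrite -(ucoord_mu j i) e. Qed.

Lemma ucoord_out j a b : (r < a + b)%N -> ucoord j a b = 0.
Proof.
move=> ab; rewrite /ucoord big_pred0 // => i; apply/negP => /eqP e.
by have := mu_le i; rewrite e /= leqNgt ab.
Qed.

Lemma jet_ext j j' : j.1 = j'.1 ->
  (forall a b, (a + b <= r)%N -> ucoord j a b = ucoord j' a b) -> j = j'.
Proof.
case: j j' => [x u] [x' u'] /= -> H; congr pair.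
apply/rowP => i; have := H _ _ (mu_le i).
by rewrite (ucoord_mu (x', u) i) (ucoord_mu (x', u') i).
Qed.

Definition ucl a b j : R := ucoord j a b.

Lemma ucl_linear a b : linear (ucl a b).
Proof.
move=> k j j'; rewrite /ucl /ucoord scaler_sumr -big_split /=.
by apply: eq_bigr => i _; rewrite !mxE.
Qed.
HB.instance Definition _ a b := GRing.isLinear.Build R (jet R r) R _ (ucl a b) (ucl_linear a b).

Lemma ucl_cont a b : continuous (ucl a b).
Proof.
apply: continuous_big => [|i _]; first exact: add_continuous.
move=> j; apply: (@continuous_comp _ _ _ snd (rcoord i)); first exact: cvg_snd.
exact: coord_continuous.
Qed.

Lemma ucoordD j j' a b : ucoord (j + j') a b = ucoord j a b + ucoord j' a b.
Proof. exact: (linearD (ucl a b)). Qed.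

Lemma ucoordZ k j a b : ucoord (k *: j) a b = k * ucoord j a b.
Proof. by rewrite -/(ucl a b _) linearZ. Qed.

Lemma Ck_ucoord n (U : set (jet R r)) a b : Ck n U (fun j => ucoord j a b).
Proof. exact: (@Ck_linear _ _ _ n U (ucl a b) (@ucl_cont a b)). Qed.

Lemma Ck_xu n (U : set (jet R r)) : open U -> Ck n U (@xu R r).
Proof. by move=> oU; apply: Ck_pair => //; [exact: Ck_fst|exact: Ck_ucoord]. Qed.

Lemma Ck_to_jet (V : normedModType R) n (U : set V) (f : V -> jet R r) : open U ->
  Ck n U (fun x => (f x).1) -> (forall a b, (a + b <= r)%N -> Ck n U (fun x => ucoord (f x) a b)) ->
  Ck n U f.
Proof.
move=> oU C1 C2; apply: (@Ck_eq _ _ _ _ _ (fun x => ((f x).1, (f x).2))) => // [x _|].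
  by case: (f x).
apply: Ck_pair => //; apply: Ck_row => // i.
have := C2 _ _ (mu_le i); apply: Ck_eq => // x _.
exact: ucoord_mu.
Qed.

Definition unit_dir i : jet R r := ((0, 0), delta_mx 0 i).

Lemma jet_decomp (v : jet R r) : v = (v.1, 0) + \sum_i v.2 0 i *: unit_dir i.
Proof.
have -> : \sum_i v.2 0 i *: unit_dir i = (0, \sum_i v.2 0 i *: delta_mx 0 i).
  elim/big_rec2: _ => // i x y _ ->; congr pair => /=.
  by rewrite addr0; congr pair; exact: mulr0.
by rewrite -row_sum_delta; case: v => x u; congr pair; rewrite /= ?addr0 ?add0r.
Qed.

(** At a fixed jet the total derivative is a directional derivative. The entries of order r, which
    would need derivatives of order r + 1, are cut off to 0, in accordance with [D1]. *)
Definition tot1 j : jet R r :=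
  ((1, 0), \row_i if ((mu i).1 + (mu i).2 < r)%N then ucoord j (mu i).1.+1 (mu i).2 else 0).
Definition tot2 j : jet R r :=
  ((0, 1), \row_i if ((mu i).1 + (mu i).2 < r)%N then ucoord j (mu i).1 (mu i).2.+1 else 0).

Lemma D1E (F : jet R r -> R) j : differentiable F j -> D1 F j = 'D_(tot1 j) F j.
Proof.
move=> dF; rewrite [tot1 j]jet_decomp derive_dirD //; congr (_ + _).
rewrite deriveE // linear_sum big_mkcond /=; apply: eq_bigr => i _.
rewrite linearZ /= mxE -deriveE //; case: ifP => _ //.
by rewrite scale0r.
Qed.

Lemma D2E (F : jet R r -> R) j : differentiable F j -> D2 F j = 'D_(tot2 j) F j.
Proof.
move=> dF; rewrite [tot2 j]jet_decomp derive_dirD //; congr (_ + _).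
rewrite deriveE // linear_sum big_mkcond /=; apply: eq_bigr => i _.
rewrite linearZ /= mxE -deriveE //; case: ifP => _ //.
by rewrite scale0r.
Qed.

Lemma ucoord_tot1 j a b : (a + b < r)%N -> ucoord (tot1 j) a b = ucoord j a.+1 b.
Proof.
move=> ab; have [i e] := mu_ex (ltnW ab).
by rewrite (ucoordE _ e) mxE e /= ab.
Qed.

Lemma ucoord_tot2 j a b : (a + b < r)%N -> ucoord (tot2 j) a b = ucoord j a b.+1.
Proof.
move=> ab; have [i e] := mu_ex (ltnW ab).
by rewrite (ucoordE _ e) mxE e /= ab.
Qed.

Lemma Ck_D1 n (U : set (jet R r)) (F : jet R r -> R) : open U -> Ck n.+1 U F -> Ck n U (@D1 R r F).
Proof.
move=> oU [_ DF]; apply: CkD => //; first exact: DF.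
by apply: Ck_sum => // i _; apply: CkM => //; [exact: Ck_ucoord|exact: DF].
Qed.

Lemma Ck_D2 n (U : set (jet R r)) (F : jet R r -> R) : open U -> Ck n.+1 U F -> Ck n U (@D2 R r F).
Proof.
move=> oU [_ DF]; apply: CkD => //; first exact: DF.
by apply: Ck_sum => // i _; apply: CkM => //; [exact: Ck_ucoord|exact: DF].
Qed.

(** Besides the order [m], the number [c] of differentiations in [x_2] is bounded, since the
    elimination on the invariant manifold proceeds by this number. *)
Definition agree m c j j' :=
  j.1 = j'.1 /\ forall a b, (a + b <= m)%N -> (b <= c)%N -> ucoord j a b = ucoord j' a b.

Definition depends m c (W : set (jet R r)) (F : jet R r -> R) :=
  forall j j', W j -> W j' -> agree m c j j' -> F j = F j'.

Lemma agree_line m c j j' v v' (h : R) : agree m c j j' -> agree m c v v' ->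
  agree m c (j + h *: v) (j' + h *: v').
Proof.
move=> [e1 e2] [e1' e2']; split; first by rewrite /= e1 e1'.
by move=> a b ab bc; rewrite !ucoordD !ucoordZ e2 // e2'.
Qed.

(** The difference quotients coincide for small [h]. The directions as well as the points may differ
    in the ignored coordinates, which is what absorbs the cut-off in [tot1] and [tot2]. *)
Lemma depends_derive m c W F j j' v v' : open W -> W j -> W j' -> depends m c W F ->
  agree m c j j' -> agree m c v v' -> 'D_v F j = 'D_v' F j'.
Proof.
move=> oW Wj Wj' dF ej ev.
have N1 := @near_line R _ j v W (open_nbhs_nbhs (conj oW Wj)).
have N2 := @near_line R _ j' v' W (open_nbhs_nbhs (conj oW Wj')).
have E : \forall h \near (0 : R), h^-1 *: (F (h *: v + j) - F j) = h^-1 *: (F (h *: v' + j') - F j').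
  apply: filterS2 N1 N2 => h W1 W2.
  rewrite (dF _ _ Wj Wj' ej) ![h *: _ + _]addrC; congr (_ *: (_ - _)).
  by apply: dF => //; exact: agree_line.
rewrite /derive; congr (lim _); rewrite eqEsubset; split; apply/near_eq_cvg/cvg_within => //.
by apply: filterS E => h ->.
Qed.

Lemma tot1_agree m c j j' : agree m.+1 c j j' -> agree m c (tot1 j) (tot1 j').
Proof.
move=> [e1 e2]; split => // a b ab bc.
have [abr|] := ltnP (a + b) r; first by rewrite !ucoord_tot1 //; apply: e2.
rewrite leq_eqVlt => /orP[/eqP e|abr]; last by rewrite !ucoord_out.
have [i ei] : exists i, mu i = (a, b) by apply: mu_ex; rewrite -e.
by rewrite !(ucoordE _ ei) !mxE ei /= -e ltnn.
Qed.

Lemma tot2_agree m c j j' : agree m.+1 c.+1 j j' -> agree m c (tot2 j) (tot2 j').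
Proof.
move=> [e1 e2]; split => // a b ab bc.
have [abr|] := ltnP (a + b) r; first by rewrite !ucoord_tot2 //; apply: e2; rewrite ?addnS.
rewrite leq_eqVlt => /orP[/eqP e|abr]; last by rewrite !ucoord_out.
have [i ei] : exists i, mu i = (a, b) by apply: mu_ex; rewrite -e.
by rewrite !(ucoordE _ ei) !mxE ei /= -e ltnn.
Qed.

Lemma agree_mono m c m' c' j j' : (m' <= m)%N -> (c' <= c)%N -> agree m c j j' -> agree m' c' j j'.
Proof.
move=> mm cc [e1 e2]; split => // a b ab bc.
by apply: e2; [exact: leq_trans mm|exact: leq_trans cc].
Qed.

Lemma depends_D1 m c W F : open W -> Coo W F -> depends m c W F -> depends m.+1 c W (@D1 R r F).
Proof.
move=> oW CF dF j j' Wj Wj' e; rewrite !D1E; [|exact: Coo_diff CF Wj'|exact: Coo_diff CF Wj].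
apply: (depends_derive oW Wj Wj' dF); last exact: tot1_agree.
by apply: agree_mono e.
Qed.

Lemma depends_D2 m c W F : open W -> Coo W F -> depends m c W F -> depends m.+1 c.+1 W (@D2 R r F).
Proof.
move=> oW CF dF j j' Wj Wj' e; rewrite !D2E; [|exact: Coo_diff CF Wj'|exact: Coo_diff CF Wj].
apply: (depends_derive oW Wj Wj' dF); last exact: tot2_agree.
by apply: agree_mono e.
Qed.

Lemma Coo_iterD W F a b : open W -> Coo W F -> Coo W (iter a (@D1 R r) (iter b (@D2 R r) F)).
Proof.
move=> oW CF; have C2 : Coo W (iter b (@D2 R r) F).
  by elim: b => // b IH n; apply: Ck_D2.
by elim: a => // a IH n; apply: Ck_D1.
Qed.

Lemma depends_iterD m c W F a b : open W -> Coo W F -> depends m c W F ->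
  depends (m + (a + b)) (c + b) W (iter a (@D1 R r) (iter b (@D2 R r) F)).
Proof.
move=> oW CF dF; elim: a => [|a IH].
  elim: b => [|b IH]; first by rewrite !addn0.
  by rewrite add0n !addnS; apply: depends_D2 => //; exact: (@Coo_iterD W F 0 b oW CF).
by rewrite addSn addnS; apply: depends_D1 => //; exact: Coo_iterD.
Qed.

Lemma D1_eq W F G j : open W -> W j -> (forall j, W j -> F j = G j) -> D1 F j = D1 G j.
Proof.
move=> oW Wj FG.
have N : \forall y \near j, F y = G y by apply: (open_near oW Wj) => y; exact: FG.
by congr (_ + _); [exact: near_eq_derive|apply: eq_bigr => i _; congr (_ * _); exact: near_eq_derive].
Qed.

Lemma D2_eq W F G j : open W -> W j -> (forall j, W j -> F j = G j) -> D2 F j = D2 G j.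
Proof.
move=> oW Wj FG.
have N : \forall y \near j, F y = G y by apply: (open_near oW Wj) => y; exact: FG.
by congr (_ + _); [exact: near_eq_derive|apply: eq_bigr => i _; congr (_ * _); exact: near_eq_derive].
Qed.

End Jet_coordinates.

Section Jet_of.
Variable R : realType.
Implicit Types (g : R * R -> R) (V : set (R * R)).

Lemma Coo_pd1 V g : Coo V g -> Coo V (@pd1 R g).
Proof. exact: Coo_derive. Qed.

Lemma Coo_pd2 V g : Coo V g -> Coo V (@pd2 R g).
Proof. exact: Coo_derive. Qed.

Lemma Coo_iter_pd V g a b : Coo V g -> Coo V (iter a (@pd1 R) (iter b (@pd2 R) g)).
Proof.
move=> Cg; have C2 : Coo V (iter b (@pd2 R) g) by elim: b => // b IH; exact: Coo_pd2.
by elim: a => // a IH; exact: Coo_pd1.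
Qed.

Lemma pd1_eq V g h x : open V -> V x -> (forall x, V x -> g x = h x) -> pd1 g x = pd1 h x.
Proof.
by move=> oV Vx gh; apply: near_eq_derive; apply: (open_near oV Vx) => y; exact: gh.
Qed.

Lemma pd2_eq V g h x : open V -> V x -> (forall x, V x -> g x = h x) -> pd2 g x = pd2 h x.
Proof.
by move=> oV Vx gh; apply: near_eq_derive; apply: (open_near oV Vx) => y; exact: gh.
Qed.

Lemma pd2_iter_pd1 V g a x : open V -> Coo V g -> V x ->
  pd2 (iter a (@pd1 R) g) x = iter a (@pd1 R) (pd2 g) x.
Proof.
move=> oV Cg; elim: a x => // a IH x Vx.
have Ca : Coo V (iter a (@pd1 R) g) by exact: (@Coo_iter_pd V g a 0).
rewrite !iterS /pd2 /pd1 (schwarz _ _ oV Vx (Ca 2%N)).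
by apply: (pd1_eq oV Vx) => y Vy; exact: IH.
Qed.

Lemma pd2_iter V g a b x : open V -> Coo V g -> V x ->
  pd2 (iter a (@pd1 R) (iter b (@pd2 R) g)) x = iter a (@pd1 R) (iter b.+1 (@pd2 R) g) x.
Proof. by move=> oV Cg Vx; rewrite (pd2_iter_pd1 a oV) //; exact: (@Coo_iter_pd V g 0 b). Qed.

Variable r : nat.

Lemma ucoord_jet_of g x a b : (a + b <= r)%N ->
  ucoord (jet_of r g x) a b = iter a (@pd1 R) (iter b (@pd2 R) g) x.
Proof. by move=> ab; have [i e] := mu_ex ab; rewrite (ucoordE _ e) mxE e. Qed.

Lemma Coo_jet_of V g : open V -> Coo V g -> Coo V (jet_of r g).
Proof.
move=> oV Cg n; apply: Ck_to_jet => //; first exact: Ck_id.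
move=> a b ab; apply: (Ck_eq oV _ (Coo_iter_pd a b Cg n)) => x _.
by rewrite ucoord_jet_of.
Qed.

Lemma derive_jet_of V g x v : open V -> Coo V g -> V x ->
  ('D_v (jet_of r g) x).1 = v /\
  forall a b, (a + b <= r)%N ->
    ucoord ('D_v (jet_of r g) x) a b = 'D_v (iter a (@pd1 R) (iter b (@pd2 R) g)) x.
Proof.
move=> oV Cg Vx; have dj := Coo_diff (Coo_jet_of oV Cg) Vx.
split; first by rewrite -derive_fst_comp // derive_id.
move=> a b ab.
rewrite -[LHS]/(ucl a b _) -(@derive_lin_comp _ _ _ _ (@ucl R r a b)) //; last exact: ucl_cont.
by congr derive; apply/funext => y; rewrite /= /ucl ucoord_jet_of.
Qed.

(** The jet of [g] moves in a direction that differs from [tot1] only in coordinates of order r, and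
    [F], of order [m < r], does not see these. *)
Lemma D1_jet_of V g W (F : jet R r -> R) m c x : open V -> Coo V g -> V x ->
  open W -> Coo W F -> W (jet_of r g x) -> depends m c W F -> (m < r)%N ->
  D1 F (jet_of r g x) = pd1 (fun y => F (jet_of r g y)) x.
Proof.
move=> oV Cg Vx oW CF Wx dF mr.
have dFx := Coo_diff CF Wx; have dj := Coo_diff (Coo_jet_of oV Cg) Vx.
have E : pd1 (fun y => F (jet_of r g y)) x = 'D_('D_(1, 0) (jet_of r g) x) F (jet_of r g x) := derive_comp ((1, 0) : R * R) dj dFx.
rewrite E (D1E dFx).
have [e1 e2] := derive_jet_of (1, 0) oV Cg Vx.
apply: (depends_derive oW Wx Wx dF) => //; split => // a b ab bc.
have abr : (a + b < r)%N by exact: leq_ltn_trans mr.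
by rewrite ucoord_tot1 // e2 ?(ltnW abr) // ucoord_jet_of.
Qed.

Lemma D2_jet_of V g W (F : jet R r -> R) m c x : open V -> Coo V g -> V x ->
  open W -> Coo W F -> W (jet_of r g x) -> depends m c W F -> (m < r)%N ->
  D2 F (jet_of r g x) = pd2 (fun y => F (jet_of r g y)) x.
Proof.
move=> oV Cg Vx oW CF Wx dF mr.
have dFx := Coo_diff CF Wx; have dj := Coo_diff (Coo_jet_of oV Cg) Vx.
have E : pd2 (fun y => F (jet_of r g y)) x = 'D_('D_(0, 1) (jet_of r g) x) F (jet_of r g x) := derive_comp ((0, 1) : R * R) dj dFx.
rewrite E (D2E dFx).
have [e1 e2] := derive_jet_of (0, 1) oV Cg Vx.
apply: (depends_derive oW Wx Wx dF) => //; split => // a b ab bc.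
have abr : (a + b < r)%N by exact: leq_ltn_trans mr.
rewrite ucoord_tot2 // e2 ?(ltnW abr) // ucoord_jet_of ?addnS //.
by rewrite -(pd2_iter a b oV Cg Vx).
Qed.

Lemma iterD_jet_of V g W (F : jet R r -> R) m c a b x : open V -> Coo V g ->
  open W -> Coo W F -> (forall y, V y -> W (jet_of r g y)) -> depends m c W F ->
  (m + (a + b) <= r)%N -> V x ->
  iter a (@D1 R r) (iter b (@D2 R r) F) (jet_of r g x) =
  iter a (@pd1 R) (iter b (@pd2 R) (fun y => F (jet_of r g y))) x.
Proof.
move=> oV Cg oW CF VW dF; elim: a x => [|a IH] x.
  elim: b x => [|b IH] x mr Vx //.
  have mr' : (m + (0 + b) < r)%N by move: mr; rewrite !add0n addnS.
  rewrite /= (D2_jet_of oV Cg Vx oW _ (VW x Vx) (@depends_iterD _ _ m c W F 0 b oW CF dF)) //; last first.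
    exact: (@Coo_iterD _ _ W F 0 b oW CF).
  by apply: (pd2_eq oV Vx) => y Vy; apply: IH => //; exact: ltnW.
rewrite addSn addnS => mr Vx.
rewrite /= (D1_jet_of oV Cg Vx oW _ (VW x Vx) (@depends_iterD _ _ m c W F a b oW CF dF)) //; last first.
  exact: Coo_iterD.
by apply: (pd1_eq oV Vx) => y Vy; apply: IH => //; exact: ltnW.
Qed.

End Jet_of.

(** * Polynomials with a prescribed jet *)

Section Taylor_polynomial.
Variables (R : realType).

(** The k-th derivative of the divided power [t^n / n!]; the case distinction prevents the truncated
    subtraction from giving 1 for [k > n]. *)
Definition divpow (n k : nat) (t : R) : R :=
  if (k <= n)%N then t ^+ (n - k) / ((n - k)`!)%:R else 0.

Lemma divpow_derive n k (t : R) : is_derive t 1 (divpow n k) (divpow n k.+1 t).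
Proof.
rewrite /divpow; have [kn|nk|->] := ltngtP k n.
- have -> : (n - k = (n - k.+1).+1)%N by rewrite subnSK.
  set m := (n - k.+1)%N.
  have D : is_derive t 1 (fun t => t ^+ m.+1) (m.+1%:R * t ^+ m).
    split; first exact: exprn_derivable.
    by rewrite exp_derive /GRing.scale /= mulr1.
  have -> : (fun t => t ^+ m.+1 / (m.+1)`!%:R) = (fun t : R => (m.+1)`!%:R^-1 * t ^+ m.+1).
    by apply/funext => s; rewrite mulrC.
  apply: (is_derive_eq (is_deriveZ ((m.+1)`!%:R^-1 : R) D)).
  rewrite /GRing.scale /= factS natrM; field.
  by rewrite !(addrC 1, natr1) !pnatr_eq0 -lt0n fact_gt0.
- exact: is_derive_cst.
- have -> : (fun s : R => s ^+ (n - n) / (n - n)`!%:R) = cst 1.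
    by apply/funext => s; rewrite subnn fact0 expr0 divr1.
  exact: is_derive_cst.
Qed.

Lemma divpow0 n k : divpow n k 0 = (n == k)%:R.
Proof.
rewrite /divpow; have [kn|nk|->] := ltngtP k n => //.
  by rewrite expr0n subn_eq0 leqNgt kn mul0r.
by rewrite subnn expr0 fact0 divr1.
Qed.

Lemma Ck_divpow n k m : Ck m [set: R] (divpow n k).
Proof.
elim: m k => [|m IH] k.
  move=> x _; apply: differentiable_continuous; apply/derivable1_diffP.
  by case: (divpow_derive n k x).
split => [x _|v]; first by apply/derivable1_diffP; case: (divpow_derive n k x).
apply: (@Ck_eq _ _ _ _ _ (fun x => v * divpow n k.+1 x)) => [|x _|].
- exact: openT.
- have [dx <-] := divpow_derive n k x.
  have dif : differentiable (divpow n k) x by apply/derivable1_diffP.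
  by rewrite -[in RHS](mulr1 v) (derive_dirZ _ _ dif).
- by apply: CkM; [exact: openT|exact: Ck_cst|exact: IH].
Qed.

Variables (r : nat) (j : jet R r).

(** The derivative of order [(k, l)] of the Taylor polynomial of [j] at its base point; with these
    indices differentiation is a shift. *)
Definition taylor (k l : nat) (y : R * R) : R :=
  \sum_i j.2 0 i * (divpow (mu i).1 k (y.1 - j.1.1) * divpow (mu i).2 l (y.2 - j.1.2)).

Lemma derive_divpow (h : {linear (R * R)%type -> R}) n k (c : R) v y : continuous h ->
  differentiable (fun y => divpow n k (h y - c)) y /\
  'D_v (fun y => divpow n k (h y - c)) y = h v * divpow n k.+1 (h y - c).
Proof.
move=> ch; have dh : differentiable h y by exact: linear_differentiable.
have dhc : differentiable (fun y => h y - c) y by exact: differentiableB.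
have [dx <-] := divpow_derive n k (h y - c).
have dif : differentiable (divpow n k) (h y - c) by apply/derivable1_diffP.
split; first exact: (@differentiable_comp _ _ _ _ (fun y => h y - c) (divpow n k)).
rewrite (@derive_comp _ _ _ _ (fun y => h y - c) (divpow n k)) //.
rewrite deriveB; [|exact: diff_derivable|exact: derivable_cst].
by rewrite derive_linear // derive_cst subr0 -[h v in LHS]mulr1 (derive_dirZ _ _ dif).
Qed.

Lemma derive_taylor k l v y :
  'D_v (taylor k l) y = v.1 * taylor k.+1 l y + v.2 * taylor k l.+1 y.
Proof.
pose F i (y : R * R) := j.2 0 i * (divpow (mu i).1 k (y.1 - j.1.1) * divpow (mu i).2 l (y.2 - j.1.2)).
have dF i : is_derive y v (F i) (v.1 * (j.2 0 i * (divpow (mu i).1 k.+1 (y.1 - j.1.1) * divpow (mu i).2 l (y.2 - j.1.2)))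
    + v.2 * (j.2 0 i * (divpow (mu i).1 k (y.1 - j.1.1) * divpow (mu i).2 l.+1 (y.2 - j.1.2)))).
  have [d1 e1] := @derive_divpow (fst : R * R -> R) (mu i).1 k j.1.1 v y (fun _ => cvg_fst).
  have [d2 e2] := @derive_divpow (snd : R * R -> R) (mu i).2 l j.1.2 v y (fun _ => cvg_snd).
  have D1 := derivableP (diff_derivable (v := v) d1); have D2 := derivableP (diff_derivable (v := v) d2).
  have H := is_deriveZ (j.2 0 i) (is_deriveM D1 D2).
  apply: (is_derive_eq H); rewrite e1 e2 /GRing.scale /=; ring.
have -> : taylor k l = \sum_i F i by apply/funext => z; rewrite fct_sumE.
have [_ ->] := is_derive_sum dF.
by rewrite big_split /= !mulr_sumr.
Qed.

Lemma Coo_taylor k l : Coo [set: R * R] (taylor k l).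
Proof.
have oT : open [set: R * R] by exact: openT.
move=> n; apply: Ck_sum => // i _; apply: CkM => //; first exact: Ck_cst.
apply: CkM => //.
  apply: (@Ck_compR _ _ _ _ _ setT (fun y : R * R => y.1 - j.1.1) (divpow (mu i).1 k)) => //.
  - by apply: CkB => //; [exact: Ck_fst|exact: Ck_cst].
  - exact: Ck_divpow.
apply: (@Ck_compR _ _ _ _ _ setT (fun y : R * R => y.2 - j.1.2) (divpow (mu i).2 l)) => //.
- by apply: CkB => //; [exact: Ck_snd|exact: Ck_cst].
- exact: Ck_divpow.
Qed.

Lemma iter_pd_taylor a b : iter a (@pd1 R) (iter b (@pd2 R) (taylor 0 0)) = taylor a b.
Proof.
have -> : iter b (@pd2 R) (taylor 0 0) = taylor 0 b.
  elim: b => // b IH; rewrite iterS IH; apply/funext => y.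
  by rewrite /pd2 derive_taylor /= mul0r add0r mul1r.
elim: a => // a IH; rewrite iterS IH; apply/funext => y.
by rewrite /pd1 derive_taylor /= mul0r addr0 mul1r.
Qed.

Lemma jet_of_taylor : jet_of r (taylor 0 0) j.1 = j.
Proof.
apply: jet_ext => // a b ab; rewrite ucoord_jet_of // iter_pd_taylor /taylor !subrr.
rewrite /ucoord [RHS]big_mkcond /=; apply: eq_bigr => i _.
rewrite !divpow0 -natrM mulnb -pair_eqE /= /eq_op /=.
by case: ifP => _; rewrite ?mulr1 ?mulr0.
Qed.

End Taylor_polynomial.

(** * The invariant manifold and prolongations *)

Section Invariant_manifold.
Variables (R : realType) (Z : set (R * R * R)) (xi zeta : R * R * R -> R).
Hypotheses (oZ : open Z) (Cxi : Coo Z xi) (Czeta : Coo Z zeta).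

Let Q := reduced xi zeta.

Definition overZ r : set (jet R r) := [set j | Z (xu j)].
Arguments overZ : clear implicits.

Lemma open_overZ r : open (overZ r).
Proof.
rewrite -[overZ r]setTI; apply: (@open_preimage_within _ _ _ _ Z (@xu R r) (@openT _) oZ) => j _.
exact: (Ck_cont (Ck_xu 0 (@openT _))).
Qed.

Lemma Coo_xu r (h : R * R * R -> R) : Coo Z h -> Coo (overZ r) (fun j => h (xu j)).
Proof.
move=> Ch n.
by apply: (@Ck_compR _ _ _ _ _ Z (@xu R r) h _ (@open_overZ r) _ (Ck_xu n (@open_overZ r)) (Ch n)).
Qed.

Lemma depends_xu r (h : R * R * R -> R) W : depends 0 0 W (fun j : jet R r => h (xu j)).
Proof. by move=> j j' _ _ [e1 e2]; rewrite /xu e1 e2. Qed.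

(* [T0] is [u_2] on the invariant manifold, and [T r a b] is [u_(a, b + 1)] there. *)
Definition T0 r (j : jet R r) : R := zeta (xu j) - xi (xu j) * ucoord j 1 0.

Definition T r a b : jet R r -> R := iter a (@D1 R r) (iter b (@D2 R r) (@T0 r)).
Arguments T : clear implicits.

Lemma Coo_T0 r : Coo (overZ r) (@T0 r).
Proof.
move=> n; have oW := @open_overZ r.
by apply: CkB => //; [exact: Coo_xu|apply: CkM => //; [exact: Coo_xu|exact: Ck_ucoord]].
Qed.

Lemma depends_T0 r : depends 1 0 (overZ r) (@T0 r).
Proof. by move=> j j' _ _ [e1 e2]; rewrite /T0 /xu e1 !e2. Qed.

Lemma Coo_T r a b : Coo (overZ r) (@T r a b).
Proof. by apply: Coo_iterD; [exact: open_overZ|exact: Coo_T0]. Qed.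

Lemma depends_T r a b : depends (a + b).+1 b (overZ r) (@T r a b).
Proof.
have := @depends_iterD _ _ 1 0 _ (@T0 r) a b (@open_overZ r) (@Coo_T0 r) (@depends_T0 r).
by rewrite add1n add0n.
Qed.

Lemma T0E r (j : jet R r) : qchar Q j = T0 j - ucoord j 0 1.
Proof. by rewrite /qchar /T0 /= mul1r. Qed.

(** Each equation of the manifold is thus solved for [u_(a, b+1)], and by [depends_T] its right-hand
    side involves at most [b] differentiations in [x_2]. So the manifold is a graph over [x] and the
    pure [x_1]-derivatives of [u]. *)
Lemma iterD_qchar r a b (j : jet R r) : (a + b < r)%N -> overZ r j ->
  iter a (@D1 R r) (iter b (@D2 R r) (qchar Q)) j = T r a b j - ucoord j a b.+1.
Proof.
have oW := @open_overZ r.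
have du c d j' : differentiable (fun j : jet R r => ucoord j c d) j'.
  by apply: (Coo_diff (U := setT)) => // n; exact: Ck_ucoord.
elim: a j => [|a IH] j.
  elim: b j => [|b IH] j; first by move=> _ _; exact: T0E.
  rewrite add0n => br Wj /=.
  rewrite (D2_eq oW Wj (fun j Wj => IH j (ltnW br) Wj)).
  have dT := Coo_diff (@Coo_T r 0 b) Wj.
  rewrite D2E; last exact: differentiableB.
  rewrite deriveB; [|exact: diff_derivable|exact: diff_derivable].
  rewrite -[X in X - _]D2E //; congr (_ - _).
  by apply: etrans (derive_linear _ _ (@ucl_cont R r 0 b.+1)) _; exact: ucoord_tot2.
rewrite addSn => abr Wj /=.
rewrite (D1_eq oW Wj (fun j Wj => IH j (ltnW abr) Wj)).
have dT := Coo_diff (@Coo_T r a b) Wj.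
rewrite D1E; last exact: differentiableB.
rewrite deriveB; [|exact: diff_derivable|exact: diff_derivable].
rewrite -[X in X - _]D1E //; congr (_ - _).
apply: etrans (derive_linear _ _ (@ucl_cont R r a b.+1)) _.
by apply: ucoord_tot1; rewrite addnS.
Qed.

Lemma qmanP r (j : jet R r) : overZ r j ->
  qman Q j <-> forall a b, (a + b < r)%N -> ucoord j a b.+1 = T r a b j.
Proof.
move=> Wj; split => H a b ab.
  by have := H a b ab; rewrite iterD_qchar // => /eqP; rewrite subr_eq0 => /eqP.
by rewrite iterD_qchar // H // subrr.
Qed.

Lemma qman_uniq r (j j' : jet R r) : overZ r j -> overZ r j' -> qman Q j -> qman Q j' ->
  j.1 = j'.1 -> (forall a, ucoord j a 0 = ucoord j' a 0) -> j = j'.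
Proof.
move=> Wj Wj' /(qmanP Wj) Qj /(qmanP Wj') Qj' e1 e2; apply: jet_ext => // a b _.
have [n bn] := ubnP b; elim: n b a bn => // n IH [|b] a; first by rewrite e2.
rewrite ltnS => bn.
have [abr|abr] := ltnP (a + b) r; last by rewrite !ucoord_out ?addnS.
rewrite Qj // Qj' //; apply: (depends_T Wj Wj'); split => // a' b' _ bb'.
by apply: IH; exact: leq_ltn_trans bn.
Qed.

(* Retraction onto the invariant manifold, filling in the derivatives by increasing order in x_2. *)
Definition fill r b (j : jet R r) : jet R r :=
  (j.1, \row_i if (mu i).2 == b.+1 then T r (mu i).1 b j else j.2 0 i).

Fixpoint retract_upto r b (j : jet R r) : jet R r :=
  if b is b'.+1 then fill b' (retract_upto b' j) else j.

Definition retract r (j : jet R r) : jet R r := retract_upto r j.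

Lemma ucoord_fill r b (j : jet R r) a b' : (a + b' <= r)%N ->
  ucoord (fill b j) a b' = if b' == b.+1 then T r a b j else ucoord j a b'.
Proof.
move=> ab; have [i e] := mu_ex ab; rewrite (ucoordE _ e) mxE e /=.
by case: ifP => // _; rewrite (ucoordE _ e).
Qed.

Lemma ucoord_retract_pure r b (j : jet R r) a : ucoord (retract_upto b j) a 0 = ucoord j a 0.
Proof.
elim: b => // b IH; have [ar|ar] := leqP a r; last by rewrite !ucoord_out ?addn0.
by rewrite /= ucoord_fill ?addn0.
Qed.

Lemma retract_fst r b (j : jet R r) : (retract_upto b j).1 = j.1.
Proof. by elim: b. Qed.

Lemma xu_retract r b (j : jet R r) : xu (retract_upto b j) = xu j.
Proof. by rewrite /xu retract_fst ucoord_retract_pure. Qed.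

Lemma Coo_fill r b : Coo (overZ r) (@fill r b).
Proof.
move=> n; have oW := @open_overZ r; apply: Ck_to_jet => //; first exact: Ck_fst.
move=> a b' ab; have [e|ne] := eqVneq b' b.+1.
  by apply: (Ck_eq oW _ (@Coo_T r a b n)) => j _; rewrite ucoord_fill // e eqxx.
by apply: (Ck_eq oW _ (Ck_ucoord n (overZ r) a b')) => j _; rewrite ucoord_fill // (negbTE ne).
Qed.

Lemma Coo_retract_upto r b : Coo (overZ r) (@retract_upto r b).
Proof.
have oW := @open_overZ r.
elim: b => [|b IH] n; first exact: Ck_id.
apply: (@Ck_comp _ _ _ _ _ _ (overZ r) (@retract_upto r b) (@fill r b)) => //.
- by move=> j; rewrite /overZ /= xu_retract.
- exact: Coo_fill.
Qed.

(** An equation that holds already is not destroyed by later fillings: these change only coordinates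
    with more differentiations in [x_2] than occur in its right-hand side. *)
Lemma retract_uptoP r b (j : jet R r) a b' : overZ r j -> (b' < b)%N -> (a + b' < r)%N ->
  ucoord (retract_upto b j) a b'.+1 = T r a b' (retract_upto b j).
Proof.
move=> Wj; elim: b => // b IH; rewrite ltnS leq_eqVlt => bb ab /=.
have Wr : overZ r (retract_upto b j) by rewrite /overZ /= xu_retract.
have Wf : overZ r (fill b (retract_upto b j)) by have := xu_retract b.+1 j; rewrite /overZ /= => ->.
have -> : T r a b' (fill b (retract_upto b j)) = T r a b' (retract_upto b j).
  apply: (depends_T Wf Wr); split => // c d _ db.
  have [cd|cd] := leqP (c + d) r; last by rewrite !ucoord_out.
  rewrite ucoord_fill // ifN //; apply/eqP => e.
  by move: bb; rewrite -leq_eqVlt leqNgt => /negP; apply; rewrite -e.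
rewrite ucoord_fill ?addnS //.
by move: bb => /orP[/eqP ->|bb]; [rewrite eqxx|rewrite eqSS ltn_eqF // IH].
Qed.

Lemma retract_qman r (j : jet R r) : overZ r j -> qman Q (retract j).
Proof.
move=> Wj; apply/qmanP; first by rewrite /overZ /= xu_retract.
move=> a b ab; apply: retract_uptoP => //; exact: leq_ltn_trans (leq_addl a b) ab.
Qed.

Lemma retract_id r (j : jet R r) : overZ r j -> qman Q j -> retract j = j.
Proof.
move=> Wj Qj; apply: qman_uniq => //.
- by rewrite /overZ /= xu_retract.
- exact: retract_qman.
- exact: retract_fst.
- by move=> a; exact: ucoord_retract_pure.
Qed.

End Invariant_manifold.
Arguments overZ {R} Z {r} _.

Lemma derive_plane (R : realType) (f : R * R -> R) x (v : R * R) : differentiable f x ->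
  'D_v f x = v.1 * 'D_(1, 0) f x + v.2 * 'D_(0, 1) f x.
Proof.
move=> df; have -> : v = v.1 *: (1, 0) + v.2 *: (0, 1).
  by case: v => v1 v2; congr pair; rewrite /= ?scaler0 ?addr0 ?add0r // [_ *: 1]mulr1.
by rewrite derive_dirD // !derive_dirZ //= !scaler0 addr0 add0r ![_ *: 1]mulr1.
Qed.

(** * The prolongation along the invariant manifold *)

Section Prolongation.
Variable R : realType.
Local Notation R3 := (R * R * R)%type.
Variables (Z : set R3) (xi zeta : R3 -> R).
Hypotheses (oZ : open Z) (Cxi : Coo Z xi) (Czeta : Coo Z zeta).

Let Q := reduced xi zeta.

Definition charac (g : R * R -> R) (y : R * R) : R :=
  zeta (y, g y) - xi (y, g y) * pd1 g y - pd2 g y.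

Lemma xu_jet_of r g (y : R * R) : xu (jet_of r g y) = (y, g y).
Proof. by rewrite /xu ucoord_jet_of. Qed.

Lemma qchar_jet_of r g (y : R * R) : (0 < r)%N -> qchar Q (jet_of r g y) = charac g y.
Proof. by move=> r0; rewrite /qchar /charac xu_jet_of !ucoord_jet_of //= mul1r. Qed.

Lemma Coo_graph V (g : R * R -> R) (h : R3 -> R) : open V -> Coo V g ->
  (forall y, V y -> Z (y, g y)) -> Coo Z h -> Coo V (fun y => h (y, g y)).
Proof.
move=> oV Cg VZ Ch n.
apply: (@Ck_compR _ _ _ _ V Z (fun y => (y, g y)) h _ oV VZ _ (Ch n)).
by apply: Ck_pair => //; exact: Ck_id.
Qed.

Lemma Coo_charac V g : open V -> Coo V g -> (forall y, V y -> Z (y, g y)) -> Coo V (charac g).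
Proof.
move=> oV Cg VZ n; apply: CkB => //; last exact: Coo_pd2.
apply: CkB => //; first exact: Coo_graph.
by apply: CkM => //; [exact: Coo_graph|exact: Coo_pd1].
Qed.

Lemma Coo_qchar r : Coo (overZ Z) (qchar Q : jet R r -> R).
Proof.
move=> n; have oW := @open_overZ R Z oZ r.
apply: (@Ck_eq _ _ _ _ _ (fun j : jet R r => T0 xi zeta j - ucoord j 0 1)) => // [j _|].
  by rewrite T0E.
by apply: CkB => //; [exact: Coo_T0|exact: Ck_ucoord].
Qed.

Lemma depends_qchar r W : depends 1 1 W (qchar Q : jet R r -> R).
Proof. by move=> j j' _ _ [e1 e2]; rewrite /qchar /xu e1 !e2. Qed.

Lemma iterD_qchar_jet_of r V g a b x : open V -> Coo V g -> (forall y, V y -> Z (y, g y)) ->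
  V x -> (a + b < r)%N ->
  iter a (@D1 R r) (iter b (@D2 R r) (qchar Q)) (jet_of r g x) =
  iter a (@pd1 R) (iter b (@pd2 R) (charac g)) x.
Proof.
move=> oV Cg VZ Vx ab.
have r0 : (0 < r)%N by exact: leq_ltn_trans ab.
rewrite (@iterD_jet_of R r V g (overZ Z) (qchar Q) 1 1) //.
- suff -> : (fun y => qchar Q (jet_of r g y)) = charac g by [].
  by apply/funext => y; rewrite qchar_jet_of.
- exact: open_overZ.
- exact: Coo_qchar.
- by move=> y Vy; rewrite /overZ /= xu_jet_of; exact: VZ.
- exact: depends_qchar.
Qed.

Lemma D1_cst r (c : R) (j : jet R r) : D1 (fun=> c) j = 0.
Proof. by rewrite D1E ?derive_cst //; exact: differentiable_cst. Qed.

Lemma D2_cst r (c : R) (j : jet R r) : D2 (fun=> c) j = 0.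
Proof. by rewrite D2E ?derive_cst //; exact: differentiable_cst. Qed.

Lemma pcoef2S r b (j : jet R r) : pcoef2 Q b.+1 j =
  D2 (pcoef2 Q b) j - D2 (fun j => xi (xu j)) j * ucoord j 1 b.
Proof. by rewrite /= D2_cst mul0r subr0. Qed.

Lemma pcoefS r a b (j : jet R r) : pcoef Q a.+1 b j =
  D1 (pcoef Q a b) j - D1 (fun j => xi (xu j)) j * ucoord j a.+1 b.
Proof. by rewrite /= D1_cst mul0r subr0. Qed.

Lemma Coo_pcoef r a b : Coo (overZ Z) (pcoef Q a b : jet R r -> R).
Proof.
have oW := @open_overZ R Z oZ r; have Cx := @Coo_xu R Z oZ r xi Cxi.
elim: a => [|a IH].
  elim: b => [|b IH] /=; first exact: Coo_xu.
  move=> n; apply: (Ck_eq oW (fun j _ => esym (pcoef2S b j))).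
  by apply: CkB => //; [exact: Ck_D2|apply: CkM => //; [exact: Ck_D2|exact: Ck_ucoord]].
move=> n; apply: (Ck_eq oW (fun j _ => esym (pcoefS a b j))).
by apply: CkB => //; [exact: Ck_D1|apply: CkM => //; [exact: Ck_D1|exact: Ck_ucoord]].
Qed.

Lemma depends_pcoef r a b : depends (a + b) (a + b) (overZ Z) (pcoef Q a b : jet R r -> R).
Proof.
have oW := @open_overZ R Z oZ r; have Cx := @Coo_xu R Z oZ r xi Cxi.
have dx := @depends_xu R r xi (overZ Z).
elim: a => [|a IH].
  elim: b => [|b IH]; first exact: (depends_xu zeta).
  move=> j j' Wj Wj' e; rewrite /pcoef !pcoef2S; congr (_ - _ * _).
  - exact: (depends_D2 oW (@Coo_pcoef r 0 b) IH).
  - by apply: (depends_D2 oW Cx dx) => //; apply: agree_mono e.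
  - by case: e => _; apply.
move=> j j' Wj Wj' e; rewrite !pcoefS; congr (_ - _ * _).
- by apply: (depends_D1 oW (@Coo_pcoef r a b) IH) => //; apply: agree_mono e.
- by apply: (depends_D1 oW Cx dx) => //; apply: agree_mono e.
- by case: e => _; apply => //; exact: leq_addl.
Qed.

Lemma derive_leibniz (V : normedModType R) (A B C E : V -> R) x v :
  differentiable A x -> differentiable B x -> differentiable C x -> differentiable E x ->
  'D_v (fun y => A y + B y * C y + E y) x =
  'D_v A x + ('D_v B x * C x + B x * 'D_v C x) + 'D_v E x.
Proof.
move=> dA dB dC dE; have dBC := differentiableM dB dC.
by rewrite -derive_mul // -(derive_sum2 _ dA dBC) -(derive_sum2 _ (differentiableD dA dBC) dE).
Qed.

(** The closed formula for the coefficients of the prolongation. For [a + b = r] it contains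
    derivatives of order r + 1, which cancel; it is therefore stated along a function [g] and not
    for jets of order r. *)
Lemma pcoef_jet_of r V g a b x : open V -> Coo V g -> (forall y, V y -> Z (y, g y)) ->
  V x -> (a + b <= r)%N ->
  pcoef Q a b (jet_of r g x) = iter a (@pd1 R) (iter b (@pd2 R) (charac g)) x
    + xi (x, g x) * iter a.+1 (@pd1 R) (iter b (@pd2 R) g) x
    + iter a (@pd1 R) (iter b.+1 (@pd2 R) g) x.
Proof.
move=> oV Cg VZ.
have oW := @open_overZ R Z oZ r; have Cx := @Coo_xu R Z oZ r xi Cxi.
have dx := @depends_xu R r xi (overZ Z).
have Wg y : V y -> overZ Z (jet_of r g y) by move=> Vy; rewrite /overZ /= xu_jet_of; exact: VZ.
have Cq := Coo_charac oV Cg VZ; have Cxg := Coo_graph oV Cg VZ Cxi.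
have xig : (fun y => xi (xu (jet_of r g y))) = (fun y => xi (y, g y)).
  by apply/funext => y; rewrite xu_jet_of.
have dq a' b' y : V y -> differentiable (iter a' (@pd1 R) (iter b' (@pd2 R) (charac g))) y.
  by move=> Vy; exact: Coo_diff (Coo_iter_pd a' b' Cq) Vy.
have dg a' b' y : V y -> differentiable (iter a' (@pd1 R) (iter b' (@pd2 R) g)) y.
  by move=> Vy; exact: Coo_diff (Coo_iter_pd a' b' Cg) Vy.
elim: a x => [|a IH] x.
  elim: b x => [|b IH] x Vx.
    by move=> _; rewrite /= xu_jet_of /charac /=; ring.
  rewrite add0n => br; rewrite /pcoef pcoef2S -/(pcoef Q 0 b).
  rewrite (D2_jet_of oV Cg Vx oW (@Coo_pcoef r 0 b) (Wg x Vx) (@depends_pcoef r 0 b)) //.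
  rewrite (D2_jet_of oV Cg Vx oW Cx (Wg x Vx) dx) ?(leq_ltn_trans (leq0n _) br) //.
  rewrite (pd2_eq oV Vx (fun y Vy => IH y Vy (ltnW br))) xig.
  rewrite ucoord_jet_of //.
  rewrite {1}/pd2 derive_leibniz; [|exact: dq|exact: (Coo_diff Cxg Vx)|exact: dg|exact: dg].
  have := @pd2_iter R V g 1 b x oV Cg Vx; rewrite /pd2 /= => ->; ring.
rewrite addSn => Vx abr; rewrite pcoefS.
rewrite (D1_jet_of oV Cg Vx oW (@Coo_pcoef r a b) (Wg x Vx) (@depends_pcoef r a b)) //.
rewrite (D1_jet_of oV Cg Vx oW Cx (Wg x Vx) dx) ?(leq_ltn_trans (leq0n _) abr) //.
rewrite (pd1_eq oV Vx (fun y Vy => IH y Vy (ltnW abr))) xig.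
rewrite ucoord_jet_of //.
rewrite {1}/pd1 derive_leibniz; [|exact: dq|exact: (Coo_diff Cxg Vx)|exact: (dg a.+1 b)|exact: dg].
rewrite /pd1 /=; ring.
Qed.

Lemma prolongE r (F : jet R r -> R) j (p : jet R r) : differentiable F j ->
  p.1 = (xi (xu j), 1) -> (forall a b, (a + b <= r)%N -> ucoord p a b = pcoef Q a b j) ->
  prolong Q F j = 'D_p F j.
Proof.
move=> dF e1 e2; rewrite [p]jet_decomp derive_dirD // e1 /prolong; congr (_ + _).
  have -> : ((xi (xu j), 1), 0) = xi (xu j) *: ((1, 0), 0) + ((0, 1), 0) :> jet R r.
    congr pair; last by rewrite /= scaler0 addr0.
    by congr pair; rewrite /= ?addr0 ?scaler0 ?add0r // [_ *: 1]mulr1.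
  by rewrite derive_dirD // derive_dirZ // mul1r.
rewrite deriveE // linear_sum; apply: eq_bigr => i _.
by rewrite linearZ /= -e2 ?mu_le // ucoord_mu -deriveE.
Qed.

(* Fill in the derivatives of order r + 1 as well and take the Taylor polynomial,
   so that the characteristic vanishes at the point to order r + 1. *)
Lemma invariant_jet r (j : jet R r) : overZ Z j -> qman Q j ->
  exists V g, [/\ open V, V j.1, Coo V g & forall y, V y -> Z (y, g y)] /\
    [/\ jet_of r g j.1 = j &
      forall a b, (a + b <= r)%N -> iter a (@pd1 R) (iter b (@pd2 R) (charac g)) j.1 = 0].
Proof.
move=> Wj Qj.
(* The coordinates of order r + 1 get the junk value 0 of [ucoord]. The retraction replaces it
   wherever [x_2] is involved; the pure [x_1]-derivative of order r + 1 may be arbitrary. *)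
pose j1 : jet R r.+1 := (j.1, \row_i ucoord j (mu i).1 (mu i).2).
have uj1 a b : (a + b <= r.+1)%N -> ucoord j1 a b = ucoord j a b.
  by move=> ab; have [i e] := mu_ex ab; rewrite (ucoordE _ e) mxE e.
have Wj1 : overZ Z j1 by rewrite /overZ /= /xu uj1.
pose J := retract xi zeta j1.
have QJ : qman Q J := retract_qman oZ Cxi Czeta Wj1.
pose g := taylor J 0 0.
have J1 : J.1 = j.1 by exact: retract_fst.
have Cg : Coo [set: R * R] g by exact: Coo_taylor.
have gJ : jet_of r.+1 g j.1 = J by rewrite -J1; exact: jet_of_taylor.
pose V := setT `&` [set y : R * R | Z (y, g y)].
have oV : open V.
  apply: open_preimage_within => //; first exact: openT.
  move=> y _; apply: differentiable_continuous; apply: differentiable_pair => //.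
  exact: (Coo_diff Cg).
have CgV : Coo V g by move=> n; apply: Ck_sub (Cg n).
have VZ y : V y -> Z (y, g y) by case.
have Vj : V j.1.
  split => //=; have := Wj1; rewrite /overZ /= -(xu_retract xi zeta r.+1 j1).
  by rewrite -[retract_upto _ _ _ _]/J -gJ xu_jet_of.
have K a b : (a + b <= r)%N -> iter a (@pd1 R) (iter b (@pd2 R) (charac g)) j.1 = 0.
  move=> ab; rewrite -(@iterD_qchar_jet_of r.+1 V) // gJ; exact: QJ.
exists V, g; split; first by split.
split => //.
have Wg : overZ Z (jet_of r g j.1) by rewrite /overZ /= xu_jet_of; exact: VZ.
apply: (qman_uniq oZ Cxi Czeta) => //.
  by move=> a b ab; rewrite (@iterD_qchar_jet_of r V) // K // ltnW.
move=> a; have [ar|ar] := leqP a r; last by rewrite !ucoord_out ?addn0.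
rewrite ucoord_jet_of ?addn0 //.
have := ucoord_retract_pure xi zeta r.+1 j1 a; rewrite -[retract_upto _ _ _ _]/J -gJ.
by rewrite ucoord_jet_of ?addn0 ?(leqW ar) // uj1 ?addn0 ?(leqW ar).
Qed.

Lemma Coo_retract_jet_of r V (g : R * R -> R) : open V -> Coo V g ->
  (forall y, V y -> Z (y, g y)) -> Coo V (fun y => retract xi zeta (jet_of r g y)).
Proof.
move=> oV Cg VZ n; have oW := @open_overZ R Z oZ r.
apply: (@Ck_comp _ _ _ _ _ V (overZ Z) (jet_of r g) (@retract _ xi zeta r) _ _ oV oW).
- by move=> y Vy; rewrite /overZ /= xu_jet_of; exact: VZ.
- exact: Coo_jet_of.
- exact: (Coo_retract_upto oZ Cxi Czeta r r n).
Qed.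

(** As the characteristic of [g] vanishes at [x] together with its derivatives up to order r, the
    jets of [g] satisfy the equations of the manifold up to terms with zero first derivative at [x].
    An induction on the number of [x_2]-differentiations then shows that the retraction does not
    change the velocity. *)
Lemma derive_retract_jet_of r V g (v x : R * R) : open V -> Coo V g ->
  (forall y, V y -> Z (y, g y)) -> V x -> qman Q (jet_of r g x) ->
  (forall a b, (a + b <= r)%N -> iter a (@pd1 R) (iter b (@pd2 R) (charac g)) x = 0) ->
  'D_v (fun y => retract xi zeta (jet_of r g y)) x = 'D_v (jet_of r g) x.
Proof.
move=> oV Cg VZ Vx Qx K.
have oW := @open_overZ R Z oZ r.
have Wg y : V y -> overZ Z (jet_of r g y) by move=> Vy; rewrite /overZ /= xu_jet_of; exact: VZ.
have Cj := @Coo_jet_of R r V g oV Cg.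
pose M := fun y => retract xi zeta (jet_of r g y).
have CM : Coo V M.
  exact: Coo_retract_jet_of.
have dM := Coo_diff CM Vx; have dj := Coo_diff Cj Vx.
have Mx : M x = jet_of r g x by apply: (retract_id oZ Cxi Czeta) => //; exact: Wg.
have WM y : V y -> overZ Z (M y) by move=> Vy; have := Wg y Vy; rewrite /overZ /= xu_retract.
have FE : (fun y => (M y).1) = (fun y => (jet_of r g y).1).
  by apply/funext => y; rewrite /M retract_fst.
have Mpure a y : (a + 0 <= r)%N -> ucoord (M y) a 0 = iter a (@pd1 R) g y.
  by move=> ar; rewrite ucoord_retract_pure ucoord_jet_of.
have MT a b y : (a + b < r)%N -> V y -> ucoord (M y) a b.+1 = T xi zeta a b (M y).
  move=> ab Vy.
  by have /(qmanP oZ Cxi Czeta (WM y Vy)) := retract_qman oZ Cxi Czeta (Wg y Vy); apply.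
change ('D_v M x = 'D_v (jet_of r g) x).
clearbody M.
have [p1 p2] := derive_jet_of r v oV Cg Vx.
have uM a b : ucoord ('D_v M x) a b = 'D_v (fun y => ucoord (M y) a b) x.
  exact: esym (@derive_lin_comp _ _ _ _ (@ucl R r a b) _ _ _ (@ucl_cont R r a b) dM).
have e1 := derive_fst_comp v dM; have e2 := derive_fst_comp v dj.
have M1 := etrans (esym e1) (etrans (congr1 (fun f => 'D_v f x) FE) e2).
suff H n : forall b a, (b < n)%N -> (a + b <= r)%N ->
    ucoord ('D_v M x) a b = ucoord ('D_v (jet_of r g) x) a b.
  by apply: (jet_ext M1) => a b; exact: (H b.+1 b a (ltnSn b)).
elim: n => [b a bn|n IH [|b] a bn ab].
- by exfalso; move: bn; rewrite ltn0.
- have FE2 : (fun y => ucoord (M y) a 0) = iter a (@pd1 R) g by apply/funext => y; exact: Mpure.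
  exact (etrans (uM a 0%N) (etrans (congr1 (fun f => 'D_v f x) FE2) (esym (p2 a 0%N ab)))).
have ab' : (a + b < r)%N by rewrite -addnS.
apply: etrans (uM a b.+1) (etrans _ (esym (p2 a b.+1 ab))).
have CT := @Coo_T R Z xi zeta oZ Cxi Czeta r a b.
have dT : differentiable (T xi zeta a b) (jet_of r g x) := Coo_diff CT (Wg x Vx).
rewrite (near_eq_derive (g := fun y => T xi zeta a b (M y))); last first.
  by apply: (open_near oV Vx) => y; exact: MT.
have dTM : differentiable (T xi zeta a b) (M x) by rewrite Mx.
rewrite (@derive_comp _ _ _ _ M (T xi zeta a b) _ _ dM dTM).
pose qab := iter a (@pd1 R) (iter b (@pd2 R) (charac g)).
have Cq : Coo V qab by exact/Coo_iter_pd/Coo_charac.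
have E y : V y -> T xi zeta a b (jet_of r g y) - qab y = iter a (@pd1 R) (iter b.+1 (@pd2 R) g) y.
  move=> Vy; have h1 := @iterD_qchar_jet_of r V g a b y oV Cg VZ Vy ab'.
  have h2 := etrans (esym h1) (iterD_qchar oZ Cxi Czeta ab' (Wg y Vy)).
  by rewrite [qab y]h2 subKr (ucoord_jet_of g y ab).
rewrite -(near_eq_derive (f := fun y => T xi zeta a b (jet_of r g y) - qab y)); last first.
  by apply: (open_near oV Vx) => y; exact: E.
have dTj : differentiable (fun y => T xi zeta a b (jet_of r g y)) x.
  exact: (@differentiable_comp _ _ _ _ (jet_of r g) (T xi zeta a b)).
have dqab := Coo_diff Cq Vx.
rewrite deriveB; [|exact: diff_derivable|exact: diff_derivable].
have q1 : 'D_(1, 0) qab x = 0 := K a.+1 b ab'.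
have q2 : 'D_(0, 1) qab x = 0 := etrans (pd2_iter a b oV (Coo_charac oV Cg VZ) Vx) (K a b.+1 ab).
clearbody qab.
have -> : 'D_v qab x = 0 by rewrite (derive_plane v dqab) q1 q2 !mulr0 addr0.
rewrite subr0 (@derive_comp _ _ _ _ (jet_of r g) (T xi zeta a b) _ _ dj dT) Mx.
apply: (depends_derive oW (Wg x Vx) (Wg x Vx) (@depends_T _ _ _ _ oZ Cxi Czeta r a b)).
  by split.
split; first exact: M1.
move=> a' b' _ bb.
have [ab''|ab''] := leqP (a' + b') r; last exact (etrans (ucoord_out _ ab'') (esym (ucoord_out _ ab''))).
have bn' : (b' < n)%N by exact: leq_ltn_trans bb bn.
exact (IH b' a' bn' ab'').
Qed.

Lemma derive_xuu1 r (j p : jet R r) :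
  differentiable (@xuu1 R r) j /\ 'D_p (@xuu1 R r) j = xuu1 p.
Proof.
have df := @differentiable_fst R (R * R)%type 'rV[R]_#|multi r| j.
have du a b : differentiable (fun j : jet R r => ucoord j a b) j.
  by apply: (Coo_diff (U := setT)) => // n; exact: Ck_ucoord.
have Du a b : 'D_p (fun j : jet R r => ucoord j a b) j = ucoord p a b.
  exact: (derive_linear _ _ (@ucl_cont R r a b)).
have dxu : differentiable (@xu R r) j by exact: differentiable_pair.
split; first exact: differentiable_pair.
rewrite (@derive_pair _ _ _ _ (@xu R r)) // (@derive_pair _ _ _ _ (fun j : jet R r => j.1)) //.
by rewrite derive_fst !Du.
Qed.

(* The coefficient of the prolongation of Q at u_1. *)
Definition eta1 (c : R * R * R * R) : R :=
  'D_((1, 0, 0) : R3) zeta c.1 + c.2 * 'D_((0, 0, 1) : R3) zeta c.1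
  - ('D_((1, 0, 0) : R3) xi c.1 + c.2 * 'D_((0, 0, 1) : R3) xi c.1) * c.2.

Lemma D1_xu r (h : R3 -> R) (j : jet R r) : (0 < r)%N -> Coo Z h -> overZ Z j ->
  D1 (fun j => h (xu j)) j = 'D_((1, 0, 0) : R3) h (xu j)
    + ucoord j 1 0 * 'D_((0, 0, 1) : R3) h (xu j).
Proof.
move=> r0 Ch Wj; have oW := @open_overZ R Z oZ r.
have dh : differentiable h (xu j) := Coo_diff Ch Wj.
have df := @differentiable_fst R (R * R)%type 'rV[R]_#|multi r| j.
have du : differentiable (fun j : jet R r => ucoord j 0 0) j.
  by apply: (Coo_diff (U := setT)) => // n; exact: Ck_ucoord.
rewrite D1E; last exact: (Coo_diff (@Coo_xu R Z oZ r h Ch) Wj).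
have Du : 'D_(tot1 j) (fun j : jet R r => ucoord j 0 0) j = ucoord j 1 0.
  by apply: etrans (derive_linear _ _ (@ucl_cont R r 0 0)) _; exact: ucoord_tot1.
apply: etrans (@derive_graph _ _ _ (fun j : jet R r => j.1) (fun j => ucoord j 0 0) h j _ df du dh) _.
by rewrite Du derive_fst.
Qed.

(** Let [g] be a function as in [invariant_jet]. In the direction (xi, 1) its jets move with
    velocity [xi u_(a+1, b) + u_(a, b+1)], which by [pcoef_jet_of] is the prolonged field, as the
    characteristic terms vanish. The retracted jets [M] have the same velocity and lie on the
    manifold, where [L] may be replaced by [l]. *)
Theorem prolong_restriction r (L : jet R r -> R) (l : R * R * R * R -> R) (j : jet R r) :
  (0 < r)%N -> overZ Z j -> qman Q j -> differentiable L j -> differentiable l (xuu1 j) ->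
  (\forall j' \near j, qman Q j' -> L j' = l (xuu1 j')) ->
  prolong Q L j = 'D_((xi (xu j), 1, zeta (xu j), eta1 (xuu1 j)) : R * R * R * R) l (xuu1 j).
Proof.
move=> r0 Wj Qj dL dl Ll.
have [V [g [[oV Vx CgV VZ] [gj K]]]] := invariant_jet Wj Qj.
pose x := j.1; pose v : R * R := (xi (xu j), 1).
have xuj : xu j = (x, g x) by rewrite -[in LHS]gj xu_jet_of.
pose p := 'D_v (jet_of r g) x.
have Wg y : V y -> overZ Z (jet_of r g y) by move=> Vy; rewrite /overZ /= xu_jet_of; exact: VZ.
have Cj := @Coo_jet_of R r V g oV CgV.
pose M := fun y => retract xi zeta (jet_of r g y).
have CM : Coo V M.
  exact: Coo_retract_jet_of.
have dM := Coo_diff CM Vx.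
have Mx : M x = j by rewrite /M gj; apply: (retract_id oZ Cxi Czeta).
have DM : 'D_v M x = p by apply: (derive_retract_jet_of v oV CgV VZ Vx) => //; rewrite gj.
have [p1 p2] := derive_jet_of r v oV CgV Vx.
have pp a b : (a + b <= r)%N -> ucoord p a b = pcoef Q a b j.
  move=> ab; rewrite /p p2 // -[in RHS]gj (pcoef_jet_of oV CgV VZ Vx ab) K // add0r.
  have dG := Coo_diff (Coo_iter_pd a b CgV) Vx.
  rewrite (derive_plane v dG) mul1r -xuj; congr (_ + _).
  exact: (pd2_iter a b oV CgV Vx).
rewrite (prolongE dL p1 pp).
have [dx Dx] := derive_xuu1 j p.
have -> : (xi (xu j), 1, zeta (xu j), eta1 (xuu1 j)) = xuu1 p.
  rewrite /xuu1 /xu p1 !pp ?r0 //; congr pair.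
  by rewrite pcoefS /pcoef /= !D1_xu.
rewrite -Dx -(@derive_comp _ _ _ _ (@xuu1 R r) l) //.
have dlx : differentiable (l \o @xuu1 R r) j by exact: differentiable_comp.
have dLM : differentiable L (M x) by rewrite Mx.
have dlM : differentiable (l \o @xuu1 R r) (M x) by rewrite Mx.
suff : 'D_('D_v M x) L (M x) = 'D_('D_v M x) (l \o @xuu1 R r) (M x) by rewrite DM Mx.
apply: etrans (esym (derive_comp v dM dLM)) (etrans _ (derive_comp v dM dlM)).
apply: near_eq_derive.
have cM := Coo_cont CM Vx; rewrite /prop_for /continuous_at Mx in cM.
have N1 := cM _ Ll; rewrite nbhs_simpl /= in N1.
apply: filterS2 N1 (open_nbhs_nbhs (conj oV Vx)) => y Ly Vy.
by apply: Ly; apply: (retract_qman oZ Cxi Czeta); exact: Wg.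
Qed.

End Prolongation.

(** * Families of solutions *)

Section Local_tools.
Variable R : realType.
Local Notation R3 := (R * R * R)%type.
Local Notation R4 := (R * R * R * R)%type.
Implicit Types V W : normedModType R.

Definition fd1 (f : R3 -> R) p : R := 'D_((1, 0, 0) : R3) f p.
Definition fd2 (f : R3 -> R) p : R := 'D_((0, 1, 0) : R3) f p.
Definition fdk (f : R3 -> R) p : R := 'D_((0, 0, 1) : R3) f p.

Lemma iter_pd_slice (f : R3 -> R) k a b x :
  iter a (@pd1 R) (iter b (@pd2 R) (fun y => f (y, k))) x = iter a fd1 (iter b fd2 f) (x, k).
Proof.
have E2 : iter b (@pd2 R) (fun y => f (y, k)) = fun y => iter b fd2 f (y, k).
  elim: b => // b IH; rewrite iterS IH; apply/funext => y.
  exact: derive_slice.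
rewrite E2; elim: a x => // a IH x; rewrite !iterS.
have -> : iter a (@pd1 R) (fun y => iter b fd2 f (y, k)) = fun y => iter a fd1 (iter b fd2 f) (y, k).
  by apply/funext => y; exact: IH.
exact: derive_slice.
Qed.

Lemma Coo_iter_fd A f a b : Coo A f -> Coo A (iter a fd1 (iter b fd2 f)).
Proof.
move=> Cf; have C2 : Coo A (iter b fd2 f) by elim: b => // b IH; exact: Coo_derive.
by elim: a => // a IH; exact: Coo_derive.
Qed.

Definition family_jet r (f : R3 -> R) (p : R3) : jet R r :=
  jet_of r (fun y => f (y, p.2)) p.1.

Lemma ucoord_family_jet r f p a b : (a + b <= r)%N ->
  ucoord (family_jet r f p) a b = iter a fd1 (iter b fd2 f) p.
Proof. by move=> ab; rewrite ucoord_jet_of // iter_pd_slice; case: p. Qed.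

Lemma Coo_family_jet r A f : open A -> Coo A f -> Coo A (family_jet r f).
Proof.
move=> oA Cf n; apply: Ck_to_jet => //; first exact: Ck_fst.
move=> a b ab; apply: (Ck_eq oA _ (Coo_iter_fd a b Cf n)) => p _.
by rewrite ucoord_family_jet.
Qed.

Lemma xuu1_family_jet r f p : (0 < r)%N -> xuu1 (family_jet r f p) = (p.1, f p, fd1 f p).
Proof. by move=> r0; rewrite /xuu1 /xu !ucoord_family_jet. Qed.

Lemma Coo_slice A (f : R3 -> R) k : open A -> Coo A f ->
  open [set y | A (y, k)] /\ Coo [set y | A (y, k)] (fun y => f (y, k)).
Proof.
move=> oA Cf.
have Cp n (B : set (R * R)) : open B -> Ck n B (fun y : R * R => (y, k)).
  by move=> oB; apply: Ck_pair => //; [exact: Ck_id|exact: Ck_cst].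
have oB : open [set y | A (y, k)].
  rewrite -[X in open X]setTI; apply: (@open_preimage_within _ _ _ _ A (fun y => (y, k)) openT oA).
  by move=> y _; exact: (Ck_cont (Cp 0%N _ openT)).
split => // n.
by apply: (@Ck_compR _ _ _ _ _ A (fun y : R * R => (y, k)) f _ oB _ (Cp n _ oB) (Cf n)).
Qed.

(* A family of functions is a change of variables between (x, k) and (x, u). *)
Lemma family_chart (f : R3 -> R) x0 k0 : smooth_near (x0, k0) f -> fdk f (x0, k0) <> 0 ->
  exists A B Phi, [/\ open A, A (x0, k0), Coo A f, open B & Coo B Phi] /\
    [/\ forall p, A p -> [/\ B (p.1, f p), Phi (p.1, f p) = p.2 & fdk f p <> 0] &
        forall z, B z -> A (z.1, Phi z) /\ f (z.1, Phi z) = z.2].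
Proof.
move=> /smooth_nearP[A0 [oA0 A00 Cf]] fk0.
pose F (w : R4) := f (w.1.1, w.2) - w.1.2.
pose q (w : R4) : R3 := (w.1.1, w.2).
have Cq n (U : set R4) : open U -> Ck n U q.
  move=> oU; apply: Ck_pair => //; last exact: Ck_snd.
  by apply: Ck_fst_comp => //; exact: Ck_fst.
pose U := setT `&` [set w | A0 (q w)].
have oU : open U.
  apply: (@open_preimage_within _ _ _ setT A0 q openT oA0) => z _.
  exact: (Ck_cont (Cq 0%N _ openT) I).
have CF : Coo U F.
  move=> n; apply: CkB => //; last by apply: Ck_snd_comp => //; exact: Ck_fst.
  by apply: (@Ck_compR _ _ _ _ U A0 q f _ oU _ (Cq n _ oU) (Cf n)) => w [].
have Fk (v : R3) k : U (v, k) -> 'D_((0, 1) : R4) F (v, k) = fdk f (v.1, k).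
  move=> Uw; have Aw : A0 (v.1, k) by case: Uw.
  have dq : differentiable q (v, k) by exact: (Coo_diff (fun n => Cq n _ openT)).
  have df : differentiable f (q (v, k)) := Coo_diff Cf Aw.
  have d12 : differentiable (fun w : R4 => w.1.2) (v, k).
    by apply: (Coo_diff (U := setT)) => // n; apply: Ck_snd_comp; [exact: openT|exact: Ck_fst].
  have dfq : differentiable (f \o q) (v, k) by exact: differentiable_comp.
  have d1 := @differentiable_fst R R3 R (v, k).
  have d2 := @differentiable_snd R R3 R (v, k).
  have d11 : differentiable (fun w : R4 => w.1.1) (v, k).
    by apply: (Coo_diff (U := setT)) => // n; apply: Ck_fst_comp; [exact: openT|exact: Ck_fst].
  rewrite deriveB; [|exact: diff_derivable|exact: diff_derivable].
  rewrite (derive_snd_comp _ d1) derive_fst subr0.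
  rewrite (derive_comp _ dq df) (@derive_pair _ _ _ _ (fun w : R4 => w.1.1) snd _ _ d11 d2).
  by rewrite (derive_fst_comp _ d1) derive_fst derive_snd.
pose z0 : R3 := (x0, f (x0, k0)).
have U0 : U (z0, k0) by split.
have [||B [e [Phi [oB Bz0 e0 CPhi [H1 H2]]]]] := implicit_function _ oU U0 CF.
- by rewrite /F /= subrr.
- by rewrite Fk //; apply/eqP.
pose g (p : R3) : R3 := (p.1, f p).
have Cg n : Ck n A0 g by apply: Ck_pair => //; exact: Ck_fst.
pose A1 := A0 `&` [set p | B (g p)].
have oA1 : open A1 by apply: open_preimage_within => // p Ap; exact: (Ck_cont (Cg 0%N)).
(* Within [e] of [k0] the implicit solution is unique, so on [A] the function [Phi] recovers the
   parameter from the value of [f]. *)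
pose A := A1 `&` [set p | `|p.2 - k0| < e].
have oA : open A.
  have ok : open [set k : R | `|k - k0| < e].
    by rewrite openE => k /= ke; exact: near_dist ke.
  exact: (open_preimage_within oA1 ok (fun p _ => cvg_snd)).
exists A, B, Phi; split; split => //.
- by split => //=; rewrite subrr normr0.
- by move=> n; apply: Ck_sub (Cf n) => p [[]].
- move=> p [[Ap Bp] pe]; have [Up [Dp up]] := H2 _ p.2 Bp pe.
  split => //; last by move: Dp; rewrite Fk //= -surjective_pairing => /eqP.
  by rewrite -up // /F /= -surjective_pairing subrr.
- move=> z Bz; have [pe /eqP Fz] := H1 z Bz.
  have [[_ Az] _] := H2 z _ Bz pe.
  move: Fz; rewrite /F /= subr_eq0 => /eqP fz.
  by split => //; split => //; split => //; rewrite /g /= fz -surjective_pairing.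
Qed.

End Local_tools.

(** * The restriction of the equation as a function of x, u and u_1 *)

Section Elimination.
Variable R : realType.
Local Notation R4 := (R * R * R * R)%type.
Variables (r : nat) (Omega : set (jet R r)) (L : jet R r -> R).
Hypotheses (r0 : (0 < r)%N) (oOmega : open Omega) (CL : Coo Omega L).
Variables (Z : set (R * R * R)) (xi zeta : R * R * R -> R).
Hypotheses (oZ : open Z) (Cxi : Coo Z xi) (Czeta : Coo Z zeta).

Let Q := reduced xi zeta.

Lemma open_over (N : set R4) : open N -> open (over Omega N).
Proof.
move=> oN; apply: open_preimage_within => // j _.
apply: differentiable_continuous; exact: (derive_xuu1 j 0).1.
Qed.

(** The higher pure [x_1]-derivatives are frozen at their values in [j0], and the retraction
    determines the remaining coordinates. Passing through [j0], the section takes values in [Omega]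
    near its base point. *)
Lemma section_through j0 : Omega j0 -> qman Q j0 -> Z (xu j0) ->
  exists (C : set R4) (sigma : R4 -> jet R r),
    [/\ open C, C (xuu1 j0), Coo C sigma &
     forall c, C c -> [/\ Z c.1, Omega (sigma c), qman Q (sigma c) & xuu1 (sigma c) = c]].
Proof.
move=> O0 Q0 Z0.
pose base (c : R4) : jet R r := (c.1.1,
  \row_i if mu i == (0, 0)%N then c.1.2 else if mu i == (1, 0)%N then c.2 else j0.2 0 i).
have ub c a b : (a + b <= r)%N -> ucoord (base c) a b =
    if (a, b) == (0, 0)%N then c.1.2 else if (a, b) == (1, 0)%N then c.2 else ucoord j0 a b.
  by move=> ab; have [i e] := mu_ex ab; rewrite !(ucoordE _ e) mxE e.
have b0 : base (xuu1 j0) = j0.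
  apply: jet_ext => // a b ab; rewrite ub //=.
  by do 2 (case: eqP => [[-> ->] //|_]).
have Cb n (C : set R4) : open C -> Ck n C base.
  move=> oC; apply: Ck_to_jet => //; first by apply: (@Ck_fst_comp _ _ _ _ _ _ (fst : R4 -> R * R * R)) => //; exact: Ck_fst.
  move=> a b ab.
  have E (h : R4 -> R) : (forall c, h c = ucoord (base c) a b) -> Ck n C h ->
    Ck n C (fun c => ucoord (base c) a b) by move=> hE; apply: Ck_eq.
  have [e|ne] := eqVneq (a, b) (0, 0)%N.
    apply: (E (fun c => c.1.2)) => [c|]; first by rewrite ub // e eqxx.
    by apply: Ck_snd_comp => //; exact: Ck_fst.
  have [e|ne'] := eqVneq (a, b) (1, 0)%N.
    apply: (E snd) => [c|]; last exact: Ck_snd.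
    by rewrite ub // (negbTE ne) e eqxx.
  apply: (E (fun=> ucoord j0 a b)) => [c|]; last exact: Ck_cst.
  by rewrite ub // (negbTE ne) (negbTE ne').
have xub c : xu (base c) = c.1 by rewrite /xu ub //= -surjective_pairing.
pose C0 := setT `&` [set c : R4 | Z c.1].
have oC0 : open C0.
  by apply: (open_preimage_within openT oZ) => c _; exact: cvg_fst.
pose sigma c := retract xi zeta (base c).
have Cs : Coo C0 sigma.
  move=> n; apply: (@Ck_comp _ _ _ _ _ C0 (overZ Z) base (@retract _ xi zeta r) _ _ oC0).
  - exact: open_overZ.
  - by move=> c [_ Zc]; rewrite /overZ /= xub.
  - exact: Cb.
  - exact: (Coo_retract_upto oZ Cxi Czeta r r n).
pose C := C0 `&` [set c | Omega (sigma c)].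
have oC : open C by apply: open_preimage_within => // c Cc; exact: Coo_cont Cs Cc.
exists C, sigma; split => //.
- split; first by split.
  by rewrite /= /sigma b0 (retract_id oZ Cxi Czeta).
- by move=> n; apply: Ck_sub (Cs n) => c [].
- move=> c [[_ Zc] Oc]; split => //.
    by apply: (retract_qman oZ Cxi Czeta); rewrite /overZ /= xub.
  rewrite /xuu1 /sigma xu_retract xub ucoord_retract_pure ub //=.
  by rewrite -surjective_pairing.
Qed.

Lemma order_le1 (W : set (jet R r)) F (k : int) j j' : order_le W F k -> k <= 1 -> W j -> W j' -> j.1 = j'.1 ->
  (forall a b, (a + b <= 1)%N -> ucoord j a b = ucoord j' a b) -> F j = F j'.
Proof.
case: k => [n|[|n]] //= H k1 Wj Wj' e1 e2; last by rewrite !H.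
by apply: H => // a b ab; apply: e2; apply: leq_trans ab k1.
Qed.

(** A representative of order at most 1 sees only [x], [u], [u_1] and [u_2], and on the manifold
    [u_2] is a function of the others. So [F] does not change when a jet on the manifold is replaced
    by the value of the section over the same [(x, u, u_1)]. *)
Lemma elimination (c0 : R4) N F (k : int) j0 :
  represented Omega L c0 Q N F k -> k <= 1 -> Omega j0 -> qman Q j0 -> xuu1 j0 = c0 -> Z c0.1 ->
  exists (C : set R4) (sigma : R4 -> jet R r) (l : R4 -> R),
    [/\ open C, C c0, Coo C l,
     (forall c, C c -> [/\ Z c.1, over Omega N (sigma c), qman Q (sigma c), xuu1 (sigma c) = c
        & l c = F (sigma c)]) &
     agree_on_qman (over Omega C) Q L (fun j => l (xuu1 j))].
Proof.
move=> [[oN N0] sF [oF _] LF] k1 O0 Q0 e0 Z0.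
have oW := open_over oN.
have CF : Coo (over Omega N) F by apply/(smooth_Coo F _ oW).
have Z0' : Z (xu j0) by rewrite -e0 in Z0.
have [C1 [sigma [oC1 C10 Cs HC1]]] := section_through O0 Q0 Z0'.
pose C := C1 `&` N.
have oC : open C by exact: openI.
have Csig n : Ck n C sigma by apply: Ck_sub (Cs n) => c [].
have Wsig c : C c -> over Omega N (sigma c).
  by move=> [/HC1[_ Oc _ ec] Nc]; split => //=; rewrite ec.
exists C, sigma, (fun c => F (sigma c)); split => //.
- by split => //; rewrite -e0.
- by move=> n; exact: (@Ck_compR _ _ _ _ C (over Omega N) sigma F _ oC Wsig (Csig n) (CF n)).
- by move=> c Cc; have [[/HC1[Zc _ Qc ec] _] Wc] := (Cc, Wsig c Cc); split.
move=> j [Oj /= [C1j Nj]] Qj.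
have [Zj _ Qs es] := HC1 _ C1j.
have Wj : over Omega N j by split.
have Ws : over Omega N (sigma (xuu1 j)) by apply: Wsig; split.
rewrite (LF j Wj Qj).
have ex : xu (sigma (xuu1 j)) = xu j := congr1 fst es.
have e10 : ucoord (sigma (xuu1 j)) 1 0 = ucoord j 1 0 := congr1 snd es.
have Zs : overZ Z (sigma (xuu1 j)) by rewrite /overZ /= ex.
apply: (order_le1 oF k1 Wj Ws); first exact: (esym (congr1 fst ex)).
have e00 : ucoord (sigma (xuu1 j)) 0 0 = ucoord j 0 0 := congr1 snd ex.
have u01 (j' : jet R r) : overZ Z j' -> qman Q j' -> ucoord j' 0 1 = T0 xi zeta j'.
  by move=> Zj' /(qmanP oZ Cxi Czeta Zj') /(_ 0%N 0%N r0).
move=> [|[|a]] [|[|b]] // _.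
by rewrite !u01 // /T0 ex e10.
Qed.

End Elimination.

Lemma Coo_fd1 (R : realType) (A : set (R * R * R)) f : Coo A f -> Coo A (fd1 f).
Proof. exact: Coo_derive. Qed.

Lemma Coo_fd2 (R : realType) (A : set (R * R * R)) f : Coo A f -> Coo A (fd2 f).
Proof. exact: Coo_derive. Qed.

Lemma eta1_algebra (R : realType) (zt xx f1 X f11 f12 Dz Dx d12 Dw : R) :
  Dz - (Dx * f1 + X * f11) - d12 = 0 -> d12 = f12 -> Dz = zt -> Dx = xx ->
  Dw = X * f11 + 1 * f12 -> Dw = zt - xx * f1.
Proof. by move=> E0 e1 e2 e3 ->; move: E0; rewrite e1 e2 e3; lra. Qed.

Section Families.
Variable R : realType.
Local Notation R3 := (R * R * R)%type.
Variables (Z : set R3) (xi zeta : R3 -> R).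
Hypotheses (oZ : open Z) (Cxi : Coo Z xi) (Czeta : Coo Z zeta).

Let Q := reduced xi zeta.

(** The characteristic of the vector field on the members of the family, as a function of
    [(x, k)]. *)
Definition family_defect (f : R3 -> R) (p : R3) : R :=
  zeta (p.1, f p) - xi (p.1, f p) * fd1 f p - fd2 f p.

Lemma charac_family (f : R3 -> R) p :
  charac xi zeta (fun y => f (y, p.2)) p.1 = family_defect f p.
Proof.
case: p => x k /=; rewrite /charac /family_defect /=.
by congr (_ - _ * _ - _); exact: derive_slice.
Qed.

Lemma qchar_family r (f : R3 -> R) p : (0 < r)%N ->
  qchar Q (family_jet r f p) = family_defect f p.
Proof. by move=> r0; rewrite /family_jet (qchar_jet_of _ _ _ _ r0) charac_family. Qed.

Lemma iter_pd_zero (V : set (R * R)) (h : R * R -> R) a b x : open V ->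
  (forall y, V y -> h y = 0) -> V x -> iter a (@pd1 R) (iter b (@pd2 R) h) x = 0.
Proof.
move=> oV h0; elim: a x => [|a IH] x Vx.
  elim: b x Vx => [|b IH] x Vx; first exact: h0.
  by rewrite /= (pd2_eq (h := fun=> 0) oV Vx) //; exact: derive_cst.
by rewrite iterS (pd1_eq (h := fun=> 0) oV Vx) //; exact: derive_cst.
Qed.

Lemma qman_family r (A : set R3) f p : open A -> Coo A f ->
  (forall p, A p -> Z (p.1, f p) /\ family_defect f p = 0) -> A p ->
  qman Q (family_jet r f p).
Proof.
move=> oA Cf HA Ap a b ab.
have [oV CV] := Coo_slice p.2 oA Cf.
have VZ y : [set y | A (y, p.2)] y -> Z (y, f (y, p.2)) by move=> /HA[].
have Vp : [set y | A (y, p.2)] p.1 by rewrite /= -surjective_pairing.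
rewrite /family_jet (iterD_qchar_jet_of oZ Cxi Czeta oV CV VZ Vp ab).
apply: (iter_pd_zero _ _ oV _ Vp) => y Vy.
by have [_] := HA _ Vy; rewrite -charac_family.
Qed.

Lemma derive_along_family (l : R * R * R * R -> R) (A : set R3) f p (w : R * R) :
  Coo A f -> A p -> differentiable l (p.1, f p, fd1 f p) ->
  'D_((w, 0) : R3) (fun p => l (p.1, f p, fd1 f p)) p =
  'D_((w, 'D_((w, 0) : R3) f p, 'D_((w, 0) : R3) (fd1 f) p) : R * R * R * R) l (p.1, f p, fd1 f p).
Proof.
move=> Cf Ap dl.
have df := Coo_diff Cf Ap; have df1 := Coo_diff (Coo_fd1 Cf) Ap.
have d1 := @differentiable_fst R (R * R)%type R p.
have d2 : differentiable (fun p : R3 => (p.1, f p)) p by exact: differentiable_pair.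
have d3 : differentiable (fun p : R3 => (p.1, f p, fd1 f p)) p by exact: differentiable_pair.
rewrite (@derive_comp _ _ _ _ (fun p : R3 => (p.1, f p, fd1 f p)) l _ _ d3 dl).
rewrite (@derive_pair _ _ _ _ (fun p : R3 => (p.1, f p)) (fd1 f) _ _ d2 df1).
by rewrite (@derive_pair _ _ _ _ fst f _ _ d1 df) derive_fst.
Qed.

Lemma derive_dir_plane (F : R3 -> R) p (w : R * R) : differentiable F p ->
  'D_((w, 0) : R3) F p = w.1 * fd1 F p + w.2 * fd2 F p.
Proof.
move=> dF; have -> : ((w, 0) : R3) = w.1 *: (1, 0, 0) + w.2 *: (0, 1, 0).
  case: w => w1 w2; congr pair; last by rewrite /= !scaler0 addr0.
  by congr pair; rewrite /= ?scaler0 ?addr0 ?add0r // [_ *: 1]mulr1.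
by rewrite derive_dirD // !derive_dirZ.
Qed.

Lemma fd1_graph (h : R3 -> R) (A : set R3) f p : Coo A f -> A p ->
  differentiable h (p.1, f p) ->
  fd1 (fun p => h (p.1, f p)) p = fd1 h (p.1, f p) + fd1 f p * fdk h (p.1, f p).
Proof.
move=> Cf Ap dh; have df := Coo_diff Cf Ap.
have d1 := @differentiable_fst R (R * R)%type R p.
apply: etrans (@derive_graph _ _ _ fst f h p (1, 0, 0) d1 df dh) _.
by rewrite derive_fst.
Qed.

(** Differentiating [zeta - xi f_1 - f_2 = 0] with respect to [x_1] and exchanging the mixed
    derivatives expresses [xi f_11 + f_12] through [zeta], [xi] and [f_1]. *)
Lemma eta1_family (A : set R3) f p : open A -> Coo A f ->
  (forall p, A p -> Z (p.1, f p) /\ family_defect f p = 0) -> A p ->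
  'D_((xi (p.1, f p), 1, 0) : R3) (fd1 f) p = eta1 xi zeta (p.1, f p, fd1 f p).
Proof.
move=> oA Cf HA Ap; have [Zp _] := HA p Ap.
have dxi := Coo_diff Cxi Zp; have dzeta := Coo_diff Czeta Zp.
have df := Coo_diff Cf Ap.
have df1 := Coo_diff (Coo_fd1 Cf) Ap.
have df2 := Coo_diff (Coo_fd2 Cf) Ap.
have d1 := @differentiable_fst R (R * R)%type R p.
have dgr := differentiable_pair d1 df.
have dx : differentiable (fun p => xi (p.1, f p)) p.
  exact: (@differentiable_comp _ _ _ _ (fun p : R3 => (p.1, f p)) xi).
have dz : differentiable (fun p => zeta (p.1, f p)) p.
  exact: (@differentiable_comp _ _ _ _ (fun p : R3 => (p.1, f p)) zeta).
have E : fd1 (family_defect f) p = 0.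
  rewrite /fd1 (near_eq_derive (g := fun=> 0)) ?derive_cst //.
  by apply: (open_near oA Ap) => q /HA[].
pose w : R3 := (1, 0, 0).
have dA : differentiable (fun p => zeta (p.1, f p) - xi (p.1, f p) * fd1 f p) p.
  exact: differentiableB dz (differentiableM dx df1).
have D := deriveB (diff_derivable (v := w) dA) (diff_derivable (v := w) df2).
rewrite (derive_subM w dz dx df1) in D.
have S : 'D_(1, 0, 0) (fd2 f) p = fd2 (fd1 f) p := schwarz _ _ oA Ap (Cf 2%N).
exact (@eta1_algebra _ _ _ _ _ _ _ _ _ _ _ (etrans (esym D) E) S (fd1_graph Cf Ap dzeta) (fd1_graph Cf Ap dxi)
  (derive_dir_plane (xi (p.1, f p), 1) df1)).
Qed.

End Families.

Section Derivative_identities.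
Variable R : realType.

Lemma derive_dir3 (F : R * R * R -> R) z (a b c : R) : differentiable F z ->
  'D_((a, b, c) : R * R * R) F z = a * fd1 F z + b * fd2 F z + c * fdk F z.
Proof. by move=> dF; rewrite derive_dir_pair // (derive_dir_plane (a, b) dF). Qed.

(** Scalars stand for derivatives at a point: [DG = eta] is the invariance of [u_1 = G], and the
    conclusion is the compatibility of [u_1 = G] with [u_2 = zeta - xi G]. *)
Lemma compat_algebra (G1 G2 Gu z1 zu x1 xu z x G DG eta H1 Hu : R) :
  DG = x * G1 + 1 * G2 + z * Gu -> DG = eta -> eta = z1 + G * zu - (x1 + G * xu) * G ->
  H1 = z1 - (x1 * G + x * G1) -> Hu = zu - (xu * G + x * Gu) ->
  G2 + (z - x * G) * Gu = H1 + G * Hu.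
Proof. by move=> e1 e2 e3 -> ->; move: e1; rewrite e2 e3 => e; lra. Qed.

End Derivative_identities.

(** * From families to operators, from operators to families, and the equivalences *)

Section Correspondence.
Variable R : realType.
Local Notation R3 := (R * R * R)%type.
Local Notation R4 := (R * R * R * R)%type.
Variables (r : nat) (Omega : set (jet R r)) (L : jet R r -> R).
Variables (c0 : R4) (xi : R3 -> R).
Hypotheses (hr : (1 < r)%N) (oOmega : open Omega) (CL : Coo Omega L).
Variable Zx : set R3.
Hypotheses (oZx : open Zx) (Zx0 : Zx c0.1) (Cxi : Coo Zx xi).
Hypothesis hdom : eliminable_domain Omega c0 xi.
Hypothesis hsing : first_coorder_singular Omega L c0 xi.
Hypothesis hultra : forall zeta, inS Omega c0 xi zeta ->
  ~ ultra_singular Omega L c0 (reduced xi zeta).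
Hypothesis hrank : forall zeta, inS Omega c0 xi zeta -> max_rank Omega L c0 xi zeta.

Let r0 : (0 < r)%N := ltnW hr.
Let x0 : R * R := c0.1.1.

(** A representative of order -1 is zero, which would make the field ultra-singular. *)
Lemma coorder01 zeta : inS Omega c0 xi zeta ->
  exists k N F, [/\ represented Omega L c0 (reduced xi zeta) N F k,
     coorder Omega L c0 (reduced xi zeta) k & k = 0 \/ k = 1].
Proof.
move=> Szeta; have [[k [ck kr]] k1] := hsing.1 zeta Szeta.
have [[N [F rep]] _] := ck.
exists k, N, F; split => //; have := k1 k ck.
case: k rep {ck kr} => [[|[|n]]|[|n]] rep //; try by [left|right].
- case: rep => oN _ [F0 _] LF; case: (hultra Szeta); exists N; split => //.
  by move=> j Wj Qj; rewrite (LF j Wj Qj) F0.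
- by case: rep => _ _ [].
Qed.

Lemma restriction zeta : inS Omega c0 xi zeta ->
  exists (Z : set R3) (C : set R4) (sigma : R4 -> jet R r)
    (l : R4 -> R),
    [/\ [/\ open Z, Z c0.1, Coo Z xi & Coo Z zeta],
        [/\ open C, C c0 & Coo C l],
        forall c, C c -> [/\ Z c.1, Omega (sigma c), qman (reduced xi zeta) (sigma c) & xuu1 (sigma c) = c],
        agree_on_qman (over Omega C) (reduced xi zeta) L (fun j => l (xuu1 j)) &
        coorder Omega L c0 (reduced xi zeta) 1 \/
        coorder Omega L c0 (reduced xi zeta) 0 /\
          forall c c', C c -> C c' -> c.1 = c'.1 -> l c = l c'].
Proof.
move=> Szeta; have [k [N [F [rep ck k01]]]] := coorder01 Szeta.
have [/smooth_nearP[Zz [oZz Zz0 Cz]] [j0 [Oj0 Qj0 ej0]]] := Szeta.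
pose Z := Zx `&` Zz.
have oZ : open Z by exact: openI.
have Cx : Coo Z xi by move=> n; apply: Ck_sub (Cxi n) => z [].
have Czeta : Coo Z zeta by move=> n; apply: Ck_sub (Cz n) => z [].
have k1 : k <= 1 by case: k01 => ->.
have Z0 : Z c0.1 by split.
have [C [sigma [l [oC C0 Cl HC LC]]]] := elimination r0 oOmega oZ Cx Czeta rep k1 Oj0 Qj0 ej0 Z0.
exists Z, C, sigma, l; split => //.
  by move=> c /HC[Zc [Oc _] Qc ec _].
case: k01 => ek; last by left; rewrite -ek.
right; split; first by rewrite -ek.
move=> c c' Cc Cc' e; have [_ Wc _ ec ->] := HC c Cc; have [_ Wc' _ ec' ->] := HC c' Cc'.
have [_ _ [oF _] _] := rep; rewrite ek in oF.
have xs : xu (sigma c) = xu (sigma c').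
  by move: e; rewrite -{1}ec -{1}ec'.
apply: oF => //; first exact: (congr1 fst xs).
move=> a b; rewrite leqn0 addn_eq0 => /andP[/eqP -> /eqP ->].
exact: (congr1 snd xs).
Qed.

Lemma solved_for_u1 zeta (C : set R4) (l : R4 -> R) :
  inS Omega c0 xi zeta -> coorder Omega L c0 (reduced xi zeta) 1 ->
  open C -> C c0 -> Coo C l -> agree_on_qman (over Omega C) (reduced xi zeta) L (fun j => l (xuu1 j)) ->
  l c0 = 0 ->
  exists (B : set R3) (e : R) (G : R3 -> R),
    [/\ open B, B c0.1, 0 < e, Coo B G &
      (forall z, B z -> [/\ C (z, G z), `|G z - c0.2| < e, l (z, G z) = 0 &
         'D_((0, 0, 0, 1) : R4) l (z, G z) != 0]) /\
      (forall z u, B z -> `|u - c0.2| < e -> l (z, u) = 0 -> u = G z)].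
Proof.
move=> Szeta c1 oC C0 Cl LC l0.
have lsm : smooth_near c0 l by apply/smooth_nearP; exists C.
have [_ /(_ c1) near1] := hrank Szeta lsm (ex_intro _ C (conj (conj oC C0) LC)).
have Dl : 'D_((0, 1) : R4) l (c0.1, c0.2) != 0.
  by rewrite -surjective_pairing; apply/eqP; exact: (nbhs_singleton near1 l0).
have C0' : C (c0.1, c0.2) by rewrite -surjective_pairing.
have l0' : l (c0.1, c0.2) = 0 by rewrite -surjective_pairing.
have [B [e [G [oB B0 e0 CG [H1 H2]]]]] := implicit_function _ oC C0' Cl l0' Dl.
exists B, e, G; split => //; split => [z Bz|z u Bz ue lz].
  have [Ge Gz] := H1 z Bz; have [Cz [Dz _]] := H2 z _ Bz Ge.
  by split.
by have [_ [_]] := H2 z u Bz ue; apply.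
Qed.

Lemma solution_family_base f k0 : solution_family Omega L c0 (f, k0) ->
  c0.1 = (x0, f (x0, k0)) /\ c0.2 = fd1 f (x0, k0).
Proof.
move=> [_ jc0 _ _].
have E : c0 = (x0, f (x0, k0), fd1 f (x0, k0)).
  by rewrite -[LHS]jc0 -[jet_of _ _ _]/(family_jet r f (x0, k0)) xuu1_family_jet.
by split; rewrite [in LHS]E.
Qed.

Lemma solution_family_sing f k0 : solution_family Omega L c0 (f, k0) ->
  exists2 zeta, singular_reduction_operator Omega L c0 xi zeta &
    invariant_family r c0 xi (f, k0) zeta.
Proof.
move=> S; have [E1 E2] := solution_family_base S.
have [sf jc0 /nbhs_singleton fk sol] := S.
have E0 : c0 = (x0, f (x0, k0), fd1 f (x0, k0)) by rewrite -E1 -E2 -surjective_pairing.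
have [A [B [Phi [[oA A0 Cf oB CPhi] [HA HB]]]]] := family_chart sf fk.
have [A' [oA' A'0 HA']] := near_open sol.
pose zeta z := fd2 f (z.1, Phi z) + xi z * fd1 f (z.1, Phi z).
pose Z := B `&` Zx.
have oZ : open Z by exact: openI.
have Cx : Coo Z xi by move=> n; apply: Ck_sub (Cxi n) => z [].
have ZA z : Z z -> A (z.1, Phi z) by move=> [/HB[]].
have Cch n : Ck n Z (fun z : R3 => (z.1, Phi z)).
  by apply: Ck_pair => //; [exact: Ck_fst|apply: Ck_sub (CPhi n) => z []].
have Cfd (g : R3 -> R) n : Coo A g -> Ck n Z (fun z => g (z.1, Phi z)).
  by move=> Cg; exact: (@Ck_compR _ _ _ _ Z A _ g _ oZ ZA (Cch n) (Cg n)).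
have Czeta : Coo Z zeta.
  move=> n; apply: CkD => //; first by apply: Cfd; exact: Coo_derive.
  by apply: CkM => //; apply: Cfd; exact: Coo_derive.
have Z0 : Z c0.1 by rewrite E1; split; [case: (HA _ A0)|rewrite -E1].
have Cgr n (U : set R3) : open U -> U `<=` A -> Ck n U (fun p : R3 => (p.1, f p)).
  by move=> oU UA; apply: Ck_pair => //; [exact: Ck_fst|exact: Ck_sub UA (Cf n)].
pose A2 := (A `&` A') `&` [set p : R3 | Z (p.1, f p)].
have oA2 : open A2.
  apply: open_preimage_within => //; first exact: openI.
  by move=> p [Ap A'p]; apply: (Ck_cont (Cgr 0%N A oA (@subset_refl _ _)) Ap).
have A20 : A2 (x0, k0) by split; [split|rewrite /= -E1].
have CfA2 : Coo A2 f by move=> n; apply: Ck_sub (Cf n) => p [[]].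
have inv p : A2 p -> Z (p.1, f p) /\ family_defect xi zeta f p = 0.
  move=> [[Ap _] Zp]; split => //; have [_ Phip _] := HA p Ap.
  by rewrite /family_defect /zeta Phip /= -surjective_pairing; ring.
have invf : invariant_family r c0 xi (f, k0) zeta.
  by apply: (open_near oA2 A20) => p /inv[_ E]; rewrite -[jet_of _ _ _]/(family_jet r f p) qchar_family.
have qmanA p : A2 p -> qman (reduced xi zeta) (family_jet r f p).
  by move=> Ap a b ab; exact: (qman_family oZ Cx Czeta oA2 CfA2 inv Ap ab).
have solA p : A2 p -> Omega (family_jet r f p) /\ L (family_jet r f p) = 0.
  by move=> [[_ /HA']].
have xj p : xuu1 (family_jet r f p) = (p.1, f p, fd1 f p) by exact: xuu1_family_jet.
have Szeta : inS Omega c0 xi zeta.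
  split; first by apply/smooth_nearP; exists Z.
  by exists (family_jet r f (x0, k0)); split; [case: (solA _ A20)|exact: qmanA|].
exists zeta => //.
have [Z' [C [sigma [l [[oZ' Z'0 Cx' Cz'] [oC C0 Cl] HC LC co]]]]] := restriction Szeta.
pose cc (p : R3) : R4 := (p.1, f p, fd1 f p).
have Ccc n : Ck n A2 cc.
  apply: Ck_pair => //; first by apply: Cgr => // p [[]].
  exact: (Coo_fd1 CfA2 n).
pose A3 := A2 `&` [set p | C (cc p)].
have oA3 : open A3 by apply: open_preimage_within => // p Ap; exact: (Ck_cont (Ccc 0%N) Ap).
have A30 : A3 (x0, k0) by split => //; rewrite /= /cc /= -E0.
have lcc p : A3 p -> l (cc p) = 0.
  move=> [Ap Cp]; have [Op Lp] := solA p Ap.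
  have W : over Omega C (family_jet r f p) by split => //=; rewrite xj.
  by have := LC _ W (qmanA p Ap); rewrite Lp xj.
have l0 : l c0 = 0 by rewrite E0; exact: (lcc _ A30).
have c1 : coorder Omega L c0 (reduced xi zeta) 1.
  case: co => // -[c00 l1].
  exfalso.
  have lsm : smooth_near c0 l by apply/smooth_nearP; exists C.
  have [/(_ c00) near0 _] := hrank Szeta lsm (ex_intro _ C (conj (conj oC C0) LC)).
  apply: (nbhs_singleton near0 l0).
  (* In co-order 0 the function [l] does not involve [u_1], which can be frozen at its base value.
     The derivative of [l = 0] with respect to the parameter is then [f_k * l_u], against maximal
     rank and [f_k <> 0]. *)
  pose m (p : R3) : R4 := (p.1, f p, c0.2).
  have dg := Coo_diff (fun n => Cgr n A oA (@subset_refl _ _)) A0.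
  have df := Coo_diff Cf A0.
  have dm : differentiable m (x0, k0).
    by apply: (@differentiable_pair _ _ _ _ (fun p : R3 => (p.1, f p)) (fun=> c0.2)).
  have m0 : m (x0, k0) = c0 by rewrite /m /= -E1 -surjective_pairing.
  have Nm : \forall p \near (x0, k0), C (m p).
    have := differentiable_continuous dm; rewrite /prop_for /continuous_at m0.
    by move/(_ _ (open_nbhs_nbhs (conj oC C0))).
  have dl : differentiable l (m (x0, k0)) by rewrite m0; exact: Coo_diff Cl C0.
  have : 'D_((0, 0, 1) : R3) (l \o m) (x0, k0) = 0.
    rewrite (near_eq_derive (g := fun=> 0)) ?derive_cst //.
    have N3 : \forall p \near (x0, k0), A3 p by apply: open_nbhs_nbhs.
    apply: filterS2 N3 Nm => p A3p Cp; rewrite -(lcc p A3p).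
    by apply: l1 => //; case: A3p.
  rewrite (derive_comp _ dm dl) m0.
  rewrite (@derive_pair _ _ _ _ (fun p : R3 => (p.1, f p)) (fun=> c0.2) _ _ dg (differentiable_cst _ _)).
  rewrite (@derive_pair _ _ _ _ fst f _ _ (@differentiable_fst R (R * R)%type R _) df).
  rewrite derive_fst derive_cst /= -/(fdk f _).
  have -> : (0, 0, fdk f (x0, k0), 0) = fdk f (x0, k0) *: (0, 0, 1, 0) :> R4.
    congr pair; last by rewrite /= scaler0.
    by congr pair; rewrite /= ?scaler0 // [_ *: 1]mulr1.
  rewrite (derive_dirZ _ _ (Coo_diff Cl C0)) /GRing.scale /= => /eqP.
  by rewrite mulf_eq0 => /orP[/eqP|/eqP //].
split => //.
  exists (family_jet r f (x0, k0)); have [Oj Lj] := solA _ A20.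
  by split => //; exact: qmanA.
have [B1 [e [G [oB1 B10 e0 CG [HG uG]]]]] := solved_for_u1 Szeta c1 oC C0 Cl LC l0.
have nearG : \forall p \near (x0, k0), [/\ A3 p, B1 (p.1, f p) & `|fd1 f p - c0.2| < e].
  have N1 : \forall p \near (x0, k0), A3 p by apply: open_nbhs_nbhs.
  have N2 : \forall p \near (x0, k0), B1 (p.1, f p).
    have := Ck_cont (Cgr 0%N A oA (@subset_refl _ _)) A0; rewrite /prop_for /continuous_at /= -E1.
    by move/(_ _ (open_nbhs_nbhs (conj oB1 B10))).
  have N3 : \forall p \near (x0, k0), `|fd1 f p - c0.2| < e.
    have e1 : `|fd1 f (x0, k0) - c0.2| < e by rewrite [in c0.2]E0 /= subrr normr0.
    exact: (Coo_cont (Coo_fd1 Cf) A0 (near_dist e1)).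
  by apply: filterS3 N1 N2 N3 => p a1 a2 a3; split; [exact a1|exact a2|exact a3].
have [A4 [oA4 A40 HA4]] := near_open nearG.
(* Near c0 the points of {l = 0} come from the family. *)
pose N := C `&` [set c : R4 | [/\ Z c.1, A4 (c.1.1, Phi c.1) & `|c.2 - c0.2| < e]].
have nN : \forall c \near c0, N c.
  have M1 : \forall c \near c0, C c by apply: open_nbhs_nbhs.
  have M2 : \forall c \near c0, Z c.1.
    exact: ((cvg_fst : (fst : R4 -> _) @ nbhs c0 --> c0.1) _ (open_nbhs_nbhs (conj oZ Z0))).
  have M3 : \forall c \near c0, A4 (c.1.1, Phi c.1).
    have dch := Coo_diff (fun n => Cch n) Z0.
    have cch : {for c0, continuous (fun c : R4 => (c.1.1, Phi c.1))}.
      apply: differentiable_continuous.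
      by apply: (@differentiable_comp _ _ _ _ fst (fun z : R3 => (z.1, Phi z))) => //; exact: differentiable_fst.
    apply: (cch A4); apply: open_nbhs_nbhs; split => //=.
    by rewrite E1 /=; have [_ -> _] := HA _ A0.
  have M4 : \forall c \near c0, `|c.2 - c0.2| < e.
    have z0 : `|c0.2 - c0.2| < e by rewrite subrr normr0.
    exact: ((cvg_snd : (snd : R4 -> _) @ nbhs c0 --> c0.2) _ (near_dist z0)).
  by apply: filterS2 (filterI M1 M2) (filterI M3 M4) => c [a1 a2] [a3 a4].
have [N' [oN' N'0 HN']] := near_open nN.
exists N'; split; first by split.
move=> j [Oj /= /HN' [Cj [Zj A4j uj]]] Lj Qj.
have lj : l (xuu1 j) = 0 by rewrite -(LC j) //; split.
pose p : R3 := (j.1, Phi (xu j)).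
have A4p : A4 p by [].
have [A3p B1p fe] := HA4 p A4p.
have fp : f p = ucoord j 0 0 by have [_] := HB _ (Zj.1).
have xup : (p.1, f p) = xu j by rewrite fp.
(* Both [f_1] at [p] and the coordinate [u_1] of [j] are zeros of [l] over the same [(x, u)] and
   within [e] of the base value, hence both equal [G]. *)
have u1p : fd1 f p = ucoord j 1 0.
  have -> : fd1 f p = G (xu j).
    by rewrite -xup; apply: uG => //; exact: (lcc p A3p).
  by apply/esym/uG => //; rewrite -xup.
have ccp : cc p = xuu1 j by rewrite /cc xup u1p.
have A2p : A2 p by case: A3p.
have dl : differentiable l (xuu1 j) by exact: Coo_diff Cl Cj.
have dL : differentiable L j by exact: Coo_diff CL Oj.
have ZZ : overZ Z j by [].
rewrite (@prolong_restriction _ Z xi zeta oZ Cx Czeta r L l j) //; last first.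
  have oCC := open_over oOmega oC.
  by apply: (open_near oCC (conj Oj Cj)) => j'; exact: LC.
have dlp : differentiable l (p.1, f p, fd1 f p) by rewrite -/(cc p) ccp.
(* The vector [(xi, 1, zeta, eta1)] is the velocity of [(x, f, f_1)] along (xi, 1) with the
   parameter fixed, and [l] vanishes along the family. *)
have H1 := derive_along_family (xi (xu j), 1) CfA2 A2p dlp.
have H0 : 'D_((xi (xu j), 1, 0) : R3) (fun p => l (p.1, f p, fd1 f p)) p = 0.
  rewrite (near_eq_derive (g := fun=> 0)) ?derive_cst //.
  by apply: (open_near oA3 A3p) => q; exact: lcc.
have H2 : 'D_((xi (xu j), 1, 0) : R3) f p = zeta (xu j).
  apply: etrans (derive_dir_plane (xi (xu j), 1) (Coo_diff CfA2 A2p)) _.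
  have [_ /eqP] := inv p A2p; rewrite /family_defect xup subr_eq0 => /eqP <-.
  by rewrite /= mul1r addrC subrK.
have H3 := eta1_family Cx Czeta oA2 CfA2 inv A2p.
rewrite xup in H3; rewrite H2 H3 xup u1p in H1.
exact: etrans (esym H1) H0.
Qed.

Lemma singular_reduction_data zeta : singular_reduction_operator Omega L c0 xi zeta ->
  exists (Z : set R3) (C : set R4) (sigma : R4 -> jet R r)
    (l : R4 -> R) (B : set R3) (e : R) (G : R3 -> R),
    [/\ [/\ open Z, Z c0.1, Coo Z xi & Coo Z zeta],
        [/\ open C, C c0, Coo C l &
            forall c, C c -> [/\ Z c.1, Omega (sigma c), qman (reduced xi zeta) (sigma c) & xuu1 (sigma c) = c]],
        agree_on_qman (over Omega C) (reduced xi zeta) L (fun j => l (xuu1 j)),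
        [/\ open B, B c0.1, 0 < e & Coo B G] &
        [/\ G c0.1 = c0.2,
            forall z, B z -> [/\ C (z, G z), `|G z - c0.2| < e, l (z, G z) = 0 &
                'D_((0, 0, 0, 1) : R4) l (z, G z) != 0] &
            forall z u, B z -> `|u - c0.2| < e -> l (z, u) = 0 -> u = G z]].
Proof.
move=> [Szeta [j0 [Oj0 Qj0 ej0 Lj0]] c1 _].
have [Z [C [sigma [l [HZ [oC C0 Cl] HC LC _]]]]] := restriction Szeta.
have l0 : l c0 = 0.
  by rewrite -ej0 -(LC j0) //; split => //=; rewrite ej0.
have [B [e [G [oB B0 e0 CG [HG uG]]]]] := solved_for_u1 Szeta c1 oC C0 Cl LC l0.
exists Z, C, sigma, l, B, e, G; split => //; split => //.
by apply/esym/uG => //; rewrite ?subrr ?normr0 // -surjective_pairing.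
Qed.

Lemma sing_solution_family zeta : singular_reduction_operator Omega L c0 xi zeta ->
  exists2 fk, solution_family Omega L c0 fk & invariant_family r c0 xi fk zeta.
Proof.
move=> Hs; have [Szeta [j0 [Oj0 Qj0 ej0 Lj0]] c1 [Nr [[oNr Nr0] Hr]]] := Hs.
have [Z [C [sigma [l [B [e [G H]]]]]]] := singular_reduction_data Hs.
have [[oZ Z0 Cx Cz] [oC C0 Cl HC] LC [oB B0 e0 CG] [G0 HG uG]] := H.
pose BZ := B `&` Z.
have oBZ : open BZ by exact: openI.
have CgG n : Ck n BZ (fun z => (z, G z)).
  by apply: Ck_pair => //; [exact: Ck_id|apply: Ck_sub (CG n) => z []].
pose U := BZ `&` [set z | Nr (z, G z)].
have oU : open U by apply: open_preimage_within => // z Bz; exact: (Ck_cont (CgG 0%N) Bz).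
have U0 : U c0.1 by split => //=; rewrite G0 -surjective_pairing.
have CGU : Coo U G by move=> n; apply: Ck_sub (CG n) => z [[]].
have CxU : Coo U xi by move=> n; apply: Ck_sub (Cx n) => z [[]].
have CzU : Coo U zeta by move=> n; apply: Ck_sub (Cz n) => z [[]].
(* The value of [u_2] on the invariant manifold where [u_1 = G]. *)
pose K z := zeta z - xi z * G z.
have CK : Coo U K by move=> n; apply: CkB => //; apply: CkM.
have GE z : U z -> 'D_((xi z, 1, zeta z) : R3) G z = eta1 xi zeta (z, G z).
  move=> Uz; have [[Bz Zz] Nz] := Uz.
  have [Cc Gb lz Dl] := HG z Bz.
  have [_ Os Qs es] := HC _ Cc.
  have exu : xu (sigma (z, G z)) = z by exact: (congr1 fst es).
  have WZ : overZ Z (sigma (z, G z)) by rewrite /overZ /= exu.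
  have Ws : over Omega C (sigma (z, G z)) by split => //=; rewrite es.
  have Wr : over Omega Nr (sigma (z, G z)) by split => //=; rewrite es.
  have Ls : L (sigma (z, G z)) = 0 by rewrite (LC _ Ws Qs) es.
  have dl : differentiable l (z, G z) := Coo_diff Cl Cc.
  have dl' : differentiable l (xuu1 (sigma (z, G z))) by rewrite es.
  have dL := Coo_diff CL Os.
  have LC' : \forall j' \near sigma (z, G z), qman (reduced xi zeta) j' -> L j' = l (xuu1 j').
    by apply: (open_near (open_over oOmega oC) Ws) => j'; exact: LC.
  have P := prolong_restriction oZ Cx Cz r0 WZ Qs dL dl' LC'.
  rewrite (Hr _ Wr Ls Qs) exu es in P.
  have dG : differentiable G z := Coo_diff CGU Uz.
  have dgr : differentiable (fun z => (z, G z)) z by exact: differentiable_pair.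
  pose w : R3 := (xi z, 1, zeta z).
  have M : 'D_w (l \o (fun z => (z, G z))) z = 0.
    rewrite (near_eq_derive (g := fun=> 0)) ?derive_cst //.
    by apply: (open_near oB Bz) => y /HG[].
  have did : differentiable (fun z : R3 => z) z.
    by apply: (Coo_diff (U := setT)) => // n; exact: Ck_id.
  rewrite (derive_comp w dgr dl) (derive_pair w did dG) derive_id in M.
  rewrite derive_dir_pair // in M; rewrite derive_dir_pair // in P.
  (* The vanishing prolongation gives [l_w + eta1 * l_(u_1) = 0], and differentiating
     [l (z, G z) = 0] along [w] gives the same relation with ['D_w G] for [eta1]. They are
     subtracted, and [l_(u_1) <> 0]. *)
  have E : ('D_w G z - eta1 xi zeta (z, G z)) * 'D_((0, 1) : R4) l (z, G z) = 0.
    rewrite mulrBl; apply/eqP; rewrite subr_eq0; apply/eqP.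
    by apply: (@addrI _ ('D_((w, 0) : R4) l (z, G z))); rewrite M -P.
  move/eqP: E; rewrite mulf_eq0 subr_eq0 => /orP[/eqP //|].
  by rewrite (negbTE Dl).
have compat z : U z -> 'D_((0, 1, 0) : R3) G z + K z * 'D_((0, 0, 1) : R3) G z =
    'D_((1, 0, 0) : R3) K z + G z * 'D_((0, 0, 1) : R3) K z.
  move=> Uz.
  have dG := Coo_diff CGU Uz; have dx := Coo_diff CxU Uz; have dz := Coo_diff CzU Uz.
  exact (compat_algebra (derive_dir3 (xi z) 1 (zeta z) dG) (GE z Uz) (erefl _)
    (derive_subM _ dz dx dG) (derive_subM _ dz dx dG)).
have U0' : U ((c0.1.1.1, c0.1.1.2), c0.1.2) by rewrite -!surjective_pairing.
have [f [N [oN N0 Cf fN HN]]] := frobenius oU U0' CGU CK compat.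
rewrite -!surjective_pairing in N0 fN.
(* The parameter of the constructed family is the value of [u] at the base point [x0]; hence
   [f_k = 1] there. *)
pose k0 := c0.1.2.
have ek : c0.1 = (x0, k0) by rewrite -surjective_pairing.
have N0' : N (x0, k0) by rewrite -ek.
have f0 : f (x0, k0) = k0 by apply: fN.
have inv p : N p -> Z (p.1, f p) /\ family_defect xi zeta f p = 0.
  move=> /HN[[[_ Zp] _] E1 E2]; split => //.
  by rewrite /family_defect /fd1 /fd2 E1 E2 /K subrr.
have qmanN p : N p -> qman (reduced xi zeta) (family_jet r f p).
  by move=> Np a b ab; exact: (qman_family oZ Cx Cz oN Cf inv Np ab).
have xj p : xuu1 (family_jet r f p) = (p.1, f p, fd1 f p) by exact: xuu1_family_jet.
have xj0 : xuu1 (family_jet r f (x0, k0)) = c0.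
  have [_ E1 _] := HN _ N0'.
  by rewrite xj /fd1 E1 f0 /= -ek G0 -surjective_pairing.
(* The jet of the family and the given point [j0] lie on the same manifold over [c0] but may differ
   in the higher pure derivatives; [hdom] carries membership in [Omega] from one to the other. *)
have O0 : Omega (family_jet r f (x0, k0)).
  by apply: (hdom (proj1 Szeta) Qj0 _ ej0 xj0 Oj0); exact: qmanN.
have Cj := Coo_family_jet r oN Cf.
have nO : \forall p \near (x0, k0), Omega (family_jet r f p).
  exact: (Coo_cont Cj N0' (open_nbhs_nbhs (conj oOmega O0))).
have nN : \forall p \near (x0, k0), N p by apply: open_nbhs_nbhs.
exists (f, k0); last first.
  apply: (open_near oN N0') => p Np; rewrite -[jet_of _ _ _]/(family_jet r f p) qchar_family //.
  by have [] := inv p Np.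
split.
- by apply/smooth_nearP; exists N.
- exact: xj0.
- have Ck' : Coo N (fdk f) by exact: Coo_derive.
  have fk1 : fdk f (x0, k0) = 1.
    have S : 'D_1 (fun k => f (x0, k)) k0 = fdk f (x0, k0).
      exact: derive_slice2.
    rewrite -S.
    rewrite (near_eq_derive (g := id)) ?derive_id //.
    have : \forall k \near k0, N (x0, k).
      have cp : {for k0, continuous (fun k : R => (x0, k))}.
        by apply: differentiable_continuous; exact: differentiable_pair.
      exact: (cp _ nN).
    by apply: filterS => k Nk; exact: fN.
  have : \forall p \near (x0, k0), 0 < fdk f p.
    by apply: (cvgr_gt _ (Coo_cont Ck' N0')); rewrite fk1 ltr01.
  by apply: filterS => p /lt0r_neq0/eqP.
- apply: filterS2 nO nN => p Op Np; split => //.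
  have [[[Bp _] _] E1 _] := HN p Np; have [Cc _ lz _] := HG _ Bp.
  have ej : xuu1 (family_jet r f p) = (p.1, f p, G (p.1, f p)) by rewrite xj /fd1 E1.
  have W : over Omega C (family_jet r f p) by split => //=; rewrite ej.
  by rewrite -[jet_of _ _ _]/(family_jet r f p) (LC _ W (qmanN p Np)) ej.
Qed.

Lemma family_defect_near f k0 zeta :
  invariant_family r c0 xi (f, k0) zeta ->
  \forall p \near (x0, k0), family_defect xi zeta f p = 0.
Proof.
apply: filterS => p.
by rewrite -[jet_of _ _ _]/(family_jet r f p) qchar_family.
Qed.

Lemma cont_graph A f p : Coo A f -> A p ->
  {for p, continuous (fun p : R3 => (p.1, f p : R))}.
Proof.
move=> Cf Ap; apply: differentiable_continuous; apply: differentiable_pair.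
  exact: differentiable_fst.
exact: Coo_diff Cf Ap.
Qed.

(** Along the family [l] vanishes, and near the base point [f_1] stays within [e] of [c0.2], where
    [G] is the only solution. This selects the same branch of [u_1] for all families with the base
    point [c0]. *)
Lemma family_pfaff zeta Z C l B e G f k0 :
  [/\ open Z, Z c0.1, Coo Z xi & Coo Z zeta] ->
  [/\ open C, C c0 & agree_on_qman (over Omega C) (reduced xi zeta) L (fun j => l (xuu1 j))] ->
  [/\ open B, B c0.1, 0 < e & forall z u, B z -> `|u - c0.2| < e -> l (z, u) = 0 -> u = G z] ->
  solution_family Omega L c0 (f, k0) ->
  (\forall p \near (x0, k0), family_defect xi zeta f p = 0) ->
  \forall p \near (x0, k0), fd1 f p = G (p.1, f p) /\
    fd2 f p = zeta (p.1, f p) - xi (p.1, f p) * G (p.1, f p).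
Proof.
move=> [oZ Z0 Cx Cz] [oC C0 LC] [oB B0 e0 uG] sol inv.
have [E1 E2] := solution_family_base sol.
have [/smooth_nearP[A [oA A0 Cf]] _ _ nL] := sol.
have cg := cont_graph Cf A0.
have nZB : \forall p \near (x0, k0), (B `&` Z) (p.1, f p).
  by apply: (cg (B `&` Z)); rewrite /= -E1; apply: open_nbhs_nbhs; split; [exact: openI|].
have [A1 [oA1 A10 HA1]] : exists A1 : set R3, [/\ open A1, A1 (x0, k0) &
    forall p, A1 p -> [/\ A p, family_defect xi zeta f p = 0 & (B `&` Z) (p.1, f p)]].
  apply: near_open; have nA : \forall p \near (x0, k0), A p by apply: open_nbhs_nbhs.
  by apply: filterS3 nA inv nZB => p a1 a2 a3; split; [exact a1|exact a2|exact a3].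
have CfA1 : Coo A1 f by move=> n; apply: Ck_sub (Cf n) => p /HA1[].
have invA p : A1 p -> Z (p.1, f p) /\ family_defect xi zeta f p = 0 by move=> /HA1[_ ? []].
have n1 : \forall p \near (x0, k0), A1 p by apply: open_nbhs_nbhs.
have n2 : \forall p \near (x0, k0), `|fd1 f p - c0.2| < e.
  have e1 : `|fd1 f (x0, k0) - c0.2| < e by rewrite E2 subrr normr0.
  exact: (Coo_cont (Coo_fd1 Cf) A0 (near_dist e1)).
have n3 : \forall p \near (x0, k0), C (p.1, f p, fd1 f p).
  have dc : differentiable (fun p : R3 => (p.1, f p, fd1 f p)) (x0, k0).
    apply: (@differentiable_pair _ _ _ _ (fun p : R3 => (p.1, f p)) (fd1 f)).
      by apply: differentiable_pair; [exact: differentiable_fst|exact: Coo_diff Cf A0].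
    exact: Coo_diff (Coo_fd1 Cf) A0.
  apply: (differentiable_continuous dc); apply: open_nbhs_nbhs; split => //=.
  by rewrite -E1 -E2 -surjective_pairing.
apply: filterS2 (filterI n1 nL) (filterI n2 n3) => p [A1p [Op Lp]] [ep Cp].
have [Ap dp [Bp Zp]] := HA1 p A1p.
have Qp : qman (reduced xi zeta) (family_jet r f p).
  by move=> a b ab; exact: (qman_family oZ Cx Cz oA1 CfA1 invA A1p ab).
have xj : xuu1 (family_jet r f p) = (p.1, f p, fd1 f p) by exact: xuu1_family_jet.
have W : over Omega C (family_jet r f p) by split => //=; rewrite xj.
have lp : l (p.1, f p, fd1 f p) = 0.
  by have := LC _ W Qp; rewrite xj => <-.
have Gp : fd1 f p = G (p.1, f p) by exact: uG.
split => //; rewrite -Gp.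
by move/eqP: dp; rewrite /family_defect subr_eq0 => /eqP.
Qed.

(** A reparametrization does not affect the derivatives in [x], so both characteristics give the
    same value of [zeta] on the points of the family, and by [family_chart] these fill a
    neighbourhood of [c0.1]. *)
Lemma family_equiv_germ_eq f k0 f' k0' zeta zeta' :
  solution_family Omega L c0 (f, k0) -> solution_family Omega L c0 (f', k0') ->
  (\forall p \near (x0, k0), family_defect xi zeta f p = 0) ->
  (\forall p \near (x0, k0'), family_defect xi zeta' f' p = 0) ->
  family_equiv c0 (f, k0) (f', k0') -> germ_eq c0 zeta zeta'.
Proof.
move=> sol sol' inv inv' [theta [/smooth_nearP[T [oT T0 CT]] t0 _ nE]].
have [E1 E2] := solution_family_base sol.
have [sf _ /nbhs_singleton fk _] := sol.
have [A [B [Phi [[oA A0 Cf oB CPhi] [HA HB]]]]] := family_chart sf fk.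
have [W [oW W0 HW]] := near_open nE.
have nth : \forall p \near (x0, k0), family_defect xi zeta' f' (p.1, theta p.2) = 0.
  have dth : differentiable (fun p : R3 => (p.1, theta p.2)) (x0, k0).
    have dt : differentiable (theta \o (snd : R3 -> R)) (x0, k0).
      by apply: differentiable_comp; [exact: differentiable_snd|exact: Coo_diff CT T0].
    exact: (differentiable_pair (@differentiable_fst R (R * R)%type R (x0, k0)) dt).
  have := differentiable_continuous dth; rewrite /prop_for /continuous_at /= t0.
  by move=> c; exact: (c _ inv').
have nW : \forall p \near (x0, k0), W p by apply: open_nbhs_nbhs.
have key : \forall p \near (x0, k0), zeta (p.1, f p) = zeta' (p.1, f p).
  apply: filterS3 nW inv nth => -[x k] Wp d1 d2.
  have slice (v : R * R) : 'D_((v, 0) : R3) f' (x, theta k) = 'D_((v, 0) : R3) f (x, k).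
    rewrite -!derive_slice; apply: near_eq_derive.
    have N : \forall y \near x, W (y, k).
      exact: (@cont_pairl R _ _ x k W (open_nbhs_nbhs (conj oW Wp))).
    by apply: filterS N => y Wy; exact: HW (y, k) Wy.
  have e1 : fd1 f' (x, theta k) = fd1 f (x, k) by exact: slice.
  have e2 : fd2 f' (x, theta k) = fd2 f (x, k) by exact: slice.
  have e0 : f' (x, theta k) = f (x, k) by exact: HW (x, k) Wp.
  move: d1 d2; rewrite /family_defect /= e0 e1 e2.
  by move=> /eqP; rewrite subr_eq0 => /eqP <- /eqP; rewrite subr_eq0 => /eqP /addIr.
have B0 : B c0.1 by rewrite E1; case: (HA _ A0).
have cch := cont_graph CPhi B0.
have P0 : (c0.1.1, Phi c0.1) = (x0, k0) by rewrite [in Phi _]E1; have [_ -> _] := HA _ A0.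
rewrite /prop_for /continuous_at P0 in cch.
have nB : \forall z \near c0.1, B z by apply: open_nbhs_nbhs.
apply: filterS2 nB (cch _ key) => z Bz /=.
by have [_ ->] := HB z Bz; rewrite -surjective_pairing.
Qed.

(** Both families satisfy the same equations [u_1 = G], [u_2 = zeta - xi G]. Differentiating
    [f' (x, Psi (x, k)) = f (x, k)] in [x] therefore leaves [f'_k * Psi_x = 0]. *)
Lemma germ_eq_family_equiv f k0 f' k0' zeta :
  singular_reduction_operator Omega L c0 xi zeta ->
  solution_family Omega L c0 (f, k0) -> solution_family Omega L c0 (f', k0') ->
  (\forall p \near (x0, k0), family_defect xi zeta f p = 0) ->
  (\forall p \near (x0, k0'), family_defect xi zeta f' p = 0) ->
  family_equiv c0 (f, k0) (f', k0').
Proof.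
move=> Hs sol sol' inv inv'.
have [Z [C [sigma [l [B [e [G [HZ [oC C0 Cl HC] LC [oB B0 e0 CG] [G0 HG uG]]]]]]]]] := singular_reduction_data Hs.
have pf := family_pfaff HZ (And3 oC C0 LC) (And4 oB B0 e0 uG) sol inv.
have pf' := family_pfaff HZ (And3 oC C0 LC) (And4 oB B0 e0 uG) sol' inv'.
have [E1 _] := solution_family_base sol; have [E1' _] := solution_family_base sol'.
have [/smooth_nearP[A [oA A0 Cf]] _ nfk _] := sol.
have [sf' _ /nbhs_singleton fk' _] := sol'.
have [A' [B' [Phi [[oA' A'0 Cf' oB' CPhi] [HA' HB']]]]] := family_chart sf' fk'.
pose D := A `&` [set p | B' (p.1, f p)].
have Cgr n : Ck n A (fun p : R3 => (p.1, f p)).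
  by apply: Ck_pair => //; exact: Ck_fst.
have oD : open D by apply: open_preimage_within => // p Ap; exact: (Ck_cont (Cgr 0%N) Ap).
have D0 : D (x0, k0) by split => //=; rewrite -E1 E1'; case: (HA' _ A'0).
(* The parameter of the member of the second family that passes through the point
   [(x, f (x, k))]. *)
pose Psi (p : R3) := Phi (p.1, f p).
have CPsi : Coo D Psi.
  move=> n; have CgD : Ck n D (fun p : R3 => (p.1, f p)) by apply: Ck_sub (Cgr n) => p [].
  by apply: (@Ck_compR _ _ _ _ D B' (fun p : R3 => (p.1, f p)) Phi _ oD _ CgD (CPhi n)) => p [].
have Psi0 : Psi (x0, k0) = k0' by rewrite /Psi /= -E1 E1'; have [_ -> _] := HA' _ A'0.
have fPsi p : D p -> A' (p.1, Psi p) /\ f' (p.1, Psi p) = f p by move=> [_ /HB'].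
have good : \forall p \near (x0, k0), [/\ D p,
    fd1 f p = fd1 f' (p.1, Psi p), fd2 f p = fd2 f' (p.1, Psi p) & fdk f p <> 0].
  have nD : \forall p \near (x0, k0), D p by apply: open_nbhs_nbhs.
  have cP := cont_graph CPsi D0; rewrite /prop_for /continuous_at /= Psi0 in cP.
  apply: filterS2 (filterI nD nfk) (filterI pf (cP _ pf')) => p [Dp kp] [[p1 p2] /= [p1' p2']].
  have [_ fp] := fPsi p Dp.
  by split; [exact: Dp|rewrite p1' fp|rewrite p2' fp|exact: kp].
have [D2 [oD2 D20 HD2]] := near_open good.
have dPsi (v : R * R) p : D2 p -> 'D_((v, 0) : R3) Psi p = 0.
  move=> D2p; have [Dp q1 q2 _] := HD2 p D2p; have [A'p _] := fPsi p Dp.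
  have df' := Coo_diff Cf' A'p; have dP := Coo_diff CPsi Dp.
  have df := Coo_diff Cf Dp.1.
  have d1 := @differentiable_fst R (R * R)%type R p.
  have D1 := @derive_graph _ _ _ fst Psi f' p (v, 0) d1 dP df'.
  have D2' : 'D_((v, 0) : R3) (fun p => f' (p.1, Psi p)) p = 'D_((v, 0) : R3) f p.
    by apply: near_eq_derive; apply: (open_near oD Dp) => q /fPsi[].
  have E := etrans (esym D1) D2'.
  rewrite derive_fst (derive_dir_plane v df') (derive_dir_plane v df) q1 q2 in E.
  have /eqP : 'D_((v, 0) : R3) Psi p * fdk f' (p.1, Psi p) = 0.
    by apply: (addrI (v.1 * fd1 f' (p.1, Psi p) + v.2 * fd2 f' (p.1, Psi p))); rewrite addr0; exact: E.
  have [_ _ fk0] := HA' _ A'p.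
  by rewrite mulf_eq0 => /orP[/eqP //|/eqP].
have /nbhs_ballP[d /= d0 Hd] := open_nbhs_nbhs (conj oD2 D20).
have bx0 : ball x0 d x0 by exact: ballxx.
(* The segment from [x0] to [x] stays in the ball, so the mean value theorem turns the vanishing
   derivative into constancy. *)
have const p : ball (x0, k0) d p -> Psi p = Psi (x0, p.2).
  case: p => x k [/= bx bk].
  have line (t : R) : (x0, k) + t *: (x - x0, 0) = (x0 + t *: (x - x0), k) :> R3.
    by congr pair; rewrite /= scaler0 addr0.
  have inb (t : R) : `|t| <= `|1 : R| -> D2 ((x0, k) + t *: (x - x0, 0)).
    move=> t1; rewrite line; apply: Hd; split => //=.
    move: bx; rewrite -!ball_normE /= opprD addNKr normrN normrZ => bx.
    apply: le_lt_trans bx; rewrite [`|x0 - x|]distrC ler_piMl //.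
    by rewrite normr1 in t1.
  have [t /inb D2t|t t1] := @mvt_dir R _ Psi (x0, k) (x - x0, 0) 1.
    apply: diff_derivable; apply: Coo_diff CPsi _; by case: (HD2 _ D2t).
  have xE : x0 + 1 *: (x - x0) = x by rewrite scale1r addrC subrK.
  by rewrite (dPsi _ _ (inb t t1)) mulr0 line xE => /eqP; rewrite subr_eq0 => /eqP.
pose theta (k : R) := Psi (x0, k).
pose T := ball k0 d.
have oT : open T by exact: ball_open.
have TD k : T k -> D2 (x0, k) by move=> Tk; apply: Hd; split.
have CT : Coo T theta.
  move=> n; have Cp : Ck n T (fun k : R => (x0, k)).
    by apply: Ck_pair => //; [exact: Ck_cst|exact: Ck_id].
  apply: (@Ck_compR _ _ _ _ T D (fun k : R => (x0, k)) Psi _ oT _ Cp (CPsi n)) => k /TD D2k.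
  by case: (HD2 _ D2k).
exists theta; split.
- by apply/smooth_nearP; exists T; split => //; exact: ballxx.
- exact: Psi0.
- apply: (open_near oT (ballxx _ d0)) => k Tk.
  have D2k := TD k Tk; have [Dk _ _ fk0] := HD2 _ D2k.
  have [A'k _] := fPsi _ Dk.
  have df' := Coo_diff Cf' A'k; have dth := Coo_diff CT Tk; have df := Coo_diff Cf Dk.1.
  have S := derive_slice2 f x0 k (1 : R).
  have Dg := @derive_graph _ _ _ (fun _ : R => x0) theta f' k (1 : R) (differentiable_cst _ _) dth df'.
  have E : 'D_1 (fun k => f' (x0, theta k)) k = 'D_1 (fun k => f (x0, k)) k.
    apply: near_eq_derive; apply: (open_near oT Tk) => y /TD D2y.
    by have [Dy _ _ _] := HD2 _ D2y; have [_ ->] := fPsi _ Dy.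
  (* If the derivative of [theta] vanished, the chain rule would give [f_k = 0]. *)
  rewrite derive1E => t0; rewrite t0 derive_cst mul0r addr0 in Dg.
  apply: fk0; apply: etrans (esym S) (etrans (esym E) (etrans Dg _)).
  exact: derive0.
- apply/nbhs_ballP; exists d => // p bp /=.
  have [Dp _ _ _] := HD2 _ (Hd _ bp).
  by rewrite /theta -const //; have [_] := fPsi p Dp.
Qed.

End Correspondence.

Theorem corollary13 (R : realType) (r : nat) (Omega : set (jet R r))
    (L : jet R r -> R) (c0 : R * R * R * R) (xi : R * R * R -> R)
    (hr : (1 < r)%N)
    (hOmega : open Omega) (hL : smooth_on Omega L)
    (hord : diff_order Omega L r%:Z)
    (hxi : smooth_near c0.1 xi)
    (hdom : eliminable_domain Omega c0 xi)
    (hsing : first_coorder_singular Omega L c0 xi)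
    (hultra : forall zeta, inS Omega c0 xi zeta ->
       ~ ultra_singular Omega L c0 (reduced xi zeta))
    (hrank : forall zeta, inS Omega c0 xi zeta -> max_rank Omega L c0 xi zeta) :
  bijection_mod
    (solution_family Omega L c0) (family_equiv c0)
    (singular_reduction_operator Omega L c0 xi) (germ_eq c0)
    (invariant_family r c0 xi).
Proof.
have CL : Coo Omega L by apply/(smooth_Coo L _ hOmega).
have [Zx [oZx Zx0 Cxi]] := (smooth_nearP c0.1 xi _).1 hxi.
split.
- by move=> [f k0]; exact: (solution_family_sing hr hOmega CL oZx Zx0 Cxi hsing hultra hrank).
- move=> zeta Hz; have [fk sol inv] := sing_solution_family hr hOmega CL oZx Zx0 Cxi hdom hsing hultra hrank Hz.
  by exists fk.
move=> [f k0] [f' k0'] zeta zeta' sol sol' Hz Hz' inv inv'.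
have d := family_defect_near hr inv; have d' := family_defect_near hr inv'.
split; first exact: (family_equiv_germ_eq hr sol sol' d d').
(* It remains to see that the second family is invariant for [zeta] as well: near the base point its
   values stay where the two germs coincide. *)
move=> E; apply: (germ_eq_family_equiv hr hOmega oZx Zx0 Cxi hsing hultra hrank Hz sol sol' d).
have [E1 _] := solution_family_base hr sol'.
have [/smooth_nearP[A [oA A0 Cf]] _ _ _] := sol'.
have cg := cont_graph Cf A0; rewrite /prop_for /continuous_at /= -E1 in cg.
by apply: filterS2 d' (cg _ E) => p; rewrite /family_defect => dp ->.
Qed.
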